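(* Let $\phi:[0,1]\to\mathbb{R}_{<0}$ be a negative function and, for $y\in\mathbb{T}$ and $\varepsilon>0$, consider on the manifold $(\mathbb{T},dx)$ the potential $$ V_{y,\varepsilon}(x) = \begin{cases} 1 + \varepsilon\, \phi\left( \frac{x-y}{\varepsilon} \right) & \text{if } y \leq x \leq y+ \varepsilon, \\ 1 & \text{otherwise.} \end{cases}$$ Let $(\phi_k)$ be the sequence of eigenfunctions of $-\Delta+V_{y,\varepsilon}$ on $\mathbb{T}$, with associated eigenvalues $\lambda_k$. Then for every $\varepsilon>0$ there exists $N_\varepsilon\in\mathbb{R}$ such that, for all $N\leq N_\varepsilon$, the function $$ x\mapsto \sum_{k\leq N} \frac{1}{\sqrt{\lambda_k}} \frac{|\phi_k(x)|}{\|\phi_k\|_{L^{\infty}(\mathbb{T})}}$$ has a strict local minimum at some point $x_0$ with $y\leq x_0\leq y+\varepsilon$. Moreover, $N_{\varepsilon}\to\infty$ as $\varepsilon\to 0$.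
   Context: $\mathbb{T}$ is the one-dimensional torus (circle) with its standard metric $dx$, and $\Delta=d^2/dx^2$. The potential $V_{y,\varepsilon}$ is a slight local perturbation, near the point $y$, of the constant potential $1$. The eigenfunctions satisfy $-\Delta\phi_k+V_{y,\varepsilon}\phi_k=\lambda_k\phi_k$ and are listed in order of increasing eigenvalue. The function $\phi$ (without index) is the profile of the perturbation and is unrelated to the eigenfunctions $\phi_k$.
   Formalization: The claim is restricted to 3 ≤ N ≤ N_ε (N counts eigenfunctions), since for N = 0, 1, 2 it contradicts N_ε → ∞ (constant sum; concave sum near the interval); φ is assumed integrable on [0,1] so that the operator is well defined. *)

(* Defs.v *)
From HB Require Import structures.
From mathcomp Require Import all_boot all_order all_algebra.
From mathcomp Require Import all_classical all_reals all_analysis.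
Set Implicit Arguments.
Unset Strict Implicit.
Unset Printing Implicit Defensive.
Import Order.TTheory GRing.Theory Num.Theory.
Import numFieldNormedType.Exports.
Local Open Scope classical_set_scope.
Local Open Scope ring_scope.

(* The circle of circumference L is R modulo L: functions on it are L-periodic
   functions on R, its points are given by real representatives, and its
   measure dx is Lebesgue measure on the fundamental domain [0, L[. *)

Definition periodic_on (R : realType) (L : R) (f : R -> R) : Prop :=
  forall x, f (x + L) = f x.

Definition circle_measure (R : realType) (L : R) :=
  mrestr (@lebesgue_measure R) (measurable_itv `[0, L[).

(* The representative in [0, L[ of x modulo L, for L > 0. *)
Definition circle_rep (R : realType) (L x : R) : R :=
  x - L * (Num.floor (x / L))%:~R.

Definition potential (R : realType) (L : R) (phi : R -> R) (y eps : R) (x : R)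
    : R :=
  let t := circle_rep L (x - y) in
  if t <= eps then 1 + eps * phi (t / eps) else 1.

(* u is a solution of - u'' + V u = lambda u on the circle. As V need not be
   continuous, this is meant in the Caratheodory sense: u is differentiable,
   u' is absolutely continuous and the equation holds almost everywhere; that
   is, u' is an indefinite Lebesgue integral of (V - lambda) u. *)
Definition eigenfunction (R : realType) (L : R) (V : R -> R) (lambda : R)
    (u : R -> R) : Prop :=
  [/\ periodic_on L u,
      exists x, u x != 0,
      forall x, derivable u x 1 &
      forall a b, a <= b ->
        (@lebesgue_measure R).-integrable `[a, b]
          (EFin \o (fun x => (V x - lambda) * u x)) /\
        derive1 u b - derive1 u a =
          \int[@lebesgue_measure R]_(x in `[a, b]) ((V x - lambda) * u x)].

(* u 0, u 1, ... is an orthonormal basis of L^2 of the circle made of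
   eigenfunctions of - d^2/dx^2 + V, listed by nondecreasing eigenvalue
   (with multiplicity). *)
Record eigenbasis (R : realType) (L : R) (V : R -> R) (lambda : nat -> R)
    (u : nat -> R -> R) : Prop := Eigenbasis {
  eigenbasis_eigen : forall k, eigenfunction L V (lambda k) (u k);
  eigenbasis_sorted : forall j k, (j <= k)%N -> lambda j <= lambda k;
  eigenbasis_orthonormal : forall j k,
    \int[circle_measure L]_x (u j x * u k x) = (j == k)%:R;
  eigenbasis_complete : forall f : R -> R,
    f \in Lfun (circle_measure L) 2%:E ->
    (forall k, \int[circle_measure L]_x (f x * u k x) = 0) ->
    {ae circle_measure L, forall x, f x = 0} }.

Definition sup_norm (R : realType) (L : R) (f : R -> R) : R :=
  fine ('N[circle_measure L]_+oo[EFin \o f])%E.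

(* The sum over the first N eigenfunctions; u and lambda are indexed from 0.
   For phi < 0 and small eps, u 0 is nearly constant, u 1 is close to a cosine
   with a maximum near y, and u 2 is close to a sine vanishing near y: N = 3 is
   the first length for which the sum has a kink near y. *)
Definition landscape (R : realType) (L : R) (lambda : nat -> R)
    (u : nat -> R -> R) (N : nat) (x : R) : R :=
  \sum_(k < N) (Num.sqrt (lambda k))^-1 * (`|u k x| / sup_norm L (u k)).

Definition strict_local_min (R : realType) (f : R -> R) (x0 : R) : Prop :=
  \forall x \near x0^', f x0 < f x.

(* Main.v *)
From HB Require Import structures.
Require Import Defs.
From mathcomp Require Import all_boot all_order all_algebra.
From mathcomp Require Import all_classical all_reals all_analysis.
From mathcomp Require Import measurable_realfun ess_sup_inf ring lra.
Import Order.TTheory GRing.Theory Num.Theory.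
Import numFieldNormedType.Exports.
Local Open Scope classical_set_scope.
Local Open Scope ring_scope.
Set Implicit Arguments.
Unset Strict Implicit.
Unset Printing Implicit Defensive.

(** The integral of |V - 1| is eps ^ 2 times the integral of |phi|, so that for
    small eps the operator - d^2/dx^2 + V is a small perturbation of
    - d^2/dx^2 + 1, whose eigenvalues are 1 + w_j ^ 2 with w_j = 2 pi j / L and
    whose eigenfunctions are the combinations of cos (w_j (x - y)) and
    sin (w_j (x - y)).  Everything below is quantitative in the integral of
    |V - 1| and in eps, uniformly over the first N eigenfunctions.

    Upper bounds on the eigenvalues.  A Sobolev inequality makes the quadratic
    form of the operator coercive.  Completeness of the eigenbasis then yields the
    Courant-Fischer principle, and the trigonometric functions as trial functions
    give lambda_k <= 1 + w_(ceil (k / 2)) ^ 2 (eigenvalue_upper), because V <= 1.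

    Shape of the eigenfunctions.  The Wronskian of an eigenfunction u and of a
    wave of frequency sqrt (lambda - 1) is almost conserved, so u is close to a
    wave; periodicity forces that frequency to be close to some w_j.  Hence u is
    C^1-close to a cos (w_j (x - y)) + b sin (w_j (x - y)) (near_sinusoid).

    Phase of the eigenfunctions.  Integrating the equation against these two
    functions over the circle gives
      (lambda - 1 - w_j ^ 2) <u, cos> = int (V - 1) u cos
    and the same identity with sin.  If u has no zero in [y, y + eps] then
    (V - 1) u has a constant sign there and vanishes elsewhere, whereas cos is
    close to 1 and sin is O(eps): dividing the two identities shows that <u, sin>
    is O(eps), so that for j > 0 the function u is close to a cos (phase_bound).
    If u has a zero in [y, y + eps], then j > 0 and u is close to b sin.  Thus
    near the interval each eigenfunction is either flat, that is, without zero
    and with small slope, or crossing, that is, with a zero in the interval and a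
    slope bounded away from 0.  The first three have j <= 1, and by orthogonality
    they are one almost constant function, one cosine and one sine.

    The minimum.  Moving away from [y, y + eps], each crossing term of the sum
    grows at a definite rate while the others vary slowly, so that the minimum of
    the sum over [y - eps, y + 2 eps] is attained at a point x0 of [y, y + eps].
    It is strict, because on each side of x0, close to it, all the
    eigenfunctions have a constant sign and the sum is strictly concave: |u|''
    = (V - lambda) |u| <= (1 - lambda) |u| is at most tiny for all of them and
    definitely negative for the cosine (strict_local_min_weighted_sum).

    For each fixed N this works as soon as eps is small enough.  N_eps is the
    largest M <= 1 / eps such that all lengths from 3 to M work for this eps. *)

Local Notation "'\intab_' [ a , b ] f" := (Rintegral (@lebesgue_measure _) `[a, b]%classic f)
  (at level 36, f at level 36, format "'\intab_' [ a ,  b ]  f").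
Local Notation integrable_on a b f :=
  ((@lebesgue_measure _).-integrable `[a, b]%classic (EFin \o f)).

(** * Calculus on segments *)

Section SegmentCalculus.
Context {R : realType}.
Implicit Types (f g h F : R -> R) (a b c x : R).

Definition C1 (f f' : R -> R) :=
  (forall x, is_derive x 1 f (f' x)) /\ continuous f'.

Lemma C1_continuous f f' : C1 f f' -> continuous f.
Proof.
by move=> [df _] x; apply/differentiable_continuous/derivable1_diffP;
  have [] := df x.
Qed.

Lemma continuous_integrable f a b : continuous f -> integrable_on a b f.
Proof.
move=> cf; apply: continuous_compact_integrable; first exact: segment_compact.
by apply: continuous_subspaceT.
Qed.

Lemma integrable_subitv f a b c d : a <= c -> d <= b -> integrable_on a b f ->
  integrable_on c d f.
Proof.
move=> ac db; apply: integrableS => //.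
by apply: subset_itv; rewrite bnd_simp.
Qed.

Lemma eq_integrable_on f g a b : (forall x, a <= x <= b -> f x = g x) ->
  integrable_on a b f -> integrable_on a b g.
Proof.
move=> fg; apply: eq_integrable => // x; rewrite inE /= in_itv /= => /fg.
by move=> ->.
Qed.

Lemma integrableD_on f g a b : integrable_on a b f -> integrable_on a b g ->
  integrable_on a b (fun x => f x + g x).
Proof.
by move=> fi gi; apply: (integrableD _ fi gi).
Qed.

Lemma integrableZ_on f k a b : integrable_on a b f ->
  integrable_on a b (fun x => k * f x).
Proof.
by move=> fi; apply: (integrableZl _ k fi).
Qed.

Lemma integrableB_on f g a b : integrable_on a b f -> integrable_on a b g ->
  integrable_on a b (fun x => f x - g x).
Proof.
by move=> fi gi; apply: (integrableB _ fi gi).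
Qed.

Lemma integrable_norm_on f a b : integrable_on a b f ->
  integrable_on a b (fun x => `|f x|).
Proof. by move=> /integrable_norm. Qed.

(** A continuous function is bounded on the segment, which makes the product of an
    integrable function with it integrable. *)
Lemma integrableM_on f g a b : integrable_on a b f -> continuous g ->
  integrable_on a b (fun x => f x * g x).
Proof.
move=> fi cg.
have [ab|ab] := leP a b; last first.
  rewrite set_itv_ge ?bnd_simp -?ltNge//; exact: integrable_set0.
have : {within `[a, b], continuous (fun x => `|g x|)}.
  by apply: continuous_subspaceT => x; apply: continuous_comp; [exact: cg|exact: norm_continuous].
move=> /(EVT_max ab)[c _ cmax].
have mg : measurable_fun `[a, b] g.
  by apply: measurable_funTS; exact: continuous_measurable_fun.
have mf : measurable_fun `[a, b] f.
  by have /integrableP[/measurable_EFinP] := fi.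
apply: (le_integrable _ _ _ (integrableZ_on `|g c| fi)) => //.
  by apply/measurable_EFinP; exact: measurable_funM.
move=> x xab /=; rewrite lee_fin !normrM mulrC ler_wpM2r//.
  by rewrite [leRHS]ger0_norm//; apply: cmax; move: xab; rewrite in_itv.
Qed.

Lemma intabD f g a b : integrable_on a b f -> integrable_on a b g ->
  \intab_[a, b] (fun x => f x + g x) = \intab_[a, b] f + \intab_[a, b] g.
Proof. by move=> fi gi; rewrite RintegralD. Qed.

Lemma intabB f g a b : integrable_on a b f -> integrable_on a b g ->
  \intab_[a, b] (fun x => f x - g x) = \intab_[a, b] f - \intab_[a, b] g.
Proof. by move=> fi gi; rewrite RintegralB. Qed.

Lemma intabZ f k a b : integrable_on a b f ->
  \intab_[a, b] (fun x => k * f x) = k * \intab_[a, b] f.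
Proof. by move=> fi; rewrite RintegralZl. Qed.

Lemma eq_intab f g a b : (forall x, a <= x <= b -> f x = g x) ->
  \intab_[a, b] f = \intab_[a, b] g.
Proof. by move=> fg; apply: eq_Rintegral => x; rewrite inE /= in_itv => /fg. Qed.

Lemma le_intab f g a b : integrable_on a b f -> integrable_on a b g ->
  (forall x, a <= x <= b -> f x <= g x) ->
  \intab_[a, b] f <= \intab_[a, b] g.
Proof.
move=> fi gi fg; apply: le_Rintegral => // x; rewrite /= in_itv; exact: fg.
Qed.

Lemma intab_ge0 f a b : (forall x, a <= x <= b -> 0 <= f x) ->
  0 <= \intab_[a, b] f.
Proof. by move=> f0; apply: Rintegral_ge0 => x; rewrite /= in_itv; exact: f0. Qed.

Lemma le_norm_intab f a b : integrable_on a b f ->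
  `|\intab_[a, b] f| <= \intab_[a, b] (fun x => `|f x|).
Proof. by move=> fi; apply: le_normr_Rintegral. Qed.

Lemma intab_cst k a b : a <= b -> \intab_[a, b] (fun=> k) = k * (b - a).
Proof.
move=> ab; rewrite Rintegral_cst//= lebesgue_measure_itv/= lte_fin.
by case: ltgtP ab => //= ->; rewrite subrr.
Qed.

Lemma intab_point f a : \intab_[a, a] f = 0.
Proof. by rewrite set_itv1 Rintegral_set1. Qed.

Lemma intab_cat f a b c : a <= b -> b <= c -> integrable_on a c f ->
  \intab_[a, c] f = \intab_[a, b] f + \intab_[b, c] f.
Proof.
move=> ab bc fi; have := @Rintegral_itvB _ f (BLeft a) (BRight c) b fi.
rewrite !bnd_simp => /(_ ab bc) /eqP; rewrite subr_eq => /eqP ->.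
rewrite addrC Rintegral_itv_obnd_cbnd//.
apply: integrableS fi => //.
by apply: subset_itv; rewrite bnd_simp.
Qed.

Lemma intab_norm_sub f a b c d : a <= c -> d <= b -> integrable_on a b f ->
  \intab_[c, d] (fun x => `|f x|) <= \intab_[a, b] (fun x => `|f x|).
Proof.
move=> ac db fi.
have [cd|dc] := leP c d; last first.
  rewrite [X in X <= _]Rintegral_mkcond /=.
  rewrite set_itv_ge ?bnd_simp -?ltNge// -Rintegral_mkcond Rintegral_set0.
  exact: intab_ge0.
have ni := integrable_norm_on fi.
rewrite (intab_cat (b := c) _ _ ni)//; last by rewrite (le_trans cd).
rewrite (intab_cat (a := c) (b := d))//; last exact: integrable_subitv ni.
have := @intab_ge0 (fun x => `|f x|) a c (fun _ _ => normr_ge0 _).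
have := @intab_ge0 (fun x => `|f x|) d b (fun _ _ => normr_ge0 _).
lra.
Qed.

Lemma intab_bound f k a b : a <= b -> integrable_on a b f ->
  (forall x, a <= x <= b -> `|f x| <= k) -> `|\intab_[a, b] f| <= k * (b - a).
Proof.
move=> ab fi fk; rewrite (le_trans (le_norm_intab fi))// -intab_cst//.
apply: le_intab => //; first exact: integrable_norm_on.
by apply: continuous_integrable => x; exact: cst_continuous.
Qed.

Lemma intab_bound_mul f g k a b : integrable_on a b f -> continuous g ->
  (forall x, a <= x <= b -> `|g x| <= k) ->
  `|\intab_[a, b] (fun x => f x * g x)| <= k * \intab_[a, b] (fun x => `|f x|).
Proof.
move=> fi cg gk; have fgi := integrableM_on fi cg.
rewrite (le_trans (le_norm_intab fgi))// -intabZ; last exact: integrable_norm_on.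
apply: le_intab; [exact: integrable_norm_on|exact/integrableZ_on/integrable_norm_on|].
by move=> x xab; rewrite normrM mulrC ler_wpM2r// gk.
Qed.

Lemma C1_intab f f' a b : C1 f f' -> a <= b -> \intab_[a, b] f' = f b - f a.
Proof.
move=> [df cf']; rewrite le_eqVlt => /predU1P[->|ab].
  by rewrite intab_point subrr.
have cf := C1_continuous (conj df cf').
have dfx x : derivable f x 1 by have [] := df x.
rewrite /Rintegral (@continuous_FTC2 _ f' f)//.
- by apply: continuous_subspaceT.
- split=> //; first exact/cvg_at_right_filter/cf.
  exact/cvg_at_left_filter/cf.
- by move=> x _; rewrite derive1E; have /@derive_val := df x.
Qed.

Lemma continuous_primitive f a x : continuous f -> a < x ->
  is_derive x 1 (fun z => \intab_[a, z] f) (f x).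
Proof.
move=> cf ax; have xu : x < x + 1 by rewrite ltrDl.
have fi : integrable_on a (x + 1) f by exact: continuous_integrable.
have [dF Fx] := continuous_FTC1_closed xu fi ax (cf x).
by apply: DeriveDef; [exact: dF|rewrite -derive1E; exact: Fx].
Qed.

Lemma primitive_continuous_within f a b : a <= b -> integrable_on a b f ->
  {within `[a, b], continuous (fun z => \intab_[a, z] f)}.
Proof. by move=> ab fi; have := parameterized_integral_continuous ab fi. Qed.

End SegmentCalculus.

(** * Integration by parts with an absolutely continuous factor *)

Section AbsolutelyContinuous.
Context {R : realType}.
Implicit Types (f g h F : R -> R) (a b c x : R).

Let defect g f f' a b := \intab_[a, b] (fun x => g x * f x) -
   ((\intab_[a, b] g) * f b -
    \intab_[a, b] (fun x => (\intab_[a, x] g) * f' x)).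

Lemma primitiveM_integrable g f' a b : a <= b -> integrable_on a b g ->
  continuous f' -> integrable_on a b (fun x => (\intab_[a, x] g) * f' x).
Proof.
move=> ab gi cf'; apply: integrableM_on => //.
apply: continuous_compact_integrable; first exact: segment_compact.
exact: primitive_continuous_within.
Qed.

Lemma defect_continuous g f f' a b : a < b -> continuous g -> C1 f f' ->
  defect g f f' a b = 0.
Proof.
move=> ab cg Cf; have [df cf'] := Cf; have cf := C1_continuous Cf.
rewrite /defect.
have gi c d : integrable_on c d g by exact: continuous_integrable.
have ctw h : continuous h -> {within `[a, b], continuous h}.
  by move=> ch; apply: continuous_subspaceT.
have dG x : x \in `]a, b[ -> is_derive x 1 (fun z => \intab_[a, z] g) (g x).
  by rewrite in_itv /= => /andP[ax xb]; exact: continuous_primitive.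
have := @Rintegration_by_parts R (fun z => \intab_[a, z] g) f g f' a b ab.
rewrite intab_point mul0r subr0 => ->; first by lra.
- exact: ctw.
- have := primitive_continuous_within (ltW ab) (gi a b).
  move=> /(continuous_within_itvP _ ab)[_ ca cb]; split=> //.
  by move=> x /dG[].
- by move=> x /dG dGx; rewrite derive1E; exact: derive_val.
- exact: ctw.
- split; first by move=> x _; have [] := df x.
    exact/cvg_at_right_filter/cf.
  exact/cvg_at_left_filter/cf.
- by move=> x _; rewrite derive1E; have /@derive_val := df x.
Qed.

Lemma continuous_bounded f a b : a <= b -> continuous f ->
  exists2 k, 0 <= k & forall x, a <= x <= b -> `|f x| <= k.
Proof.
move=> ab cf.
have : {within `[a, b], continuous (fun x => `|f x|)}.
  by apply: continuous_subspaceT => x; apply: continuous_comp; [exact: cf|exact: norm_continuous].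
move=> /(EVT_max ab)[c _ cmax]; by exists `|f c|.
Qed.

(** The defect is Lipschitz in g for the L^1 norm.  It vanishes for continuous g,
    and these are dense in L^1, so that it vanishes for all integrable g (defect0). *)
Lemma defect_bound f f' a b : a < b -> C1 f f' ->
  exists2 k, 0 <= k & forall g, integrable_on a b g ->
    `|defect g f f' a b| <= k * \intab_[a, b] (fun x => `|g x|).
Proof.
move=> ab Cf; have [df cf'] := Cf; have cf := C1_continuous Cf.
have [k k0 kP] := continuous_bounded (ltW ab) cf.
have [k' k'0 k'P] := continuous_bounded (ltW ab) cf'.
exists (k + k + k' * (b - a)).
  by rewrite !addr_ge0// mulr_ge0// subr_ge0 ltW.
move=> g gi; rewrite /defect.
set N := \intab_[a, b] (fun x => `|g x|).
have N0 : 0 <= N by apply: intab_ge0.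
have h1 := intab_bound_mul gi cf kP.
have h2 : `|(\intab_[a, b] g) * f b| <= N * k.
  rewrite normrM ler_pM//; first exact: le_norm_intab.
  by rewrite kP// lexx ltW.
have h3 : `|\intab_[a, b] (fun x => (\intab_[a, x] g) * f' x)| <= N * k' * (b - a).
  apply: intab_bound; [exact: ltW|exact: primitiveM_integrable (ltW ab) gi cf'|].
  move=> x xab; rewrite normrM ler_pM//; last exact: k'P.
  have /andP[ax xb] := xab.
  rewrite (le_trans (le_norm_intab _))//; first exact: integrable_subitv gi.
  exact: intab_norm_sub.
have := ler_normB (\intab_[a, b] (fun x => g x * f x)) ((\intab_[a, b] g) * f b -
    \intab_[a, b] (fun x => (\intab_[a, x] g) * f' x)).
have := ler_normB ((\intab_[a, b] g) * f b)
    (\intab_[a, b] (fun x => (\intab_[a, x] g) * f' x)).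
rewrite -/N in h1.
have -> : (k + k + k' * (b - a)) * N = k * N + N * k + N * k' * (b - a) by ring.
lra.
Qed.

Lemma defectB f f' g h a b : a < b -> C1 f f' ->
  integrable_on a b g -> integrable_on a b h ->
  defect (fun x => g x - h x) f f' a b = defect g f f' a b - defect h f f' a b.
Proof.
move=> ab Cf gi hi; have [df cf'] := Cf; have cf := C1_continuous Cf.
rewrite /defect intabB//.
have -> : \intab_[a, b] (fun x => (g x - h x) * f x) =
   \intab_[a, b] (fun x => g x * f x) - \intab_[a, b] (fun x => h x * f x).
  rewrite -intabB; [|exact: integrableM_on..].
  by apply: eq_intab => x _; rewrite mulrBl.
have -> : \intab_[a, b] (fun x => (\intab_[a, x] (fun z => g z - h z)) * f' x) =
   \intab_[a, b] (fun x => (\intab_[a, x] g) * f' x) -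
   \intab_[a, b] (fun x => (\intab_[a, x] h) * f' x).
  rewrite -intabB; [|exact: primitiveM_integrable (ltW ab) _ cf'..].
  apply: eq_intab => x /andP[ax xb]; rewrite intabB ?mulrBl//.
    exact: integrable_subitv gi.
  exact: integrable_subitv hi.
by ring.
Qed.

Lemma defect0 g f f' a b : a < b -> integrable_on a b g -> C1 f f' ->
  defect g f f' a b = 0.
Proof.
move=> ab gi Cf; have [k k0 kP] := defect_bound ab Cf.
apply/eqP; rewrite -normr_le0; apply/ler_addgt0Pr => e e0; rewrite add0r.
have := @approximation_continuous_integrable R `[a, b] g.
rewrite /= lebesgue_measure_itv /= lte_fin ab => /(_ (measurable_itv _) (ltry _) gi).
move=> [h_ [ch hi]] /fine_cvgP[_] /cvgrPdist_lt.
have ek : 0 < e / (k + 1) by rewrite divr_gt0// ltr_pwDr.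
move=> /(_ _ ek) [n _ /(_ n (leqnn n))] /=.
rewrite sub0r normrN => hn.
have : `|defect (fun x => g x - h_ n x) f f' a b| <= e.
  rewrite (le_trans (kP _ _))//; first exact: integrableB_on.
  have : \intab_[a, b] (fun x => `|g x - h_ n x|) <= e / (k + 1).
    rewrite (le_trans _ (ltW hn))// ger0_norm//.
    by apply: fine_ge0; apply: integral_ge0.
  move=> /(ler_wpM2l k0) /le_trans; apply.
  by rewrite mulrCA -[leRHS]mulr1 ler_wpM2l ?(ltW e0)// ler_pdivrMr ?ltr_pwDr//; lra.
by rewrite defectB// (defect_continuous ab (ch n) Cf) subr0.
Qed.

(** The potential is only integrable, so that u' is only absolutely continuous; this
    is the integration by parts that its equation calls for. *)
Lemma integration_by_parts_ac w g f f' a b : a < b -> integrable_on a b g ->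
  (forall x, a <= x <= b -> w x - w a = \intab_[a, x] g) -> continuous w ->
  C1 f f' ->
  \intab_[a, b] (fun x => g x * f x) =
    w b * f b - w a * f a - \intab_[a, b] (fun x => w x * f' x).
Proof.
move=> ab gi wE cw Cf.
have /eqP := defect0 ab gi Cf; rewrite /defect subr_eq0 => /eqP ->.
rewrite -wE ?lexx ?ltW//.
have -> : \intab_[a, b] (fun x => (\intab_[a, x] g) * f' x) =
    \intab_[a, b] (fun x => w x * f' x - w a * f' x).
  by apply: eq_intab => x xab; rewrite -wE// mulrBl.
have ci h : continuous h -> integrable_on a b (fun x => h x * f' x).
  move=> ch; apply: continuous_integrable => x; apply: cvgM; first exact: ch.
  by have [_] := Cf; exact.
rewrite intabB; [|exact: ci|exact/(ci (cst (w a)))/cst_continuous].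
rewrite intabZ; last by apply: continuous_integrable; have [] := Cf.
rewrite (C1_intab Cf (ltW ab)); lra.
Qed.

End AbsolutelyContinuous.

(** * Periodic functions and the measure of the circle *)

Section CircleMeasure.
Context {R : realType}.
Variable L : R.
Hypothesis L0 : 0 < L.
Implicit Types (f g h : R -> R) (a b c x y : R).

Local Notation mu := (@lebesgue_measure R).

Lemma circle_measureT : circle_measure L [set: measurableTypeR R] = L%:E.
Proof.
by rewrite /circle_measure /mrestr setTI lebesgue_measure_itv /= lte_fin L0 oppr0 adde0.
Qed.

Lemma ae_circle_lebesgue (P : R -> Prop) :
  {ae circle_measure L, forall x, P x} ->
  {ae mu, forall x, `[0, L[%classic x -> P x}.
Proof.
move=> [A [mA A0 PA]]; exists (A `&` `[0, L[%classic); split.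
- exact: measurableI.
- exact: A0.
- move=> x /= /not_implyP[xL nPx]; split=> //; exact: PA.
Qed.

Lemma integral_circle h : continuous h ->
  \int[circle_measure L]_x h x = \intab_[0, L] h.
Proof.
move=> ch; have mh : measurable_fun setT (EFin \o h).
  by apply/measurable_EFinP; exact: continuous_measurable_fun.
have hi : mu.-integrable `[0, L[%classic (EFin \o h).
  apply: integrableS (continuous_integrable 0 L ch) => //.
  by apply: subset_itv; rewrite bnd_simp.
rewrite -Rintegral_itv_bndo_bndc//.
rewrite /Rintegral; congr fine.
have mI : measurable (`[0, L[%classic : set R) by exact: measurable_itv.
have E : (\int[circle_measure L]_(x in `[0%R, L[) (h x)%:E =
   \int[mu]_(x in `[0%R, L[) (h x)%:E)%E.
  apply: eq_measure_integral => A mA AI.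
  by rewrite -[LHS]/(mu (A `&` _)) setIidl.
rewrite -E -[X in (integral _ X _ = _)%E](setUv `[0, L[%classic).
rewrite integral_setU//; first last.
- by apply/disj_setPS; rewrite setICr.
- by rewrite setUv.
- exact: measurableC.
rewrite [X in (_ + X)%E](_ : _ = 0%E) ?adde0//.
rewrite null_set_integral//; first exact: measurableC.
  exact: measurable_funTS.
by rewrite -[LHS]/(mu (~` _ `&` _)) setICl measure0.
Qed.

Lemma ae_circle_intab_ge0 h : continuous h ->
  {ae circle_measure L, forall x, 0 <= h x} -> 0 <= \intab_[0, L] h.
Proof.
move=> ch /ae_circle_lebesgue h0.
have hi : mu.-integrable `[0, L[%classic (EFin \o h).
  apply: integrableS (continuous_integrable 0 L ch) => //.
  by apply: subset_itv; rewrite bnd_simp.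
rewrite -Rintegral_itv_bndo_bndc//.
rewrite [leRHS](_ : _ = \int[mu]_(x in `[0, L[) `|h x|).
  by apply: Rintegral_ge0.
rewrite /Rintegral; congr fine; apply: ae_eq_integral => //.
- by case/integrableP : hi.
- by have /integrable_norm /integrableP[] := hi.
- case: h0 => A [mA A0 sA]; exists A; split=> // x /= nx; apply: sA => hx.
  by apply: nx => /hx h0; rewrite ger0_norm.
Qed.

(** Estimates are proved on one period [y, y + L] and transported to the whole line
    by this common representative x'. *)
Lemma periodic_representative y x :
  exists2 x', y <= x' <= y + L & forall h, periodic_on L h -> h x = h x'.
Proof.
pose z := Num.floor ((x - y) / L).
have /andP[f1 f2] := floor_itv ((x - y) / L).
exists (x + L * (- z)%:~R).
  move: f1 f2; rewrite ler_pdivlMr// ltr_pdivrMr// intrD -/z mulrNz mulrN.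
  rewrite mulrDl mul1r => h1 h2; apply/andP; split; lra.
move=> h hL.
have hLn (n : nat) w : h (w + L * n%:R) = h w.
  elim: n => [|n IH]; first by rewrite mulr0 addr0.
  by rewrite -IH -[in RHS]hL -addrA; congr (h (_ + _)); rewrite -natr1 mulrDr mulr1.
case: (- z) => n; first by rewrite hLn.
by rewrite NegzE mulrNz -pmulrn mulrN -[RHS](hLn n.+1) subrK.
Qed.

Lemma periodic_bounded h : continuous h -> periodic_on L h ->
  exists2 k, 0 <= k & forall x, `|h x| <= k.
Proof.
move=> ch hL; have [k k0 kP] := continuous_bounded (ltW L0) ch.
exists k => // x; have [x' + ->//] := periodic_representative 0 x.
by rewrite add0r; exact: kP.
Qed.

Lemma Lfun_continuous_periodic h : continuous h -> periodic_on L h ->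
  h \in Lfun (circle_measure L) 2%:E.
Proof.
move=> ch hL; have [k k0 kP] := periodic_bounded ch hL.
have := @Lfun_subset _ _ _ (circle_measure L) _ _ (lee1n 2) (leey 1) _ _.
have T := circle_measureT; apply; [by rewrite [X in X \is a _]T|exact: leey|].
rewrite inE; apply/andP; split; rewrite inE /=.
  exact: continuous_measurable_fun.
rewrite /finite_norm unlock /Lnorm ifT; last by rewrite [ltRHS]T lte_fin.
apply: le_lt_trans (ltry k); apply/ess_supP; apply: nearW => x /=.
by rewrite lee_fin.
Qed.

(** The essential supremum is only used through these bounds: with an L^2 norm equal
    to 1, the last one keeps the weight 1 / sup_norm bounded. *)
Lemma sup_norm_bounds h k : continuous h -> periodic_on L h ->
  (forall x, `|h x| <= k) ->
  [/\ 0 <= sup_norm L h, sup_norm L h <= k &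
      \intab_[0, L] (fun x => h x ^+ 2) <= sup_norm L h ^+ 2 * L].
Proof.
move=> ch hL kP.
have N0 : (0 <= 'N[circle_measure L]_+oo[EFin \o h])%E by exact: Lnorm_ge0.
have Nk : ('N[circle_measure L]_+oo[EFin \o h] <= k%:E)%E.
  rewrite unlock /Lnorm ifT; last by rewrite [ltRHS]circle_measureT lte_fin.
  by apply/ess_supP; apply: nearW => x /=; rewrite lee_fin.
have Nfin : ('N[circle_measure L]_+oo[EFin \o h])%E \is a fin_num.
  by rewrite ge0_fin_numE// (le_lt_trans Nk)// ltry.
have S0 : 0 <= sup_norm L h by exact: fine_ge0.
split=> //; first by rewrite -lee_fin fineK.
rewrite -[X in _ <= _ * X]subr0 -(intab_cst _ (ltW L0)).
have ch2 : continuous (fun x => h x ^+ 2).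
  by move=> x; apply: cvgM; exact: ch.
have cc : continuous (fun _ : R => sup_norm L h ^+ 2) by move=> x; exact: cst_continuous.
rewrite -subr_ge0 -intabB; [|exact: continuous_integrable..].
apply: ae_circle_intab_ge0.
  by move=> x; apply: cvgB; [exact: cc|exact: ch2].
have : \forall x \ae circle_measure L, ((abse \o (EFin \o h)) x <= (sup_norm L h)%:E)%E.
  rewrite fineK// unlock /Lnorm ifT; last by rewrite [ltRHS]circle_measureT lte_fin.
  exact: ess_sup_ge.
move=> [A [mA A0 sA]]; exists A; split=> // x /= nx; apply: sA => /=.
rewrite lee_fin => hx; apply: nx.
by rewrite subr_ge0 -[h x ^+ 2]real_normK ?num_real// lerXn2r ?nnegrE.
Qed.

(** The derivative in y of the integral over [y, y + L] is h (y + L) - h y = 0. *)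
Lemma intab_shift h y : continuous h -> periodic_on L h ->
  \intab_[0, L] h = \intab_[y, y + L] h.
Proof.
move=> ch hL.
pose c := Num.min 0 y - 1.
have [c0 cy] : c < 0 /\ c < y.
  by rewrite /c; case: (ltP 0 y) => ?; lra.
pose H x := \intab_[c, x] h.
have HE a : c < a -> \intab_[a, a + L] h = H (a + L) - H a.
  move=> ca; rewrite /H (@intab_cat _ _ c a (a + L)) ?ltW ?ltrDl//.
    by rewrite addrAC subrr add0r.
  exact: continuous_integrable.
have dD x : c < x -> is_derive x 1 (fun z => H (z + L) - H z) 0.
  move=> cx.
  have dH : is_derive x 1 H (h x) by exact: continuous_primitive.
  have dHL : is_derive (x + L) 1 H (h x).
    by rewrite -[h x]hL; apply: continuous_primitive => //; rewrite ltr_wpDr// ltW.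
  have dsh : is_derive x 1 (fun z => z + L) 1.
    by apply: is_derive_eq; rewrite addr0.
  have dHc : is_derive x 1 (H \o (fun z => z + L)) (h x).
    by have := @is_derive1_comp R H (fun z => z + L) x _ _ dHL dsh; rewrite mulr1.
  by have := is_deriveB dHc dH; rewrite subrr.
have E a b : c < a -> a < b -> H (a + L) - H a = H (b + L) - H b.
  move=> ca ab.
  have [||z _] := @MVT _ (fun z => H (z + L) - H z) (fun=> 0) a b ab.
  - by move=> x; rewrite in_itv /= => /andP[ax _]; apply: dD; exact: lt_trans ax.
  - apply: derivable_within_continuous => x; rewrite in_itv /= => /andP[ax _].
    by have [] := dD x (lt_le_trans ca ax).
  by rewrite mul0r => /eqP; rewrite subr_eq0 => /eqP.
rewrite -{1}(add0r L) !HE//.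
by case: (ltgtP 0 y) => [y0|y0|->//]; [exact: E|exact/esym/E].
Qed.

End CircleMeasure.

(** * The potential *)

Section PotentialFacts.
Context {R : realType}.
Implicit Types (f g h phi : R -> R) (a b c x y eps L : R).

Local Notation mu := (@lebesgue_measure R).
Local Notation RB := (measurableTypeR R).

Section Affine.
Variables (y eps : R) (eps0 : 0 < eps).

Let s (x : RB) : RB := (x - y) / eps.

Let ms : measurable_fun setT s.
Proof.
apply: (@continuous_measurable_fun R) => x.
by apply: cvgM; [apply: cvgB; [exact: cvg_id|exact: cvg_cst]|exact: cvg_cst].
Qed.

Let sm : {mfun RB >-> RB} := HB.pack s (isMeasurableFun.Build _ _ _ _ _ ms).

(** Lebesgue measure is characterised by its values on intervals, and
    x |-> (x - y) / eps divides lengths by eps. *)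
Lemma lebesgue_measure_affine (A : set RB) : measurable A ->
  pushforward mu s A = (eps%:E * mu A)%E.
Proof.
move=> mA.
have ei : (0 : R) <= eps^-1 by rewrite invr_ge0 ltW.
have /(_ ms) -> : mu A = mscale (NngNum ei) (pushforward mu sm) A.
  move=> m; apply: lebesgue_measure_unique => // _ [[a b]] _ <-.
  have sE : s @^-1` `]a, b]%classic = `](y + eps * a), (y + eps * b)]%classic.
    apply/seteqP; split=> x /=; rewrite !in_itv /= /s.
      by rewrite ltr_pdivlMr// ler_pdivrMr// => /andP[? ?]; lra.
    by rewrite ltr_pdivlMr// ler_pdivrMr// => /andP[? ?]; lra.
  rewrite -[RHS]/((eps^-1)%:E * mu (s @^-1` `]a, b]%classic))%E sE.
  rewrite -[X in mu X = _]/(`]a, b]%classic).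
  rewrite !lebesgue_measure_itv /= !lte_fin ltrD2l ltr_pM2l//.
  case: ifP => _; last by rewrite mule0.
  by rewrite -!EFinD -EFinM; congr EFin; field; rewrite gt_eqF.
by rewrite /mscale /= muleA -EFinM divff ?gt_eqF// mul1e.
Qed.

Lemma integrable_affine phi : integrable_on 0 1 phi ->
  integrable_on y (y + eps) (fun x => phi ((x - y) / eps)) /\
  \intab_[y, y + eps] (fun x => `|phi ((x - y) / eps)|) =
    eps * \intab_[0, 1] (fun t => `|phi t|).
Proof.
move=> phii; have /integrableP[mphi phifin] := phii.
have pre : (s @^-1` `[0, 1]%classic) = `[y, y + eps]%classic.
  apply/seteqP; split=> x /=; rewrite !in_itv /= /s.
    by rewrite ler_pdivlMr// ler_pdivrMr// => /andP[? ?]; lra.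
  by rewrite ler_pdivlMr// ler_pdivrMr// => /andP[? ?]; lra.
have mn : measurable_fun (`[0, 1]%classic : set R) (fun t : R => `|phi t|%:E).
  apply/measurable_EFinP; apply: measurableT_comp => //.
  exact/measurable_EFinP.
have key : (\int[mu]_(x in `[y, (y + eps)%R]) `|phi ((x - y) / eps)|%:E =
    eps%:E * \int[mu]_(t in `[0%R, 1%R]) `|phi t|%:E)%E.
  rewrite -pre -[LHS](@ge0_integral_pushforward _ _ _ _ _ _ ms mu _
    (fun t => `|phi t|%:E))//.
  rewrite -(@ge0_integral_mscale _ _ _ mu _ _ (NngNum (ltW eps0)))//.
  by apply: eq_measure_integral => A mA _; exact: lebesgue_measure_affine.
have ifin : (\int[mu]_(t in `[0%R, 1%R]) `|phi t|%:E)%E \is a fin_num.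
  by rewrite ge0_fin_numE ?integral_ge0// => *; rewrite lee_fin.
split; last by rewrite /Rintegral key -[in LHS](fineK ifin) -EFinM.
apply/integrableP; split.
  apply/measurable_EFinP; rewrite -pre.
  rewrite -[X in measurable_fun _ X]/(phi \o s).
  apply: (@measurable_comp _ _ _ RB RB _ `[0, 1]%classic phi _ s) => //.
  - by move=> _ [t /= tI <-].
  - exact/measurable_EFinP.
  - exact: measurable_funTS.
rewrite /= key -[X in (_ * X)%E](fineK ifin) -EFinM; exact: ltry.
Qed.

End Affine.

Lemma circle_rep_small L x : 0 <= x < L -> circle_rep L x = x.
Proof.
move=> /andP[x0 xL]; have L0 : 0 < L by exact: le_lt_trans xL.
rewrite /circle_rep (_ : Num.floor (x / L) = 0) ?mulr0 ?subr0//.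
apply: floor_def; rewrite add0r divr_ge0 ?(ltW L0)//=.
by rewrite ltr_pdivrMr// mul1r.
Qed.

Lemma circle_rep_ge0 L x : 0 < L -> 0 <= circle_rep L x.
Proof.
move=> L0; rewrite /circle_rep subr_ge0 mulrC -ler_pdivlMr//.
exact: floor_le_tmp.
Qed.

Lemma potential_le1 L phi y eps x : 0 < L -> 0 < eps ->
  (forall t, t \in `[0, 1] -> phi t < 0) -> potential L phi y eps x <= 1.
Proof.
move=> L0 eps0 phi0; rewrite /potential; case: ifP => // te.
rewrite gerDl pmulr_rle0// ltW// phi0// in_itv /= divr_ge0 ?(ltW eps0) ?circle_rep_ge0//=.
by rewrite ler_pdivrMr// mul1r.
Qed.

Lemma potential_in L phi y eps x : eps < L -> y <= x <= y + eps ->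
  potential L phi y eps x = 1 + eps * phi ((x - y) / eps).
Proof.
move=> epsL /andP[yx xy]; rewrite /potential circle_rep_small ?ifT//; lra.
Qed.

Lemma potential_out L phi y eps x : 0 < eps -> y + eps < x < y + L ->
  potential L phi y eps x = 1.
Proof.
move=> eps0 /andP[yx xy]; rewrite /potential circle_rep_small ?ifF//; last lra.
by apply/negbTE; rewrite -ltNge; lra.
Qed.

(** One factor eps is the depth of the well and the other one is its width. *)
Lemma potential_integrable L phi y eps : 0 < eps -> eps < L ->
  integrable_on 0 1 phi ->
  integrable_on y (y + L) (fun x => potential L phi y eps x - 1) /\
  \intab_[y, y + L] (fun x => `|potential L phi y eps x - 1|) =
   eps ^+ 2 * \intab_[0, 1] (fun t => `|phi t|).
Proof.
move=> eps0 epsL /(integrable_affine y eps0)[phii phiE].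
set W := fun x => _ - 1.
have i1 : integrable_on y (y + eps) W.
  apply: eq_integrable_on (integrableZ_on eps phii) => x xy.
  by rewrite /W potential_in// addrAC subrr add0r.
have W0 x : y + eps < x < y + L -> W x = 0.
  by move=> xy; rewrite /W potential_out// subrr.
have iW : integrable_on y (y + L) W.
  have i1r : integrable_on y (y + L) (W \_ `[y, y + eps]).
    have : mu.-integrable setT ((EFin \o W) \_ `[y, (y + eps)]).
      by apply: (iffLR (integrable_mkcond _ _)).
    by rewrite restrict_EFin; apply: integrableS.
  have i2 : integrable_on y (y + L) (\1_[set y + L] : R -> R).
    have := integrable_indic_itv (y + L) (y + L) true false.
    by rewrite /= set_itv1; apply: integrableS.
  apply: eq_integrable_on (integrableD_on i1r (integrableZ_on (W (y + L)) i2)).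
  move=> x /andP[yx xL]; rewrite patchE indicE !mem_setE /= in_itv /= yx /=.
  have [->|xyL] := eqVneq x (y + L).
    by rewrite mem_set//= mulr1 ifF ?add0r// lerD2l leNgt epsL.
  rewrite memNset/=; last exact/eqP.
  rewrite mulr0 addr0; case: ifPn => // xe; rewrite W0// ltNge xe /=.
  by rewrite lt_neqAle xyL.
split=> //.
have yeL : y + eps <= y + L by rewrite lerD2l ltW.
rewrite (intab_cat (b := y + eps)) ?lerDl ?(ltW eps0)//; last exact: integrable_norm_on.
have -> : \intab_[y, y + eps] (fun x => `|W x|) = eps ^+ 2 * \intab_[0, 1] (fun t => `|phi t|).
  rewrite expr2 -mulrA -phiE -intabZ; last exact: integrable_norm_on.
  apply: eq_intab => x xy; rewrite /W potential_in// addrAC subrr add0r normrM.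
  by rewrite gtr0_norm.
rewrite [X in _ + X](_ : _ = 0) ?addr0//.
have iWn : mu.-integrable `[(y + eps), (y + L)] (EFin \o (fun x => `|W x|)).
  by apply: integrable_norm_on; apply: integrable_subitv iW; rewrite // lerDl ltW.
have iWn' : mu.-integrable `[(y + eps), (y + L)[ (EFin \o (fun x => `|W x|)).
  by apply: integrableS iWn => //; apply: subset_itv; rewrite bnd_simp.
rewrite -Rintegral_itv_bndo_bndc// -Rintegral_itv_obnd_cbnd//; last first.
  by apply: integrableS iWn' => //; apply: subset_itv; rewrite bnd_simp.
rewrite (@eq_Rintegral _ _ _ _ _ (fun=> 0)); first by rewrite Rintegral_cst//= mul0r.
by move=> x; rewrite inE /= in_itv /= => /W0; rewrite /W => ->; rewrite normr0.
Qed.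

End PotentialFacts.

(** * The quadratic form of the operator *)

Section SchroedingerForm.
Context {R : realType}.
Implicit Types (f g h : R -> R) (F G H : (R -> R) * (R -> R)) (a b c x y : R).

Definition jet_sub F c G : (R -> R) * (R -> R) :=
  (fun x => F.1 x - c * G.1 x, fun x => F.2 x - c * G.2 x).

Definition C1_periodic L F := C1 F.1 F.2 /\ periodic_on L F.1.

Lemma continuousM_fun f g : continuous f -> continuous g ->
  continuous (fun x => f x * g x).
Proof. by move=> cf cg x; apply: cvgM; [exact: cf|exact: cg]. Qed.

Lemma continuous_lincomb f c g : continuous f -> continuous g ->
  continuous (fun x => f x - c * g x).
Proof.
move=> cf cg x; apply: cvgB; first exact: cf.
by apply: cvgM; [exact: cvg_cst|exact: cg].
Qed.

Lemma C1_lincomb f f' c g g' : C1 f f' -> C1 g g' ->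
  C1 (fun x => f x - c * g x) (fun x => f' x - c * g' x).
Proof.
move=> [df cf] [dg cg]; split; last exact: continuous_lincomb.
move=> x; have dfx := df x; have dgx := dg x.
exact: (is_deriveB dfx (is_deriveZ c dgx)).
Qed.

Lemma C1_mul f f' g g' : C1 f f' -> C1 g g' ->
  C1 (fun x => f x * g x) (fun x => f x * g' x + g x * f' x).
Proof.
move=> Cf Cg; have [df cf'] := Cf; have [dg cg'] := Cg.
have cf := C1_continuous Cf; have cg := C1_continuous Cg.
split; last by move=> x; apply: cvgD; apply: continuousM_fun.
by move=> x; have dfx := df x; have dgx := dg x; exact: is_deriveM.
Qed.

Lemma C1_periodic_derive L f f' : C1 f f' -> periodic_on L f -> periodic_on L f'.
Proof.
move=> [df cf'] fL x.
have dsh : is_derive x 1 (fun z => z + L) 1.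
  by apply: is_derive_eq; rewrite addr0.
have := @is_derive1_comp R f (fun z => z + L) x _ _ (df (x + L)) dsh.
rewrite mulr1 (_ : f \o _ = f); last by apply/funext => z /=; rewrite fL.
by move=> /@derive_val <-; have /@derive_val := df x.
Qed.

Lemma C1_periodic_sub L F c G : C1_periodic L F -> C1_periodic L G ->
  C1_periodic L (jet_sub F c G).
Proof.
move=> [CF FL] [CG GL]; split; first exact: C1_lincomb.
by move=> x /=; rewrite FL GL.
Qed.

Lemma C1_periodic_continuous L F : C1_periodic L F ->
  continuous F.1 /\ continuous F.2.
Proof. by move=> [CF _]; split; [exact: C1_continuous CF|have [] := CF]. Qed.

Variables (L y : R) (V : R -> R).
Hypothesis L0 : 0 < L.
Hypothesis Vi : integrable_on y (y + L) (fun x => V x - 1).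

Definition ip f g := \intab_[y, y + L] (fun x => f x * g x).

Definition energy F G := ip F.2 G.2 + ip F.1 G.1 +
  \intab_[y, y + L] (fun x => (V x - 1) * (F.1 x * G.1 x)).

Definition perturbation := \intab_[y, y + L] (fun x => `|V x - 1|).

Let yL : y <= y + L. Proof. by rewrite lerDl ltW. Qed.

Lemma ipC f g : ip f g = ip g f.
Proof. by apply: eq_intab => x _; rewrite mulrC. Qed.

Lemma ip_subr f g c h : continuous f -> continuous g -> continuous h ->
  ip f (fun x => g x - c * h x) = ip f g - c * ip f h.
Proof.
move=> cf cg ch; rewrite /ip.
have i k : continuous k -> integrable_on y (y + L) (fun x => f x * k x).
  by move=> ck; apply: continuous_integrable; exact: continuousM_fun.
rewrite -intabZ; last exact: i.
rewrite -intabB; [|exact: i|exact/integrableZ_on/i].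
by apply: eq_intab => x _; ring.
Qed.

Lemma ip_subl f g c h : continuous f -> continuous g -> continuous h ->
  ip (fun x => g x - c * h x) f = ip g f - c * ip h f.
Proof. by move=> cf cg ch; rewrite ipC ip_subr// !(ipC f). Qed.

Lemma ip_ge0 f : 0 <= ip f f.
Proof. by apply: intab_ge0 => x _; rewrite -expr2 sqr_ge0. Qed.

Lemma energyC F G : energy F G = energy G F.
Proof.
rewrite /energy (ipC F.2) (ipC F.1); congr (_ + _).
by apply: eq_intab => x _; rewrite [F.1 x * _]mulrC.
Qed.

Lemma energy_subr F G c H : C1_periodic L F -> C1_periodic L G -> C1_periodic L H ->
  energy F (jet_sub G c H) = energy F G - c * energy F H.
Proof.
move=> /C1_periodic_continuous[F1 F2] /C1_periodic_continuous[G1 G2] /C1_periodic_continuous[H1 H2].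
rewrite /energy /= !ip_subr//.
rewrite (_ : \intab_[_, _] _ =
  \intab_[y, y + L] (fun x => (V x - 1) * (F.1 x * G.1 x)) -
  c * \intab_[y, y + L] (fun x => (V x - 1) * (F.1 x * H.1 x))); first by ring.
have i k : continuous k -> integrable_on y (y + L) (fun x => (V x - 1) * (F.1 x * k x)).
  by move=> ck; apply: integrableM_on => //; exact: continuousM_fun.
rewrite -intabZ; last exact: i.
rewrite -intabB; [|exact: i|exact/integrableZ_on/i].
by apply: eq_intab => x _; ring.
Qed.

Lemma energy_sub_sq F c G : C1_periodic L F -> C1_periodic L G ->
  energy (jet_sub F c G) (jet_sub F c G) =
  energy F F - 2 * c * energy G F + c ^+ 2 * energy G G.
Proof.
move=> CF CG; have CS := C1_periodic_sub c CF CG.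
rewrite energy_subr// ![energy (jet_sub _ _ _) _]energyC !energy_subr// (energyC F G); ring.
Qed.

Definition sobolev_const := L^-1 + 1.

Lemma sobolev_const_gt0 : 0 < sobolev_const.
Proof. by rewrite /sobolev_const addr_gt0// invr_gt0. Qed.

(** F.1 ^ 2 varies by at most the integral of |2 F.1 F.2|, and it takes a value not
    exceeding its mean. *)
Lemma sobolev F x : C1 F.1 F.2 -> y <= x <= y + L ->
  F.1 x ^+ 2 <= sobolev_const * (ip F.1 F.1 + ip F.2 F.2).
Proof.
move=> CF xJ; have [dF c2] := CF; have c1 := C1_continuous CF.
set N := ip F.1 F.1 + ip F.2 F.2.
have C2 := C1_mul CF CF.
have [_ c12] := C2.
have i12 a b := continuous_integrable a b c12.
have bound a b : y <= a -> a <= b -> b <= y + L -> `|F.1 b ^+ 2 - F.1 a ^+ 2| <= N.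
  move=> ya ab bL; rewrite !expr2 -(C1_intab C2 ab).
  rewrite (le_trans (le_norm_intab (i12 _ _)))//.
  rewrite (le_trans (intab_norm_sub ya bL (i12 _ _)))//.
  rewrite /N /ip -intabD; [|apply: continuous_integrable; exact: continuousM_fun..].
  apply: le_intab; first exact: integrable_norm_on.
    by apply: integrableD_on; apply: continuous_integrable; exact: continuousM_fun.
  move=> z _; rewrite ler_norml; have := sqr_ge0 (F.1 z - F.2 z).
  have := sqr_ge0 (F.1 z + F.2 z).
  by move=> ? ?; apply/andP; split; nra.
have pt z : y <= z <= y + L -> F.1 x ^+ 2 <= F.1 z * F.1 z + N.
  move: xJ => /andP[yx xL] /andP[yz zL]; rewrite -expr2.
  have [xz|zx] := leP x z.
    by have := bound x z yx xz zL; rewrite ler_norml => /andP[? ?]; lra.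
  by have := bound z x yz (ltW zx) xL; rewrite ler_norml => /andP[? ?]; lra.
have cc (k : R) : continuous (fun _ : R => k) by move=> z; exact: cst_continuous.
have c11 : continuous (fun z => F.1 z * F.1 z) by exact: continuousM_fun.
have : F.1 x ^+ 2 * L <= ip F.1 F.1 + N * L.
  have E k : k * L = \intab_[y, y + L] (fun=> k).
    by rewrite intab_cst//; congr (_ * _); ring.
  rewrite !E -intabD; [|exact: continuous_integrable..].
  apply: le_intab => //; first exact: continuous_integrable.
  by apply: integrableD_on; exact: continuous_integrable.
rewrite -ler_pdivlMr// => /le_trans; apply.
rewrite mulrDl mulfK ?gt_eqF// /sobolev_const mulrDl mul1r lerD2r mulrC.
by rewrite ler_pM2l ?invr_gt0// /N lerDl ip_ge0.
Qed.

Hypothesis small : sobolev_const * perturbation <= 2^-1.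

(** The potential term is at most the supremum of F.1 ^ 2 times the perturbation,
    which by the Sobolev inequality is at most half of the squared H^1 norm. *)
Lemma coercive F : C1 F.1 F.2 -> ip F.1 F.1 + ip F.2 F.2 <= 2 * energy F F.
Proof.
move=> CF; have [dF c2] := CF; have c1 := C1_continuous CF.
have := @intab_bound_mul _ _ _ (sobolev_const * (ip F.1 F.1 + ip F.2 F.2)) _ _ Vi
  (continuousM_fun c1 c1).
have b x : y <= x <= y + L -> `|F.1 x * F.1 x| <= sobolev_const * (ip F.1 F.1 + ip F.2 F.2).
  by move=> xJ; rewrite -expr2 ger0_norm ?sqr_ge0// sobolev.
move=> /(_ b); rewrite -/perturbation.
have N0 : 0 <= ip F.1 F.1 + ip F.2 F.2 by rewrite addr_ge0// ip_ge0.
have := ler_wpM2l N0 small.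
rewrite /energy ler_norml => h /andP[h1 h2].
have : sobolev_const * (ip F.1 F.1 + ip F.2 F.2) * perturbation =
  (ip F.1 F.1 + ip F.2 F.2) * (sobolev_const * perturbation) by ring.
lra.
Qed.

Lemma energy_ge0 F : C1 F.1 F.2 -> 0 <= energy F F.
Proof.
move=> CF; have := coercive CF; have := ip_ge0 F.1; have := ip_ge0 F.2; lra.
Qed.

Lemma energy_sobolev F x : C1 F.1 F.2 -> y <= x <= y + L ->
  F.1 x ^+ 2 <= 2 * sobolev_const * energy F F.
Proof.
move=> CF xJ; rewrite (le_trans (sobolev CF xJ))//.
rewrite [leRHS](_ : _ = sobolev_const * (2 * energy F F)); last by ring.
by rewrite ler_pM2l ?sobolev_const_gt0// coercive.
Qed.

Lemma energy_le F : (forall x, V x <= 1) -> C1 F.1 F.2 ->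
  energy F F <= ip F.1 F.1 + ip F.2 F.2.
Proof.
move=> V1 CF; rewrite /energy [leRHS]addrC gerDl -oppr_ge0.
have c1 := C1_continuous CF.
have i1 := integrableM_on Vi (continuousM_fun c1 c1).
set I := \intab_[_, _] _.
have -> : - I = \intab_[y, y + L] (fun x => (-1) * ((V x - 1) * (F.1 x * F.1 x))).
  by rewrite (intabZ _ i1) mulN1r.
apply: intab_ge0 => x _; have V1x : 0 <= 1 - V x by rewrite subr_ge0.
by have := mulr_ge0 V1x (sqr_ge0 (F.1 x)); rewrite expr2; lra.
Qed.

(** Test functions are carried along with their derivative, so that linear
    combinations can be formed without differentiating. *)
Definition jet f : (R -> R) * (R -> R) := (f, derive1 f).

(** u' is an indefinite integral, hence continuous. *)
Lemma eigenfunction_C1 lam u : eigenfunction L V lam u -> C1_periodic L (jet u).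
Proof.
move=> [uL _ du u2]; split; last exact: uL.
split => /= x.
  by apply: DeriveDef; rewrite ?derive1E.
have [ui uE] : integrable_on (x - 1) (x + 1) (fun z => (V z - lam) * u z) /\
   forall z, x - 1 <= z -> derive1 u z = derive1 u (x - 1) +
     \intab_[x - 1, z] (fun z => (V z - lam) * u z).
  split; first by apply: (u2 _ _ _).1; lra.
  by move=> z xz; have [_ <-] := u2 _ _ xz; rewrite addrC subrK.
have ab : x - 1 < x + 1 by lra.
have := primitive_continuous_within (ltW ab) ui.
move=> /(continuous_within_itvP _ ab)[+ _ _] => /(_ x).
have xI : x \in `](x - 1), (x + 1)[ by rewrite in_itv /=; apply/andP; split; lra.
move=> /(_ xI) cx.
have : {for x, continuous (fun z => derive1 u (x - 1) +
     \intab_[x - 1, z] (fun z => (V z - lam) * u z))}.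
  by apply: cvgD; [exact: cvg_cst|exact: cx].
move=> cz; rewrite /continuous_at (uE x); last by lra.
apply: cvg_trans cz; apply: near_eq_cvg; near=> z; rewrite /= -uE//.
near: z; apply: lt_le_nbhsr; lra.
Unshelve. all: by end_near. Qed.

Lemma eigenfunction_ibp lam u f f' a b : eigenfunction L V lam u -> C1 f f' -> a < b ->
  \intab_[a, b] (fun x => (V x - lam) * u x * f x) =
   derive1 u b * f b - derive1 u a * f a - \intab_[a, b] (fun x => derive1 u x * f' x).
Proof.
move=> eu Cf ab; have [[_ cu'] _] := eigenfunction_C1 eu; have [_ _ _ u2] := eu.
apply: integration_by_parts_ac => //; first exact: (u2 _ _ (ltW ab)).1.
by move=> x /andP[ax _]; exact: (u2 _ _ ax).2.
Qed.

Lemma weak_form lam u F : eigenfunction L V lam u -> C1_periodic L F ->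
  energy (jet u) F = lam * ip u F.1.
Proof.
move=> eu [CF FL]; have [Cu uL] := eigenfunction_C1 eu.
have cu := C1_continuous Cu; have cF := C1_continuous CF; have [_ cu'] := Cu.
have yL' : y < y + L by rewrite ltrDl.
have := eigenfunction_ibp eu CF yL'.
have := C1_periodic_derive Cu uL y; rewrite FL /= => ->; rewrite subrr sub0r => E.
rewrite /energy /= -[ip _ F.2]opprK -E.
have cuF : continuous (fun x => u x * F.1 x) by exact: continuousM_fun.
have iVu : integrable_on y (y + L) (fun x => (V x - 1) * (u x * F.1 x)).
  exact: integrableM_on.
have iu : integrable_on y (y + L) (fun x => u x * F.1 x) by exact: continuous_integrable.
have -> : \intab_[y, y + L] (fun x => (V x - lam) * u x * F.1 x) =
  \intab_[y, y + L] (fun x => (V x - 1) * (u x * F.1 x)) + (1 - lam) * ip u F.1.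
  rewrite /ip -intabZ// -intabD//; last exact: integrableZ_on.
  by apply: eq_intab => x _; ring.
ring.
Qed.

End SchroedingerForm.

(** * Completeness and the Courant-Fischer upper bound *)

Section UniformLimit.
Context {R : realType}.

Lemma uniform_cauchy_limit (f : nat -> R -> R) :
  (forall n, continuous (f n)) ->
  (forall d, 0 < d -> exists n, forall m x, (n <= m)%N -> `|f m x - f n x| <= d) ->
  exists2 g : R -> R, continuous g &
    forall d, 0 < d -> exists n, forall m x, (n <= m)%N -> `|g x - f m x| <= d.
Proof.
move=> cf fe.
have cvx x : cvgn (fun n => f n x).
  apply/cauchy_cvgP/cauchy_exP => d d0.
  have [n nd] := fe (d / 2) (divr_gt0 d0 (ltr0Sn _ _)).
  exists (f n x); exists n => // m /= nm; rewrite -ball_normE /= distrC.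
  by have := nd m x nm; move: d0; lra.
pose g x := limn (fun n => f n x).
have gE d : 0 < d -> exists n, forall m x, (n <= m)%N -> `|g x - f m x| <= d.
  move=> d0; have [n nd] := fe (d / 2) (divr_gt0 d0 (ltr0Sn _ _)).
  exists n => m x nm.
  have : `|g x - f n x| <= d / 2.
    have : (fun m => `|f m x - f n x|) @ \oo --> `|g x - f n x|.
      apply: cvg_norm; apply: cvgB; [exact: cvx|exact: cvg_cst].
    move=> /cvgr_to_le; apply.
    by exists n => // k /=; exact: nd.
  have := nd m x nm; rewrite !ler_norml => /andP[? ?] /andP[? ?].
  by apply/andP; split; lra.
exists g => // x; apply/cvgrPdist_le => d d0.
have [n nd] := gE (d / 3) (divr_gt0 d0 (ltr0Sn _ _)).
have /cvgrPdist_le /(_ _ (divr_gt0 d0 (ltr0Sn _ 2))) := cf n x.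
apply: filterS => z zd.
have := nd n x (leqnn n); have := nd n z (leqnn n); rewrite !ler_norml in zd *.
by move=> /andP[? ?] /andP[? ?]; move/andP: zd => [? ?]; apply/andP; split; lra.
Qed.

End UniformLimit.

Section MinMax.
Context {R : realType}.
Variables (L y : R) (V : R -> R) (lam : nat -> R) (u : nat -> R -> R).
Hypotheses (L0 : 0 < L) (Vi : integrable_on y (y + L) (fun x => V x - 1)).
Hypothesis small : sobolev_const L * perturbation L y V <= 2^-1.
Hypothesis eb : eigenbasis L V lam u.

Local Notation ip := (ip L y).
Local Notation energy := (energy L y V).
Local Notation U n := (jet (u n)).
Implicit Types (F G : (R -> R) * (R -> R)).

Lemma U_C1 n : C1_periodic L (U n).
Proof. by have := eigenbasis_eigen eb n; exact: eigenfunction_C1. Qed.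

Let cU n : continuous (u n).
Proof. by have [/C1_continuous] := U_C1 n. Qed.

Lemma ip_orthonormal j k : ip (u j) (u k) = (j == k)%:R.
Proof.
have cjk : continuous (fun x => u j x * u k x) by exact: continuousM_fun.
rewrite -(eigenbasis_orthonormal eb) integral_circle// (intab_shift L0 y)//.
by move=> x; have [_ /= ->] := U_C1 j; have [_ /= ->] := U_C1 k.
Qed.

Lemma energy_U n F : C1_periodic L F -> energy (U n) F = lam n * ip (u n) F.1.
Proof. by move=> CF; apply: weak_form => //; exact: eigenbasis_eigen. Qed.

Lemma energy_UU n : energy (U n) (U n) = lam n.
Proof. by rewrite energy_U ?ip_orthonormal ?eqxx ?mulr1//; exact: U_C1. Qed.

Lemma lam_ge0 n : 0 <= lam n.
Proof. by rewrite -energy_UU; apply: energy_ge0 => //; have [] := U_C1 n. Qed.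

Section Residual.
Variable F : (R -> R) * (R -> R).
Hypothesis CF : C1_periodic L F.

Fixpoint residual n := if n is m.+1
  then jet_sub (residual m) (ip F.1 (u m)) (U m) else F.

Lemma residual_C1 n : C1_periodic L (residual n).
Proof. by elim: n => //= n IH; apply: C1_periodic_sub => //; exact: U_C1. Qed.

Let cr n : continuous (residual n).1.
Proof. by have [/C1_continuous] := residual_C1 n. Qed.

Lemma ip_residual n j : ip (residual n).1 (u j) = if (j < n)%N then 0 else ip F.1 (u j).
Proof.
elim: n => [//|n IH] /=; rewrite ip_subl// IH ip_orthonormal ltnS.
have [jn|nj|->] := ltngtP j n; rewrite ?mulr0 ?subr0 ?mulr1 ?subrr//.
Qed.

Lemma energy_U_residual n : energy (U n) (residual n) = lam n * ip F.1 (u n).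
Proof. by rewrite energy_U ?(ipC _ _ (u n)) ?ip_residual ?ltnn//; exact: residual_C1. Qed.

Lemma energy_residual n : energy (residual n.+1) (residual n.+1) =
  energy (residual n) (residual n) - lam n * ip F.1 (u n) ^+ 2.
Proof.
rewrite /= energy_sub_sq//; [|exact: residual_C1|exact: U_C1].
by rewrite energy_U_residual energy_UU; ring.
Qed.

Lemma ip_residual_sq n : ip (residual n.+1).1 (residual n.+1).1 =
  ip (residual n).1 (residual n).1 - ip F.1 (u n) ^+ 2.
Proof.
have crs : continuous (jet_sub (residual n) (ip F.1 (u n)) (U n)).1.
  by apply: continuous_lincomb; [exact: cr|exact: cU].
rewrite /= ip_subr// !ip_subl// !(ipC _ _ (u n)) ip_residual ltnn ip_orthonormal eqxx.
by rewrite (_ : true%:R = 1 :> R)//; ring.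
Qed.

(** The partial sums of the expansion of F in the eigenbasis are orthogonal to the
    residuals for the energy too; the energy being a monotone bounded quantity along
    the residuals, this makes them a Cauchy sequence in H^1. *)
Lemma energy_residual_diff m n : (m <= n)%N ->
  energy (jet_sub (residual m) 1 (residual n)) (jet_sub (residual m) 1 (residual n)) =
  energy (residual m) (residual m) - energy (residual n) (residual n).
Proof.
move=> /subnKC <-; elim: (n - m)%N => [|k IH].
  have Cm := residual_C1 m.
  by rewrite addn0 energy_sub_sq//; ring.
rewrite addnS; set c := ip F.1 (u (m + k)).
have -> : jet_sub (residual m) 1 (residual (m + k).+1) =
    jet_sub (jet_sub (residual m) 1 (residual (m + k))) (- c) (U (m + k)).
  by congr pair; apply/funext => x /=; rewrite -/c; ring.
have Cd : C1_periodic L (jet_sub (residual m) 1 (residual (m + k))).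
  by apply: C1_periodic_sub; exact: residual_C1.
rewrite energy_sub_sq//; last exact: U_C1.
rewrite IH energy_U// energy_UU energy_residual -/c.
have -> : ip (u (m + k)) (jet_sub (residual m) 1 (residual (m + k))).1 = 0.
  rewrite ip_subr// !(ipC _ _ (u (m + k))) !ip_residual ltnn.
  by rewrite ltnNge leq_addr /=; ring.
ring.
Qed.

Let q n := energy (residual n) (residual n).

Let q_ge0 n : 0 <= q n.
Proof. by apply: energy_ge0 => //; have [] := residual_C1 n. Qed.

Let q_cauchy d : 0 < d -> exists n, forall m, (n <= m)%N -> q n - q m <= d.
Proof.
move=> d0; apply/not_existsP => H.
have step n : exists m, q m < q n - d.
  have /existsNP[m /not_implyP[nm /negP]] := H n.
  by rewrite -ltNge => ?; exists m; lra.
have drop k : exists m, q m <= q 0%N - d * k%:R.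
  elim: k => [|k [m km]]; first by exists 0%N; rewrite mulr0 subr0.
  have [m' mm'] := step m; exists m'.
  by rewrite -natr1 mulrDr mulr1; lra.
have [m] := drop (Num.bound (q 0%N / d)).
have := archi_boundP (divr_ge0 (q_ge0 0) (ltW d0)).
rewrite ltr_pdivrMr// mulrC => h1 h2; have := q_ge0 m; lra.
Qed.

(** The residuals form a Cauchy sequence for the energy, hence for the supremum norm
    by the Sobolev inequality.  The limit g is continuous and orthogonal to every
    eigenfunction, so that g = 0 by completeness of the eigenbasis. *)
Lemma residual_l2_cvg d : 0 < d ->
  exists n0, forall n, (n0 <= n)%N -> ip (residual n).1 (residual n).1 <= d.
Proof.
move=> d0.
pose K := 2 * sobolev_const L.
have K0 : 0 < K by rewrite mulr_gt0// sobolev_const_gt0.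
have unif m n x : (m <= n)%N ->
    ((residual n).1 x - (residual m).1 x) ^+ 2 <= K * (q m - q n).
  move=> mn; set D := jet_sub (residual m) 1 (residual n).
  have CD : C1_periodic L D by apply: C1_periodic_sub; exact: residual_C1.
  rewrite /q -energy_residual_diff//.
  have [x' x'J D1] := periodic_representative L0 y x.
  rewrite (_ : (_ - _) ^+ 2 = D.1 x ^+ 2); last by rewrite /D /=; ring.
  rewrite D1; last by have [] := CD.
  by apply: energy_sobolev => //; have [] := CD.
have [g cg gP] : exists2 g : R -> R, continuous g &
    forall d, 0 < d -> exists n, forall m x, (n <= m)%N -> `|g x - (residual m).1 x| <= d.
  apply: uniform_cauchy_limit => // e e0.
  have [n nP] := q_cauchy (divr_gt0 (exprn_gt0 2 e0) K0).
  exists n => m x nm; rewrite -ler_sqr ?nnegrE ?(ltW e0)// real_normK ?num_real//.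
  rewrite (le_trans (unif _ _ _ nm))// mulrC -ler_pdivlMr//; exact: nP.
have gL : periodic_on L g.
  move=> x; apply/eqP; rewrite -subr_eq0 -normr_le0; apply/ler_addgt0Pr => e e0.
  have [n nP] := gP (e / 2) (divr_gt0 e0 (ltr0Sn _ _)).
  have [_ rL] := residual_C1 n.
  have := nP n x (leqnn n); have := nP n (x + L) (leqnn n).
  rewrite rL !ler_norml => /andP[? ?] /andP[? ?]; apply/andP; split; lra.
have gu j : ip g (u j) = 0.
  set M := \intab_[y, y + L] (fun x => `|u j x|).
  have M0 : 0 <= M by apply: intab_ge0.
  apply/eqP; rewrite -normr_le0; apply/ler_addgt0Pr => e e0; rewrite add0r.
  have e1 : 0 < e / (M + 1) by rewrite divr_gt0// ltr_pwDr.
  have [n nP] := gP _ e1.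
  have := ip_residual (n + j.+1) j; rewrite leq_addl => r0.
  have -> : ip g (u j) =
      \intab_[y, y + L] (fun x => u j x * (g x - 1 * (residual (n + j.+1)).1 x)).
    rewrite -[RHS]/(ip (u j) (fun x => g x - 1 * (residual (n + j.+1)).1 x)).
    by rewrite ip_subr// !(ipC _ _ (u j)) r0; ring.
  rewrite (le_trans (intab_bound_mul (k := e / (M + 1)) _ _ _))//.
  - exact: continuous_integrable.
  - exact: continuous_lincomb.
  - by move=> x _; rewrite mul1r nP// leq_addr.
  rewrite -/M mulrAC ler_pdivrMr ?ltr_pwDr//.
  by rewrite ler_pM2l//; lra.
have g0 : ip g g <= 0.
  have cgg : continuous (fun x => g x * g x) by exact: continuousM_fun.
  have cgg' : continuous (fun x => - (g x * g x)) by move=> x; apply: cvgN; exact: cgg.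
  have ggL : periodic_on L (fun x => g x * g x) by move=> x; rewrite gL.
  rewrite /ip -(intab_shift L0 y cgg ggL) -oppr_ge0 -mulN1r -intabZ; last first.
    exact: continuous_integrable.
  rewrite (@eq_intab _ _ (fun x => - (g x * g x))); last by move=> x _; rewrite mulN1r.
  apply: ae_circle_intab_ge0 => //.
  have gu' k : \int[circle_measure L]_x (g x * u k x) = 0.
    have cgu : continuous (fun x => g x * u k x) by exact: continuousM_fun.
    rewrite integral_circle// (intab_shift L0 y)//; first exact: gu.
    by move=> x; rewrite gL; have [_ /= ->] := U_C1 k.
  have [A [mA A0 sA]] := eigenbasis_complete eb (Lfun_continuous_periodic L0 cg gL) gu'.
  exists A; split=> // x /= nx; apply: sA => /= gx; apply: nx.
  by rewrite gx mul0r oppr0.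
have dL : 0 < d / (2 * L) by rewrite divr_gt0// mulr_gt0.
have [n0 nP] := gP (Num.sqrt (d / (2 * L))) ltac:(by rewrite sqrtr_gt0).
exists n0 => n n0n.
have cgg : continuous (fun x => 2 * (g x * g x)).
  by move=> x; apply: cvgM; [exact: cvg_cst|apply: continuousM_fun].
have cc : continuous (fun _ : R => d / L) by move=> x; exact: cst_continuous.
have : ip (residual n).1 (residual n).1 <=
    \intab_[y, y + L] (fun x => 2 * (g x * g x) + d / L).
  apply: le_intab.
  - by apply: continuous_integrable; exact: continuousM_fun.
  - by apply: integrableD_on; exact: continuous_integrable.
  move=> x _; have := nP n x n0n; rewrite -ler_sqr ?nnegrE ?sqrtr_ge0//.
  rewrite real_normK ?num_real// sqr_sqrtr ?(ltW dL)//.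
  have -> : d / (2 * L) = d / L / 2 by field; rewrite gt_eqF.
  have := sqr_ge0 (g x + (g x - (residual n).1 x)); rewrite !expr2; lra.
rewrite intabD; [|exact: continuous_integrable..].
rewrite intabZ; last by apply: continuous_integrable; exact: continuousM_fun.
rewrite -/(ip g g) intab_cst; last by rewrite lerDl ltW.
have -> : d / L * (y + L - y) = d by field; rewrite gt_eqF.
lra.
Qed.

(** Each residual step lowers the energy by lam n * c ^ 2 and the squared L^2 norm by
    c ^ 2, where c is the n-th coefficient.  As c = 0 for n < k and lam k <= lam n
    otherwise, energy - lam k * norm decreases along the steps, and its limit is
    nonnegative because the residuals tend to 0 in L^2. *)
Lemma energy_lower k : (forall j, (j < k)%N -> ip F.1 (u j) = 0) ->
  lam k * ip F.1 F.1 <= energy F F.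
Proof.
move=> Fu; pose D n := q n - lam k * ip (residual n).1 (residual n).1.
have Ddec n : D n <= D 0%N.
  elim: n => // n; apply: le_trans; rewrite /D /q energy_residual ip_residual_sq.
  have [nk|kn] := ltnP n k; first by rewrite Fu// expr0n /= !mulr0 !subr0.
  have := eigenbasis_sorted eb kn; rewrite -subr_ge0 => h.
  by have := mulr_ge0 h (sqr_ge0 (ip F.1 (u n))); lra.
rewrite -subr_ge0 -[energy F F - _]/(D 0%N) -oppr_le0; apply/ler_addgt0Pr => e e0.
have lk := lam_ge0 k.
have [n nP] := residual_l2_cvg (divr_gt0 e0 (ltr_pwDr ltr01 lk)).
have := nP n (leqnn n); have := Ddec n; have := q_ge0 n; rewrite /D.
move: (ip _ _) (D 0%N) => I D0 q0 h1 h2.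
have : lam k * I <= e.
  have := ler_wpM2l lk h2; move/le_trans; apply.
  rewrite mulrCA -[leRHS]mulr1 ler_wpM2l ?(ltW e0)//.
  by rewrite ler_pdivrMr ?ltr_pwDr//; lra.
lra.
Qed.

End Residual.

Hypothesis V1 : forall x, V x <= 1.

(** Among the combinations of k + 1 independent trial functions, one is nonzero and
    orthogonal to the first k eigenfunctions; energy_lower applies to it. *)
Lemma minmax k M (E : 'I_k.+1 -> (R -> R) * (R -> R)) : 0 <= M ->
  (forall i, C1_periodic L (E i)) ->
  (forall i j, i != j -> ip (E i).1 (E j).1 = 0 /\ ip (E i).2 (E j).2 = 0) ->
  (forall i, 0 < ip (E i).1 (E i).1 /\ ip (E i).2 (E i).2 <= M * ip (E i).1 (E i).1) ->
  lam k <= 1 + M.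
Proof.
move=> M0 CE Eorth EM.
pose A : 'M[R]_(k.+1, k) := \matrix_(i, j) ip (E i).1 (u j).
have : kermx A != 0.
  rewrite kermx_eq0 /row_free neq_ltn ltnS; apply/orP; left.
  exact: rank_leq_col.
rewrite -nz_row_eq0; set v := nz_row (kermx A) => v0.
have vA : v *m A = 0 by apply/sub_kermxP; exact: nz_row_sub.
have cE i : continuous (E i).1 /\ continuous (E i).2.
  exact: C1_periodic_continuous (CE i).
pose F := (fun x => \sum_(i < k.+1) v 0 i * (E i).1 x,
           fun x => \sum_(i < k.+1) v 0 i * (E i).2 x).
have Hv (c : 'I_k.+1 -> R) (f : 'I_k.+1 -> R -> R) r : (forall i, continuous (f i)) ->
    continuous (fun x => \sum_(i <- r) c i * f i x) /\
    forall g, continuous g -> ip (fun x => \sum_(i <- r) c i * f i x) g =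
      \sum_(i <- r) c i * ip (f i) g.
  move=> cf; elim: r => [|i r [cr IH]].
    under eq_fun do rewrite big_nil; split; first by move=> x; exact: cst_continuous.
    move=> g cg; rewrite big_nil /ip (@eq_intab _ _ (fun=> 0)).
      by rewrite intab_cst ?mul0r// lerDl ltW.
    by move=> x _; rewrite mul0r.
  have E1 : (fun x => \sum_(j <- i :: r) c j * f j x) =
      (fun x => \sum_(j <- r) c j * f j x - (- c i) * f i x).
    by apply/funext => x; rewrite big_cons; ring.
  rewrite E1; split; first exact: continuous_lincomb.
  by move=> g cg; rewrite ip_subl// IH// big_cons; ring.
have csum c f cf := (Hv c f (index_enum _) cf).1.
have ipsum c f g cf := (Hv c f (index_enum _) cf).2 g.
have CF : C1_periodic L F.
  split; last by move=> x /=; apply: eq_bigr => i _; have [_ ->] := CE i.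
  split; last by apply: csum => i; have [] := cE i.
  move=> x; have dE i : is_derive x 1 (fun x => v 0 i * (E i).1 x) (v 0 i * (E i).2 x).
    by have [[dEi _] _] := CE i; have dx := dEi x; exact: (is_deriveZ (v 0 i) dx).
  have := is_derive_sum dE.
  by rewrite (_ : \sum_(i < k.+1) _ = F.1)//; apply/funext => z; rewrite fct_sumE.
have FE : ip F.1 F.1 = \sum_(i < k.+1) v 0 i ^+ 2 * ip (E i).1 (E i).1.
  rewrite ipsum; [|by move=> i; have [] := cE i|by apply: csum => i; have [] := cE i].
  apply: eq_bigr => i _; rewrite ipC ipsum; [|by move=> j; have [] := cE j|by have [] := cE i].
  rewrite (bigD1 i)//= big1 ?addr0 ?expr2 ?mulrA// => j ji.
  by rewrite (Eorth j i ji).1 mulr0.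
have FE2 : ip F.2 F.2 = \sum_(i < k.+1) v 0 i ^+ 2 * ip (E i).2 (E i).2.
  rewrite ipsum; [|by move=> i; have [] := cE i|by apply: csum => i; have [] := cE i].
  apply: eq_bigr => i _; rewrite ipC ipsum; [|by move=> j; have [] := cE j|by have [] := cE i].
  rewrite (bigD1 i)//= big1 ?addr0 ?expr2 ?mulrA// => j ji.
  by rewrite (Eorth j i ji).2 mulr0.
have Fpos : 0 < ip F.1 F.1.
  have [i vi] : exists i, v 0 i != 0.
    by apply/existsP; apply: contraNT v0 => /existsPn H; apply/eqP/rowP => i;
      rewrite mxE; apply/eqP; have := H i; rewrite negbK.
  rewrite FE (bigD1 i)//= ltr_pwDl//.
    by rewrite mulr_gt0 ?(EM i).1// exprn_even_gt0.
  by apply: sumr_ge0 => j _; rewrite mulr_ge0 ?sqr_ge0// ltW// (EM j).1.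
have Fu j : (j < k)%N -> ip F.1 (u j) = 0.
  move=> jk; rewrite ipsum; [|by move=> i; have [] := cE i|exact: cU].
  transitivity ((v *m A) 0 (Ordinal jk)); last by rewrite vA mxE.
  by rewrite [RHS]mxE; apply: eq_bigr => i _; rewrite mxE.
have := energy_lower CF Fu.
have CF1 : C1 F.1 F.2 by have [] := CF.
have := energy_le Vi V1 CF1.
have F2M : ip F.2 F.2 <= M * ip F.1 F.1.
  rewrite FE FE2 mulr_sumr; apply: ler_sum => i _.
  by rewrite mulrCA ler_wpM2l ?sqr_ge0// (EM i).2.
move=> h1 h2; rewrite -(ler_pM2r Fpos); lra.
Qed.

End MinMax.

(** * Waves as trial functions *)

Section Trigonometry.
Context {R : realType}.

Lemma sqr_le_norm (a b : R) : `|a| <= b -> a ^+ 2 <= b ^+ 2.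
Proof.
move=> ab; rewrite -(real_normK (num_real a)) lerXn2r ?nnegrE//.
exact: le_trans ab.
Qed.

Variables (L y : R).
Hypothesis L0 : 0 < L.
Implicit Types (a b c x : R) (m n : nat).

Definition freq m : R := 2 * pi * m%:R / L.

Definition wave (w c : R) : (R -> R) * (R -> R) :=
  (fun x => cos (w * (x - y) + c), fun x => - w * sin (w * (x - y) + c)).

Lemma is_derive_affine w c x : is_derive x 1 (fun z => w * (z - y) + c) w.
Proof.
have dx := is_derive_id x (1 : R).
have d1 := is_deriveB dx (is_derive_cst y x 1).
have d2 := is_deriveD (is_deriveZ w d1) (is_derive_cst c x 1).
by apply: is_derive_eq d2 _; rewrite subr0 addr0 /GRing.scale /= mulr1.
Qed.

Lemma C1_wave w c : C1 (wave w c).1 (wave w c).2.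
Proof.
split => x /=.
  have := @is_derive1_comp R cos (fun z => w * (z - y) + c) x _ _
    (is_derive_cos _) (is_derive_affine w c x).
  by rewrite mulNr [sin _ * _]mulrC -mulNr.
apply: cvgM; first exact: cvg_cst.
apply: continuous_comp; last exact: continuous_sin.
by have [/derivable1_diffP/differentiable_continuous] := is_derive_affine w c x.
Qed.

Lemma wave_derive w c : (wave w c).2 = (fun x => w * (wave w (c + pi / 2)).1 x).
Proof. by apply/funext => x /=; rewrite addrA cosDpihalf mulNr mulrN. Qed.

Lemma C1_wave_derive w c : C1 (wave w c).2 (fun x => - w ^+ 2 * (wave w c).1 x).
Proof.
have [dw cw] := C1_wave w (c + pi / 2).
have E : (fun x => - w ^+ 2 * (wave w c).1 x) = (fun x => w * (wave w (c + pi / 2)).2 x).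
  by apply/funext => x /=; rewrite addrA sinDpihalf; ring.
rewrite E wave_derive; split.
  by move=> x; have dx := dw x; exact: (is_deriveZ w dx).
by move=> x; apply: cvgM; [exact: cvg_cst|exact: cw].
Qed.

Lemma freqL m : freq m * L = pi *+ 2 *+ m.
Proof. by rewrite /freq mulfVK ?gt_eqF// -[RHS]mulr_natr -[pi *+ 2]mulr_natr; ring. Qed.

Lemma freq_ge0 m : 0 <= freq m.
Proof. by rewrite /freq !mulr_ge0 ?pi_ge0 ?invr_ge0 ?(ltW L0). Qed.

Lemma freq_gt0 m : (0 < m)%N -> 0 < freq m.
Proof. by move=> m0; rewrite /freq !mulr_gt0 ?pi_gt0 ?invr_gt0 ?ltr0n. Qed.

Lemma freqD m n : freq (m + n) = freq m + freq n.
Proof. by rewrite /freq natrD; ring. Qed.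

Lemma freq0 : freq 0 = 0.
Proof. by rewrite /freq mulr0 mul0r. Qed.

Lemma wave_periodic m c : periodic_on L (wave (freq m) c).1.
Proof.
move=> x /=.
rewrite (_ : _ + c = freq m * (x - y) + c + freq m * L); last by ring.
by rewrite freqL (periodicn (@cosD2pi R)).
Qed.

Lemma C1_periodic_wave m c : C1_periodic L (wave (freq m) c).
Proof. by split; [exact: C1_wave|exact: wave_periodic]. Qed.

Lemma wave_continuous w c : continuous (wave w c).1.
Proof. exact: C1_continuous (C1_wave w c). Qed.

Lemma intab_wave m c :
  \intab_[y, y + L] (wave (freq m) c).1 = if m == 0%N then L * cos c else 0.
Proof.
case: m => [|m] /=.
  rewrite (@eq_intab _ _ (fun=> cos c)); last by move=> x _; rewrite freq0 mul0r add0r.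
  by rewrite intab_cst ?lerDl ?(ltW L0)//; ring.
have w0 : freq m.+1 != 0 by rewrite gt_eqF// freq_gt0.
have := C1_intab (C1_wave (freq m.+1) (c - pi / 2)) (_ : y <= y + L).
rewrite wave_periodic subrr wave_derive subrK intabZ; last first.
  exact/continuous_integrable/wave_continuous.
by rewrite lerDl ltW// => /(_ isT) /eqP; rewrite mulf_eq0 (negbTE w0) => /eqP.
Qed.

Local Notation ip := (ip L y).

Lemma ip_wave_le m n c d : (n <= m)%N ->
  ip (wave (freq m) c).1 (wave (freq n) d).1 =
  2^-1 * ((if m == n then L * cos (c - d) else 0) +
          (if (m + n == 0)%N then L * cos (c + d) else 0)).
Proof.
move=> nm; rewrite -(@intab_wave (m + n)).
have -> : (m == n) = (m - n == 0)%N by rewrite subn_eq0 eqn_leq nm andbT.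
rewrite -(@intab_wave (m - n)).
have ci k e : integrable_on y (y + L) (wave (freq k) e).1.
  exact/continuous_integrable/wave_continuous.
rewrite -intabD// -intabZ; last exact: integrableD_on.
apply: eq_intab => x _ /=.
rewrite freqD (_ : freq m = freq (m - n) + freq n); last by rewrite -freqD subnK.
set p := freq (m - n); set q := freq n.
have -> : p * (x - y) + (c - d) = ((p + q) * (x - y) + c) - (q * (x - y) + d) by ring.
have -> : (p + q + q) * (x - y) + (c + d) = ((p + q) * (x - y) + c) + (q * (x - y) + d) by ring.
by move: ((p + q) * (x - y) + c) (q * (x - y) + d) => A B; rewrite cosB cosD; field.
Qed.

Lemma ip_wave_neq m n c d : m != n ->
  ip (wave (freq m) c).1 (wave (freq n) d).1 = 0.
Proof.
move=> mn; have aux p q e f : (q < p)%N -> ip (wave (freq p) e).1 (wave (freq q) f).1 = 0.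
  move=> qp; rewrite ip_wave_le ?(ltnW qp)// gtn_eqF// addn_eq0.
  by rewrite gtn_eqF ?(leq_ltn_trans _ qp)//= addr0 mulr0.
by move: mn; rewrite neq_ltn => /orP[mn|nm]; [rewrite ipC|]; exact: aux.
Qed.

Lemma ip_wave_same m c d : (0 < m)%N ->
  ip (wave (freq m) c).1 (wave (freq m) d).1 = 2^-1 * (L * cos (c - d)).
Proof.
by move=> m0; rewrite ip_wave_le// eqxx addn_eq0 gtn_eqF//= addr0.
Qed.

Lemma ip_wave0 c d : ip (wave (freq 0) c).1 (wave (freq 0) d).1 = L * cos c * cos d.
Proof. by rewrite ip_wave_le//= cosB cosD; field. Qed.

(** The family trig is 1, cos, sin, cos, sin, and so on, up to signs: the phase pi / 2
    turns the cosine of a wave into a sine. *)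
Definition trig_phase n : R := if odd n || (n == 0)%N then 0 else pi / 2.
Definition trig n := wave (freq (uphalf n)) (trig_phase n).

Lemma trig_phaseB n m : n != m -> uphalf n = uphalf m -> (0 < uphalf n)%N ->
  cos (trig_phase n - trig_phase m) = 0.
Proof.
move=> nm unm u0; have n0 : (n == 0)%N = false by case: n u0 {nm unm}.
have m0 : (m == 0)%N = false by move: u0; rewrite unm; case: m {nm unm}.
rewrite /trig_phase n0 m0 !orbF.
have : odd n != odd m.
  apply: contraNN nm => /eqP onm.
  move: unm; rewrite !uphalf_half onm => /addnI nm2.
  by rewrite -(odd_double_half n) -(odd_double_half m) onm nm2.
by case: (odd n); case: (odd m) => // _; rewrite ?subr0 ?sub0r ?cosN cos_pihalf.
Qed.

Lemma trig_orthogonal n m : n != m ->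
  ip (trig n).1 (trig m).1 = 0 /\ ip (trig n).2 (trig m).2 = 0.
Proof.
move=> nm.
have H c : ip (wave (freq (uphalf n)) (trig_phase n + c)).1
    (wave (freq (uphalf m)) (trig_phase m + c)).1 = 0.
  have [unm|unm] := eqVneq (uphalf n) (uphalf m); last exact: ip_wave_neq.
  rewrite unm; have u0 : (0 < uphalf m)%N.
    rewrite lt0n; apply: contraNN nm => /eqP um0.
    by move: unm; rewrite um0; case: n => [|[]//]; case: m um0 => [|[]//].
  rewrite ip_wave_same// (_ : _ - _ = trig_phase n - trig_phase m); last by ring.
  by rewrite trig_phaseB ?mulr0// unm.
split; first by have := H 0; rewrite !addr0.
have ci w c : integrable_on y (y + L) (fun x => (wave (freq (uphalf n)) (trig_phase n + pi / 2)).1 x * (wave w c).1 x).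
  by apply: continuous_integrable; apply: continuousM_fun; exact: wave_continuous.
rewrite /trig !wave_derive /ip.
rewrite (@eq_intab _ _ (fun x => (freq (uphalf n) * freq (uphalf m)) *
  ((wave (freq (uphalf n)) (trig_phase n + pi / 2)).1 x *
   (wave (freq (uphalf m)) (trig_phase m + pi / 2)).1 x))).
  by rewrite intabZ// -/(ip _ _) H mulr0.
by move=> x _; ring.
Qed.

Lemma trig_norm n : 0 < ip (trig n).1 (trig n).1 /\
  ip (trig n).2 (trig n).2 = freq (uphalf n) ^+ 2 * ip (trig n).1 (trig n).1.
Proof.
have ci w c d : integrable_on y (y + L) (fun x => (wave w c).1 x * (wave w d).1 x).
  by apply: continuous_integrable; apply: continuousM_fun; exact: wave_continuous.
have E : ip (trig n).2 (trig n).2 = freq (uphalf n) ^+ 2 *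
    ip (wave (freq (uphalf n)) (trig_phase n + pi / 2)).1
       (wave (freq (uphalf n)) (trig_phase n + pi / 2)).1.
  rewrite /trig !wave_derive /ip -intabZ//; apply: eq_intab => x _; ring.
rewrite E /trig; have [u0|u0] := posnP (uphalf n); last first.
  by rewrite !ip_wave_same// !subrr cos0 mulr1; split=> //; rewrite mulr_gt0// invr_gt0.
rewrite u0; split; last by rewrite freq0 expr0n /= !mul0r.
have -> : n = 0%N by move: u0; case: (n) => [|[|k]].
by rewrite ip_wave0 /trig_phase eqxx orbT cos0 !mulr1.
Qed.

Lemma freq_le m n : (m <= n)%N -> freq m <= freq n.
Proof. by move=> /subnK <-; rewrite freqD lerDr freq_ge0. Qed.

Lemma eigenvalue_upper (V : R -> R) lam u k :
  integrable_on y (y + L) (fun x => V x - 1) -> (forall x, V x <= 1) ->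
  sobolev_const L * perturbation L y V <= 2^-1 -> eigenbasis L V lam u ->
  lam k <= 1 + freq (uphalf k) ^+ 2.
Proof.
move=> Vi V1 small eb.
apply: (minmax L0 Vi small eb V1 (E := fun i : 'I_k.+1 => trig i)).
- exact: sqr_ge0.
- by move=> i; exact: C1_periodic_wave.
- by move=> i j ij; exact: trig_orthogonal.
- move=> i; have [ti ->] := trig_norm i; split => //.
  rewrite ler_wpM2r ?(ltW ti)// lerXn2r ?nnegrE ?freq_ge0// freq_le//.
  by rewrite uphalf_leq // -ltnS.
Qed.

(** Written in terms of 1 - cos t because that is the quantity which the resonance
    estimate controls. *)
Lemma cos_near_period (d t : R) : 0 < d -> d < pi -> 0 <= t -> 1 - cos t < 1 - cos d ->
  exists j, `|t - pi *+ 2 *+ j| <= d.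
Proof.
move=> d0 dpi t0 td.
have p2 : 0 < pi *+ 2 :> R by rewrite mulrn_wgt0// pi_gt0.
pose z := Num.floor ((t + pi) / (pi *+ 2)).
have z0 : 0 <= z.
  by rewrite floor_ge0; apply: divr_ge0; [rewrite addr_ge0 ?pi_ge0|exact: ltW].
have /andP[] := floor_itv ((t + pi) / (pi *+ 2)); rewrite -/z.
rewrite ler_pdivlMr// ltr_pdivrMr// intrD.
case: z z0 => // j _ /= h1 h2; exists j.
set s := t - _.
have sE : t = s + pi *+ 2 *+ j by rewrite /s subrK.
have spi : - pi <= s < pi.
  rewrite /s -[_ *+ j]mulr_natr; rewrite -[pi *+ 2]mulr_natr in h1 h2 *.
  by apply/andP; split; lra.
move: td; rewrite sE (periodicn (@cosD2pi R)) ltrD2l ltrN2 -[cos s]cos_norm.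
have ns : `|s| <= pi by rewrite ler_norml; move: spi => /andP[-> /ltW].
rewrite ltr_cos ?in_itv /= ?normr_ge0 ?ns ?(ltW d0) ?(ltW dpi)//.
exact: ltW.
Qed.

Lemma cos_lip a b : `|cos a - cos b| <= `|a - b|.
Proof.
wlog ab : a b / b <= a.
  by move=> H; have [|/ltW ba] := leP b a; [exact: H|rewrite distrC [leRHS]distrC; exact: H].
have [|c _ ->] := @MVT_segment _ cos (fun x => - sin x) b a ab.
  by apply: continuous_subspaceT; exact: continuous_cos.
by rewrite normrM ler_piMl// normrN sin_max.
Qed.

Lemma sin_lip a b : `|sin a - sin b| <= `|a - b|.
Proof.
wlog ab : a b / b <= a.
  by move=> H; have [|/ltW ba] := leP b a; [exact: H|rewrite distrC [leRHS]distrC; exact: H].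
have [|c _ ->] := @MVT_segment _ sin cos b a ab.
  by apply: continuous_subspaceT; exact: continuous_sin.
by rewrite normrM ler_piMl// cos_max.
Qed.

End Trigonometry.

(** * Eigenfunctions are almost sinusoidal *)

Section NearSinusoid.
Context {R : realType}.
Variables (L y : R).
Hypothesis L0 : 0 < L.
Implicit Types (V u : R -> R) (lam Lam a b x : R).

Local Notation S := (sobolev_const L).
Local Notation ip := (ip L y).

Definition sup_bound Lam : R := Num.sqrt (2 * S * Lam).

Section OneEigenfunction.
Variables (V : R -> R) (lam Lam : R) (u : R -> R).
Hypotheses (Vi : integrable_on y (y + L) (fun x => V x - 1))
  (small : S * perturbation L y V <= 2^-1) (eu : eigenfunction L V lam u)
  (un : ip u u = 1) (lamLam : lam <= Lam).
Local Notation rho := (perturbation L y V).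
Local Notation K := (sup_bound Lam).
Local Notation u' := (derive1 u).

Let Cu : C1_periodic L (jet u). Proof. exact: eigenfunction_C1 eu. Qed.
Let cu : continuous u. Proof. by have [/C1_continuous] := Cu. Qed.
Let du x : is_derive x 1 u (u' x). Proof. by have [[+ _] _] := Cu; exact. Qed.

Lemma energy_eigenfunction : energy L y V (jet u) (jet u) = lam.
Proof. by rewrite (weak_form L0 Vi eu Cu) un mulr1. Qed.

Lemma eigenfunction_bound x : `|u x| <= K.
Proof.
have [x' x'J ->] := periodic_representative L0 y x; last by have [] := Cu.
rewrite -sqrtr_sqr ler_wsqrtr//.
have [C1u _] := Cu.
rewrite (le_trans (energy_sobolev L0 Vi small C1u x'J))// energy_eigenfunction.
by rewrite ler_wpM2l// mulr_ge0// ltW// sobolev_const_gt0.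
Qed.

Lemma sup_bound_ge0 : 0 <= K. Proof. exact: sqrtr_ge0. Qed.

Lemma rho_ge0 : 0 <= rho. Proof. exact: intab_ge0. Qed.

Lemma eigenvalue_lower : 1 - K ^+ 2 * rho <= lam.
Proof.
rewrite -energy_eigenfunction /energy un /=.
have := ip_ge0 L y u'.
have b x : y <= x <= y + L -> `|u x * u x| <= K ^+ 2.
  by move=> _; rewrite normrM expr2 ler_pM// eigenfunction_bound.
have := intab_bound_mul Vi (continuousM_fun cu cu) b.
rewrite -/(perturbation L y V) ler_norml => /andP[h _]; lra.
Qed.

Lemma defect_integral a b h k : y <= a -> b <= y + L -> continuous h ->
  (forall x, a <= x <= b -> `|h x| <= k) -> 0 <= k ->
  `|\intab_[a, b] (fun x => (V x - 1) * h x)| <= k * rho.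
Proof.
move=> ya bL ch hk k0.
have Vab : integrable_on a b (fun x => V x - 1) by exact: integrable_subitv Vi.
rewrite (le_trans (intab_bound_mul Vab ch hk))// ler_wpM2l//.
exact: intab_norm_sub.
Qed.

Lemma derive_increment a b : y <= a -> a <= b -> b <= y + L ->
  `|u' b - u' a| <= K * rho + `|lam - 1| * (K * L).
Proof.
move=> ya ab bL; have [_ _ _ /(_ _ _ ab)[_ ->]] := eu.
have Vab : integrable_on a b (fun x => V x - 1) by exact: integrable_subitv Vi.
rewrite (@eq_intab _ _ (fun x => (V x - 1) * u x - (lam - 1) * u x)); last first.
  by move=> x _; ring.
have iu : integrable_on a b u by exact: continuous_integrable.
rewrite intabB; [|exact: integrableM_on|exact: integrableZ_on].
rewrite intabZ// (le_trans (ler_normB _ _))// lerD//.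
  apply: defect_integral => //; last exact: sup_bound_ge0.
  by move=> x _; exact: eigenfunction_bound.
rewrite normrM ler_wpM2l//.
rewrite (le_trans (intab_bound ab iu (fun x _ => eigenfunction_bound x)))//.
by rewrite ler_wpM2l ?sup_bound_ge0//; lra.
Qed.

(** u' vanishes somewhere, by Rolle's theorem on one period. *)
Lemma derive_bound x : y <= x <= y + L ->
  `|u' x| <= K * rho + `|lam - 1| * (K * L).
Proof.
move=> /andP[yx xL].
have uL : u y = u (y + L) by have [_ /= ->] := Cu.
have yL : y < y + L by rewrite ltrDl.
have [||c] := @Rolle _ u y (y + L) yL _ _ uL.
- by move=> z _; have [] := du z.
- by apply: continuous_subspaceT.
rewrite in_itv /= => /andP[yc cL] dc.
have c0 : u' c = 0 by rewrite derive1E; have /@derive_val := dc.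
have [xc|cx] := leP x c.
  have := derive_increment yx xc (ltW cL).
  by rewrite c0 sub0r normrN.
have := derive_increment (ltW yc) (ltW cx) xL.
by rewrite c0 subr0.
Qed.

(** The derivative of the Wronskian u' h - u h' is (V - lam) u h + k u h when
    h'' = - k h.  For k = lam - 1 only the perturbation remains. *)
Lemma wronskian a b h h' h'' k : y <= a -> a < b -> b <= y + L ->
  C1 h h' -> C1 h' h'' -> (forall x, h'' x = - k * h x) ->
  (u' b * h b - u b * h' b) - (u' a * h a - u a * h' a) =
  \intab_[a, b] (fun x => (V x - 1) * (u x * h x)) +
  (k - (lam - 1)) * \intab_[a, b] (fun x => u x * h x).
Proof.
move=> ya ab bL Ch Ch' h''E.
have ch := C1_continuous Ch; have ch' := C1_continuous Ch'.
have [C1u _] := Cu; have [_ /= cu'] := C1u; have [_ ch''] := Ch'.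
have cuh : continuous (fun x => u x * h x) by exact: continuousM_fun.
have E1 := eigenfunction_ibp eu Ch ab.
have := C1_intab (C1_mul C1u Ch') (ltW ab).
rewrite /= intabD; [|apply: continuous_integrable; exact: continuousM_fun..].
have -> : \intab_[a, b] (fun x => u x * h'' x) = - k * \intab_[a, b] (fun x => u x * h x).
  rewrite -intabZ; last exact: continuous_integrable.
  by apply: eq_intab => x _; rewrite h''E; ring.
have -> : \intab_[a, b] (fun x => h' x * u' x) = \intab_[a, b] (fun x => u' x * h' x).
  by apply: eq_intab => x _; ring.
move=> E2.
have Vab : integrable_on a b (fun x => V x - 1) by exact: integrable_subitv Vi.
have E3 : \intab_[a, b] (fun x => (V x - lam) * u x * h x) =
    \intab_[a, b] (fun x => (V x - 1) * (u x * h x)) - (lam - 1) * \intab_[a, b] (fun x => u x * h x).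
  rewrite -intabZ; last exact: continuous_integrable.
  rewrite -intabB; [|exact: integrableM_on|exact/integrableZ_on/continuous_integrable].
  by apply: eq_intab => x _; ring.
move: E1 E2; rewrite E3; lra.
Qed.

Lemma low_frequency x : y <= x <= y + L ->
  `|u x - u y| <= L * (K * rho + `|lam - 1| * (K * L)).
Proof.
move=> xJ; have /andP[yx xL] := xJ.
have [||c /[!in_itv]/= /andP[yc cx] ->] := @MVT_segment _ u u' y x yx.
- by move=> z _; exact: du.
- by apply: continuous_subspaceT.
rewrite normrM mulrC ler_pM//.
  by rewrite ger0_norm ?subr_ge0//; lra.
by apply: derive_bound; rewrite yc (le_trans cx).
Qed.

Section HighFrequency.
Variable om : R.
Hypothesis omE : om ^+ 2 = lam - 1.
Local Notation r := (K * rho).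
Local Notation C x := (cos (om * (x - y))).
Local Notation Sn x := (sin (om * (x - y))).

Let r0 : 0 <= r.
Proof. by rewrite mulr_ge0// ?sup_bound_ge0// rho_ge0. Qed.

Let wave_defect c x : y < x -> x <= y + L ->
  `|(u' x * (wave y om c).1 x - u x * (wave y om c).2 x) -
    (u' y * (wave y om c).1 y - u y * (wave y om c).2 y)| <= r.
Proof.
move=> yx xL.
rewrite (wronskian (lexx y) yx xL (C1_wave y om c) (C1_wave_derive y om c)
  (fun=> erefl)) omE subrr mul0r addr0.
have cw := C1_continuous (C1_wave y om c).
rewrite (defect_integral _ _ (continuousM_fun cu cw))// ?sup_bound_ge0//.
move=> z _; rewrite normrM -[leRHS]mulr1 ler_pM// ?eigenfunction_bound//.
exact: cos_max.
Qed.

(** The pair (u', om u) rotates with angular velocity om up to the error allowed by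
    the almost conserved Wronskians with the two waves of frequency om. *)
Lemma rotation x : y <= x <= y + L -> exists e1 e2 : R,
  [/\ `|e1| <= r, `|e2| <= r,
      u' x * C x + om * u x * Sn x - u' y = e1 &
      u' x * Sn x - om * u x * C x + om * u y = e2].
Proof.
move=> /andP[]; rewrite le_eqVlt => /predU1P[<- _|yx xL].
  exists 0, 0; rewrite normr0 subrr mulr0 cos0 sin0; split=> //; ring.
exists (u' x * C x + om * u x * Sn x - u' y), (u' x * Sn x - om * u x * C x + om * u y).
split=> //.
  have := wave_defect 0 yx xL; rewrite /= !addr0 subrr mulr0 cos0 sin0.
  by congr (`|_| <= _); ring.
have := wave_defect (- (pi / 2)) yx xL; rewrite /= subrr mulr0.
rewrite !cosBpihalf !sinBpihalf cos0 sin0.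
by congr (`|_| <= _); ring.
Qed.

Lemma high_frequency x : y <= x <= y + L ->
  `|om * u x - (om * u y * C x + u' y * Sn x)| <= 2 * r /\
  `|u' x - (u' y * C x - om * u y * Sn x)| <= 2 * r.
Proof.
move=> /rotation[e1 [e2 [h1 h2 E1 E2]]]; have cs := cos2Dsin2 (om * (x - y)).
have -> : om * u x - (om * u y * C x + u' y * Sn x) = e1 * Sn x - e2 * C x.
  by rewrite -E1 -E2 -[om * u x in LHS]mulr1 -cs; ring.
have -> : u' x - (u' y * C x - om * u y * Sn x) = e1 * C x + e2 * Sn x.
  by rewrite -E1 -E2 -[u' x in LHS]mulr1 -cs; ring.
have b e (z : R) : `|e| <= r -> `|z| <= 1 -> `|e * z| <= r.
  by move=> er z1; rewrite normrM -[leRHS]mulr1 ler_pM.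
have := b _ _ h1 (cos_max (om * (x - y))); have := b _ _ h1 (sin_max (om * (x - y))).
have := b _ _ h2 (cos_max (om * (x - y))); have := b _ _ h2 (sin_max (om * (x - y))).
move=> b1 b2 b3 b4; split.
  by rewrite (le_trans (ler_normB _ _))//; lra.
by rewrite (le_trans (ler_normD _ _))//; lra.
Qed.

(** After one period the pair (u', om u) is back at its initial value, while it has
    turned by the angle om L: either this angle is close to a multiple of 2 pi, or
    the amplitude is small. *)
Lemma resonance :
  (u' y ^+ 2 + (om * u y) ^+ 2) * (1 - cos (om * L)) <= r ^+ 2.
Proof.
have yLJ : y <= y + L <= y + L by rewrite lexx lerDl ltW.
have [e1 [e2 [h1 h2]]] := rotation yLJ.
have [C1u uL] := Cu; have /= -> := C1_periodic_derive C1u uL y; have /= -> := uL y.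
have -> : y + L - y = L by ring.
set p := u' y; set q := om * u y; move=> E1 E2.
have cs := cos2Dsin2 (om * L).
have s1 : e1 ^+ 2 <= r ^+ 2 by exact: sqr_le_norm.
have s2 : e2 ^+ 2 <= r ^+ 2 by exact: sqr_le_norm.
have : 2 * ((p ^+ 2 + q ^+ 2) * (1 - cos (om * L))) = e1 ^+ 2 + e2 ^+ 2.
  apply/eqP; rewrite -subr_eq0 -E1 -E2.
  rewrite (_ : _ - _ = - (p ^+ 2 + q ^+ 2) *
    (cos (om * L) ^+ 2 + sin (om * L) ^+ 2 - 1)); last by ring.
  by rewrite cs subrr mulr0.
lra.
Qed.

(** The normalisation of u bounds its amplitude from below, so that the resonance
    estimate does constrain om. *)
Lemma amplitude : om ^+ 2 <= 2 * L * (u' y ^+ 2 + (om * u y) ^+ 2 + 4 * r ^+ 2).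
Proof.
set A := _ + 4 * r ^+ 2.
have ci : continuous (fun x => u x * u x) by exact: continuousM_fun.
have cc : continuous (fun _ : R => 2 * A) by move=> x; exact: cst_continuous.
have -> : 2 * L * A = \intab_[y, y + L] (fun=> 2 * A).
  by rewrite intab_cst ?lerDl ?(ltW L0)//; ring.
rewrite (_ : om ^+ 2 = om ^+ 2 * ip u u); last by rewrite un mulr1.
rewrite /ip -intabZ; last exact: continuous_integrable.
apply: le_intab; [exact/integrableZ_on/continuous_integrable|exact: continuous_integrable|].
move=> x /high_frequency[h _]; rewrite /A.
set p := u' y in h *; set q := om * u y in h *.
have cs := cos2Dsin2 (om * (x - y)).
set g := _ - _ in h.
have g2 : g ^+ 2 <= (2 * r) ^+ 2 by exact: sqr_le_norm.
have E : om ^+ 2 * (u x * u x) = (q * C x + p * Sn x + g) ^+ 2 by rewrite /g; ring.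
have m2 : (q * C x + p * Sn x) ^+ 2 <= p ^+ 2 + q ^+ 2.
  rewrite -[leRHS]mulr1 -cs -subr_ge0.
  rewrite (_ : _ - _ = (q * Sn x - p * C x) ^+ 2) ?sqr_ge0//; ring.
rewrite E; have := sqr_ge0 (q * C x + p * Sn x - g); lra.
Qed.

End HighFrequency.

Lemma near_sinusoid_low d : `|lam - 1| * (K * L) * (L + 1) <= d / 2 ->
  (L + 1) * (K * rho) <= d / 2 -> forall x, `|u x - u y| <= d /\ `|u' x| <= d.
Proof.
move=> h1 h2 x.
have [C1u uL] := Cu; have u'L := C1_periodic_derive C1u uL.
have [x' x'J per] := periodic_representative L0 y x.
rewrite (per u)// (per u')//.
have r0 : 0 <= K * rho by rewrite mulr_ge0// ?sup_bound_ge0// rho_ge0.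
have k0 : 0 <= `|lam - 1| * (K * L) by rewrite !mulr_ge0// ?sup_bound_ge0// ltW.
have h3 : 0 <= L * (`|lam - 1| * (K * L)) by rewrite mulr_ge0// ltW.
have h4 : 0 <= L * (K * rho) by rewrite mulr_ge0// ltW.
have := low_frequency x'J; have := derive_bound x'J.
by move=> ? ?; split; lra.
Qed.

(** The resonance estimate puts om within D / L of an allowed frequency freq L j.  The
    two error terms are that of the Wronskians, small with the perturbation, and that
    of the replacement of om by freq L j over one period, of order D.  The lower bound
    h on om is there because u is only controlled after division by om. *)
Lemma near_sinusoid_high h D d om : 0 < h -> h <= om -> om ^+ 2 = lam - 1 ->
  0 < D -> D <= 1 -> D < pi ->
  let X := (K + K * (1 + Lam * L) / h) * (2 + Lam + L^-1) in
  let Y := L^-1 * (2 * (1 + Lam) + L^-1) in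
  X * D <= d / 2 -> Y * D <= d -> rho <= 1 ->
  2 * (K * rho) <= h * (d / 2) -> 2 * (K * rho) <= d / 2 ->
  24 * L * (K * rho) ^+ 2 < h ^+ 2 -> 6 * L * (K * rho) ^+ 2 < (1 - cos D) * h ^+ 2 ->
  exists j (a b : R), `|lam - 1 - freq L j ^+ 2| <= d /\
    forall x, `|u x - (a * cos (freq L j * (x - y)) + b * sin (freq L j * (x - y)))| <= d /\
     `|u' x - freq L j * (b * cos (freq L j * (x - y)) - a * sin (freq L j * (x - y)))| <= d.
Proof.
move=> h0 hom omE D0 D1 Dpi X Y XD YD rho1 r1 r2 r3 r4.
have om0 : 0 < om by exact: lt_le_trans hom.
set r := K * rho in r1 r2 r3 r4 *.
have r0 : 0 <= r by rewrite mulr_ge0// ?sup_bound_ge0// rho_ge0.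
have h2 : 0 < h ^+ 2 by rewrite exprn_gt0.
have om2 : h ^+ 2 <= om ^+ 2 by apply: sqr_le_norm; rewrite gtr0_norm.
set N := u' y ^+ 2 + (om * u y) ^+ 2.
have N1 : h ^+ 2 <= 6 * L * N.
  have := amplitude omE; rewrite -/N -/r => h3.
  have : h ^+ 2 <= 2 * L * (N + 4 * r ^+ 2) by exact: le_trans h3.
  by rewrite mulrDr; move: r3; lra.
have res := resonance omE; rewrite -/N -/r in res.
have cosL : 1 - cos (om * L) < 1 - cos D.
  rewrite -(ltr_pM2r h2).
  have c0 : 0 <= 1 - cos (om * L) by rewrite subr_ge0 cos_le1.
  apply: le_lt_trans r4; rewrite -subr_ge0.
  have e1 := ler_wpM2l c0 N1.
  have e2 : 6 * L * (N * (1 - cos (om * L))) <= 6 * L * r ^+ 2.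
    by rewrite ler_wpM2l// mulr_ge0// ltW.
  lra.
have [j jD] := cos_near_period D0 Dpi (mulr_ge0 (ltW om0) (ltW L0)) cosL.
rewrite -(freqL L0) -mulrBl normrM (gtr0_norm L0) in jD.
set w := freq L j in jD *.
have wD : `|om - w| <= L^-1 * D by rewrite mulrC ler_pdivlMr.
have w0 : 0 <= w by exact: freq_ge0.
have Li0 : 0 < L^-1 by rewrite invr_gt0.
have LD1 : L^-1 * D <= L^-1 by rewrite -[leRHS]mulr1 ler_wpM2l// ltW.
have Lam1 : 1 <= Lam by rewrite (le_trans _ lamLam)// -subr_ge0 -omE sqr_ge0.
have Lam0 : 0 <= Lam by exact: le_trans Lam1.
have om2Lam : om ^+ 2 <= Lam - 1 by rewrite omE lerD2r.
have omLam : om <= 1 + Lam.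
  by have := sqr_ge0 (om - 1); move: om2Lam Lam0; rewrite !expr2; lra.
have wle : w <= 1 + Lam + L^-1.
  by move: wD; rewrite ler_norml => /andP[? ?]; lra.
exists j, (u y), (u' y / om); split.
  rewrite -/w -omE subr_sqr normrM.
  apply: le_trans YD; rewrite /Y [leRHS](_ : _ = L^-1 * D * (2 * (1 + Lam) + L^-1)); last by ring.
  rewrite ler_pM// ger0_norm ?addr_ge0 ?(ltW om0)//; lra.
move=> x; have [C1u uL] := Cu; have u'L := C1_periodic_derive C1u uL.
have [x' x'J per] := periodic_representative L0 y x.
rewrite -/w (per u)// (per u')//.
have percos := wave_periodic y L0 j 0.
have -> : cos (w * (x - y)) = cos (w * (x' - y)).
  by have := per _ percos; rewrite /= !addr0.
have -> : sin (w * (x - y)) = sin (w * (x' - y)).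
  by have := per _ (wave_periodic y L0 j (- (pi / 2))); rewrite /= !cosBpihalf.
have [hu hu'] := high_frequency omE x'J.
rewrite -/r in hu hu'.
have K0 := sup_bound_ge0.
have uy : `|u y| <= K by exact: eigenfunction_bound.
have u'y : `|u' y| <= K * (1 + Lam * L).
  have yJ : y <= y <= y + L by rewrite lexx lerDl ltW.
  rewrite (le_trans (derive_bound yJ))// mulrDr mulr1 lerD//.
    by rewrite -[leRHS]mulr1 ler_wpM2l.
  rewrite mulrCA ler_wpM2l// ler_wpM2r ?(ltW L0)//.
  by rewrite -omE ger0_norm ?sqr_ge0// (le_trans om2Lam)// gerBl ler01.
set B := u' y / om.
have BE : u' y = om * B by rewrite /B mulrCA divff ?mulr1// gt_eqF.
have Bb : `|B| <= K * (1 + Lam * L) / h.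
  rewrite /B normrM ler_pM//.
  by rewrite normfV gtr0_norm// lef_pV2.
clearbody B; set s := x' - y in hu hu' *.
have sJ : 0 <= s <= L by rewrite /s; lra.
have dphase : `|om * s - w * s| <= D.
  rewrite -mulrBl normrM (le_trans _ jD)// ler_wpM2l//.
  by move: sJ => /andP[s0 sL]; rewrite ger0_norm.
have dC := le_trans (cos_lip (om * s) (w * s)) dphase.
have dS := le_trans (sin_lip (om * s) (w * s)) dphase.
set Kt := K + K * (1 + Lam * L) / h in X XD.
have Kt0 : 0 <= Kt.
  by rewrite addr_ge0// divr_ge0 ?(ltW h0)// mulr_ge0// addr_ge0// mulr_ge0// ltW.
have comb (p q P : R) : `|p| <= P -> `|q| <= P -> `|u y * p| + `|B * q| <= Kt * P.
  by move=> pP qP; rewrite !normrM /Kt mulrDl; apply: lerD; apply: ler_pM.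
have KtD : 0 <= Kt * D by rewrite mulr_ge0// ltW.
have XE : X * D = 2 * (Kt * D) + Lam * (Kt * D) + L^-1 * (Kt * D) by rewrite /X; ring.
have z1 : 0 <= Lam * (Kt * D) by rewrite mulr_ge0.
have z2 : 0 <= L^-1 * (Kt * D) by rewrite mulr_ge0// ltW.
split.
  have e1 : `|u x' - (u y * cos (om * s) + B * sin (om * s))| <= d / 2.
    rewrite -(ler_pM2l om0) -[X in X * _ <= _](gtr0_norm om0) -normrM.
    have -> : om * (u x' - (u y * cos (om * s) + B * sin (om * s))) =
      om * u x' - (om * u y * cos (om * s) + u' y * sin (om * s)) by rewrite BE; ring.
    have d20 : 0 <= d / 2 by apply: le_trans XD; rewrite XE; lra.
    rewrite (le_trans hu)// (le_trans r1)// ler_wpM2r//.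
  have e2 := comb _ _ D dC dS.
  have -> : u x' - (u y * cos (w * s) + B * sin (w * s)) =
    (u x' - (u y * cos (om * s) + B * sin (om * s))) +
    (u y * (cos (om * s) - cos (w * s)) + B * (sin (om * s) - sin (w * s))) by ring.
  rewrite (le_trans (ler_normD _ _))//.
  have := ler_normD (u y * (cos (om * s) - cos (w * s))) (B * (sin (om * s) - sin (w * s))).
  lra.
have -> : u' x' - w * (B * cos (w * s) - u y * sin (w * s)) =
   (u' x' - (u' y * cos (om * s) - om * u y * sin (om * s))) +
   (om * (B * (cos (om * s) - cos (w * s)) + - (u y * (sin (om * s) - sin (w * s)))) +
    (om - w) * (B * cos (w * s) + - (u y * sin (w * s)))) by rewrite BE; ring.
have e2 := comb _ _ D dS dC.
have e3 := comb _ _ 1 (sin_max (w * s)) (cos_max (w * s)).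
rewrite (le_trans (ler_normD _ _))//.
have := ler_normD (om * (B * (cos (om * s) - cos (w * s)) + - (u y * (sin (om * s) - sin (w * s)))))
   ((om - w) * (B * cos (w * s) + - (u y * sin (w * s)))).
rewrite !normrM (gtr0_norm om0).
have := ler_normD (B * (cos (om * s) - cos (w * s))) (- (u y * (sin (om * s) - sin (w * s)))).
have := ler_normD (B * cos (w * s)) (- (u y * sin (w * s))).
rewrite !normrN => n1 n2.
have m1 : om * `|B * (cos (om * s) - cos (w * s)) - u y * (sin (om * s) - sin (w * s))| <= (1 + Lam) * (Kt * D).
  by rewrite ler_pM// ?(ltW om0)//; lra.
have m2 : `|om - w| * `|B * cos (w * s) - u y * sin (w * s)| <= L^-1 * D * (Kt * 1).
  by rewrite ler_pM//; lra.
lra.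
Qed.

End OneEigenfunction.
End NearSinusoid.

Section NearSinusoidThreshold.
Context {R : realType}.
Variables (L y : R).
Hypothesis L0 : 0 < L.
Implicit Types (V u : R -> R) (lam Lam a b x : R).

Local Notation S := (sobolev_const L).
Local Notation ip := (ip L y).

Definition sinusoidal (d : R) (u : R -> R) (j : nat) (a b : R) :=
  forall x, `|u x - (a * cos (freq L j * (x - y)) + b * sin (freq L j * (x - y)))| <= d /\
   `|derive1 u x - freq L j * (b * cos (freq L j * (x - y)) - a * sin (freq L j * (x - y)))| <= d.

Lemma near0_mul_lt (c e : R) : 0 < e -> \forall t \near 0^'+, t * c < e.
Proof.
move=> e0; have c1 : 0 < `|c| + 1 by rewrite ltr_wpDl.
near=> t; have t0 : 0 < t by near: t; exact: nbhs_right_gt.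
apply: (@le_lt_trans _ _ (t * (`|c| + 1))).
  by rewrite ler_wpM2l ?(ltW t0)// (le_trans (ler_norm c))// lerDl.
rewrite -ltr_pdivlMr//; near: t; apply: nbhs_right_lt; exact: divr_gt0.
Unshelve. all: by end_near. Qed.

(** The thresholds are chosen in this order: h separates the eigenvalues close to 1,
    whose eigenfunctions are almost constant, from the others; D, depending on h, is
    the precision on the frequency; the bound on the perturbation depends on both. *)
Lemma near_sinusoid Lam d : 1 <= Lam -> 0 < d -> exists2 rho0, 0 < rho0 &
  forall V lam u, integrable_on y (y + L) (fun x => V x - 1) ->
    S * perturbation L y V <= 2^-1 -> perturbation L y V <= rho0 ->
    eigenfunction L V lam u -> ip u u = 1 -> lam <= Lam ->
    exists j a b, `|lam - 1 - freq L j ^+ 2| <= d /\ sinusoidal d u j a b.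
Proof.
move=> Lam1 d0; set K := sup_bound L Lam.
have K0 : 0 <= K by exact: sqrtr_ge0.
have d2 : 0 < d / 2 by rewrite divr_gt0.
near (0 : R)^'+ => h.
have h0 : 0 < h by near: h; exact: nbhs_right_gt.
have h1 : h <= 1 by near: h; exact: nbhs_right_le.
have hd : h <= d by near: h; exact: nbhs_right_le.
have hK : h * (K * L * (L + 1)) < d / 2 by near: h; exact: near0_mul_lt.
have hh : h ^+ 2 <= h by rewrite expr2 ler_piMl// ltW.
have h2 : 0 < h ^+ 2 by rewrite exprn_gt0.
set X := (K + K * (1 + Lam * L) / h) * (2 + Lam + L^-1).
set Y := L^-1 * (2 * (1 + Lam) + L^-1).
near (0 : R)^'+ => D.
have D0 : 0 < D by near: D; exact: nbhs_right_gt.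
have D1 : D <= 1 by near: D; exact: nbhs_right_le.
have Dpi : D < pi by rewrite (le_lt_trans D1)// (lt_le_trans _ (pi_ge2 R))// ltr1n.
have XD : X * D <= d / 2 by rewrite mulrC ltW//; near: D; exact: near0_mul_lt.
have YD : Y * D <= d by rewrite mulrC ltW//; near: D; exact: near0_mul_lt.
have cD : 0 < 1 - cos D.
  by rewrite subr_gt0 -cos0 ltr_cos// in_itv /= ?lexx ?pi_ge0 ?(ltW D0) ?(ltW Dpi).
near (0 : R)^'+ => t.
have t0 : 0 < t by near: t; exact: nbhs_right_gt.
have t1 : t <= 1 by near: t; exact: nbhs_right_le.
have c1 : t * (2 * K) < h * (d / 2) by near: t; apply: near0_mul_lt; exact: mulr_gt0.
have c2 : t * (2 * K) < d / 2 by near: t; exact: near0_mul_lt.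
have c3 : t * ((L + 1) * K) < d / 2 by near: t; exact: near0_mul_lt.
have c4 : t * (24 * L * K ^+ 2) < h ^+ 2 by near: t; exact: near0_mul_lt.
have c5 : t * (6 * L * K ^+ 2) < (1 - cos D) * h ^+ 2.
  by near: t; apply: near0_mul_lt; exact: mulr_gt0.
have c6 : t * K ^+ 2 < h ^+ 2 by near: t; exact: near0_mul_lt.
exists t => // V lam u Vi small rt eu un lamLam.
have el := eigenvalue_lower L0 Vi small eu un lamLam.
have nl := near_sinusoid_low L0 Vi small eu un lamLam.
have nh := near_sinusoid_high L0 Vi small eu un lamLam.
rewrite -/K in el nl nh.
set rho := perturbation L y V in rt el nl nh *.
have rho0 : 0 <= rho by exact: intab_ge0.
have up c e : 0 <= c -> t * c < e -> rho * c < e.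
  by move=> c0; apply: le_lt_trans; rewrite ler_wpM2r.
have up2 c e : 0 <= c -> t * (c * K ^+ 2) < e -> c * (K * rho) ^+ 2 < e.
  move=> c0; apply: le_lt_trans.
  rewrite exprMn mulrA [t * _]mulrC ler_wpM2l// ?mulr_ge0 ?sqr_ge0//.
  rewrite expr2 (le_trans _ rt)// -[leRHS]mulr1 ler_wpM2l// (le_trans rt)//.
have [kh|hk] := leP (lam - 1) (h ^+ 2).
  exists 0%N, (u y), 0.
  have lk : `|lam - 1| <= h ^+ 2.
    rewrite ler_norml kh andbT.
    by have := up _ _ (sqr_ge0 K) c6; move: el; lra.
  split; first by rewrite freq0 expr0n subr0 (le_trans lk)// (le_trans hh).
  move=> x; rewrite freq0 !mul0r cos0 mulr1 addr0 subr0.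
  apply: nl.
    rewrite -mulrA (le_trans _ (ltW hK))// ler_wpM2r ?(le_trans lk)//.
    by rewrite mulr_ge0 ?(mulr_ge0 K0 (ltW L0))// addr_ge0// ltW.
  rewrite mulrA mulrC; apply/ltW/up => //.
  by rewrite mulr_ge0// addr_ge0// ltW.
have k0 : 0 <= lam - 1 by rewrite (le_trans (ltW h2))// ltW.
apply: (nh h D d (Num.sqrt (lam - 1))) => //.
- by rewrite -[h]ger0_norm ?(ltW h0)// -sqrtr_sqr ler_wsqrtr// ltW.
- by rewrite sqr_sqrtr.
- exact: le_trans t1.
- by rewrite mulrA mulrC; apply/ltW/up => //; rewrite mulr_ge0.
- by rewrite mulrA mulrC; apply/ltW/up => //; rewrite mulr_ge0.
- by apply: up2 => //; rewrite mulr_ge0// ltW.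
- by apply: up2 => //; rewrite mulr_ge0// ltW.
Unshelve. all: by end_near. Qed.

End NearSinusoidThreshold.

(** * The phase of an eigenfunction *)

Section Dichotomy.
Context {R : realType}.
Variables (L y : R).
Hypothesis L0 : 0 < L.
Implicit Types (u : R -> R) (a b d x : R) (j : nat).

Local Notation ip := (ip L y).
Local Notation cosj j := (fun x => cos (freq L j * (x - y))).
Local Notation sinj j := (fun x => sin (freq L j * (x - y))).

Lemma cosjE j : cosj j = (wave y (freq L j) 0).1.
Proof. by apply/funext => x /=; rewrite addr0. Qed.

Lemma sinjE j : sinj j = (wave y (freq L j) (- (pi / 2))).1.
Proof. by apply/funext => x /=; rewrite cosBpihalf. Qed.

Lemma continuous_cosj j : continuous (cosj j).
Proof. by rewrite cosjE; exact: wave_continuous. Qed.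

Lemma continuous_sinj j : continuous (sinj j).
Proof. by rewrite sinjE; exact: wave_continuous. Qed.

Lemma ip_cosj_cosj j : (0 < j)%N -> ip (cosj j) (cosj j) = L / 2.
Proof. by move=> j0; rewrite cosjE ip_wave_same// subrr cos0; field. Qed.

Lemma ip_sinj_sinj j : (0 < j)%N -> ip (sinj j) (sinj j) = L / 2.
Proof. by move=> j0; rewrite sinjE ip_wave_same// subrr cos0; field. Qed.

Lemma ip_cosj_sinj j : (0 < j)%N -> ip (cosj j) (sinj j) = 0.
Proof.
by move=> j0; rewrite cosjE sinjE ip_wave_same// sub0r opprK cos_pihalf !mulr0.
Qed.

Lemma ip_perturb u v h d k : continuous u -> continuous v -> continuous h ->
  (forall x, `|u x - v x| <= d) -> (forall x, y <= x <= y + L -> `|h x| <= k) ->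
  `|ip u h - ip v h| <= d * k * L.
Proof.
move=> cu cv ch uv hk.
have -> : ip u h - ip v h = ip (fun x => u x - 1 * v x) h by rewrite ip_subl// mul1r.
have -> : d * k * L = d * k * (y + L - y) by ring.
apply: intab_bound; first by rewrite lerDl ltW.
  by apply: continuous_integrable; apply: continuousM_fun => //; exact: continuous_lincomb.
by move=> x xJ; rewrite normrM mul1r ler_pM// hk.
Qed.

Definition sinusoid j a b := fun x : R => a * cos (freq L j * (x - y)) + b * sin (freq L j * (x - y)).

Lemma continuous_sinusoid j a b : continuous (sinusoid j a b).
Proof.
move=> x; apply: cvgD; apply: cvgM; try exact: cvg_cst.
  exact: continuous_cosj.
exact: continuous_sinj.
Qed.

Lemma ip_sinusoid j a b h : continuous h ->
  ip h (sinusoid j a b) = a * ip h (cosj j) + b * ip h (sinj j).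
Proof.
move=> ch; have cc := @continuous_cosj j; have cs := @continuous_sinj j.
rewrite /ip -!intabZ; [|apply: continuous_integrable; exact: continuousM_fun..].
rewrite -intabD; [|apply: integrableZ_on; apply: continuous_integrable; exact: continuousM_fun..].
by apply: eq_intab => x _; rewrite /sinusoid; ring.
Qed.

Section Coefficients.
Variables (K d : R).
Hypotheses (K0 : 0 <= K) (d0 : 0 <= d) (d1 : d <= 1).

Section One.
Variables (u : R -> R) (j : nat) (a b : R).
Hypotheses (cu : continuous u) (uK : forall x, `|u x| <= K).
Hypothesis us : sinusoidal L y d u j a b.

Let uv x : `|u x - sinusoid j a b x| <= d.
Proof. by have [] := us x. Qed.

Lemma ip_cosj : (0 < j)%N -> `|ip u (cosj j) - a * (L / 2)| <= d * L.
Proof.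
move=> j0; have cc := @continuous_cosj j.
have := ip_perturb cu (@continuous_sinusoid j a b) cc uv (fun x _ => cos_max _).
rewrite mulr1; congr (`|_ - _| <= _).
by rewrite ipC ip_sinusoid// ip_cosj_cosj// ip_cosj_sinj// mulr0 addr0.
Qed.

Lemma ip_sinj : (0 < j)%N -> `|ip u (sinj j) - b * (L / 2)| <= d * L.
Proof.
move=> j0; have cs := @continuous_sinj j.
have := ip_perturb cu (@continuous_sinusoid j a b) cs uv (fun x _ => sin_max _).
rewrite mulr1; congr (`|_ - _| <= _).
by rewrite ipC ip_sinusoid// ip_sinj_sinj// ipC ip_cosj_sinj// mulr0 add0r.
Qed.

Lemma ip_bounded h : continuous h -> (forall x, `|h x| <= 1) -> `|ip u h| <= K * L.
Proof.
move=> ch h1; have -> : K * L = K * (y + L - y) by ring.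
apply: intab_bound; first by rewrite lerDl ltW.
  by apply: continuous_integrable; exact: continuousM_fun.
by move=> x _; rewrite normrM -[leRHS]mulr1 ler_pM.
Qed.

Lemma coef_bound : (0 < j)%N -> `|a| <= 2 * K + 2 /\ `|b| <= 2 * K + 2.
Proof.
move=> j0.
have aux (e I : R) : `|I - e * (L / 2)| <= d * L -> `|I| <= K * L -> `|e| <= 2 * K + 2.
  move=> h1 h2; have L2 : 0 < L / 2 by rewrite divr_gt0.
  rewrite -(ler_pM2r L2) -[X in _ * X <= _](gtr0_norm L2) -normrM.
  have -> : e * (L / 2) = I - (I - e * (L / 2)) by ring.
  rewrite (le_trans (ler_normB _ _))//.
  have : d * L <= 1 * L by rewrite ler_wpM2r// ltW.
  lra.
split; [apply: aux (ip_cosj j0) _|apply: aux (ip_sinj j0) _]; apply: ip_bounded.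
- exact: continuous_cosj.
- by move=> x; exact: cos_max.
- exact: continuous_sinj.
- by move=> x; exact: sin_max.
Qed.

Lemma near_const x : j = 0%N -> `|u x - a| <= d /\ `|derive1 u x| <= d.
Proof.
by move=> j0; have := us x; rewrite j0 freq0 !mul0r cos0 sin0 mulr1 mulr0 addr0 subr0.
Qed.

Lemma coef_bound0 : j = 0%N -> `|a| <= 2 * K + 2.
Proof.
move=> j0; have [h _] := near_const y j0.
have -> : a = u y - (u y - a) by ring.
rewrite (le_trans (ler_normB _ _))//; have := uK y; have := K0; have := d1; lra.
Qed.

End One.

(** Orthonormality of the eigenfunctions becomes a condition on their coefficients:
    two eigenfunctions with the same j > 0 satisfy a1 a2 + b1 b2 = (2 / L) <u1, u2> up
    to an error of order d. *)
Lemma ip_pair u1 u2 j a1 b1 a2 b2 : (0 < j)%N ->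
  continuous u1 -> (forall x, `|u1 x| <= K) -> sinusoidal L y d u1 j a1 b1 ->
  continuous u2 -> (forall x, `|u2 x| <= K) -> sinusoidal L y d u2 j a2 b2 ->
  `|ip u1 u2 - L / 2 * (a1 * a2 + b1 * b2)| <= d * (L * (5 * K + 4)).
Proof.
move=> j0 c1 k1 s1 c2 k2 s2.
have [a2b b2b] := coef_bound c2 k2 s2 j0.
have h1 := ip_cosj c1 s1 j0; have h2 := ip_sinj c1 s1 j0.
have h3 : `|ip u2 u1 - ip (sinusoid j a2 b2) u1| <= d * K * L.
  apply: ip_perturb => //; first exact: continuous_sinusoid.
  by move=> x; have [] := s2 x.
rewrite [ip (sinusoid _ _ _) _]ipC ip_sinusoid// [ip u2 u1]ipC in h3.
set Ic := ip u1 (cosj j) in h1 h3; set Is := ip u1 (sinj j) in h2 h3.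
have -> : ip u1 u2 - L / 2 * (a1 * a2 + b1 * b2) =
  (ip u1 u2 - (a2 * Ic + b2 * Is)) + (a2 * (Ic - a1 * (L / 2)) + b2 * (Is - b1 * (L / 2))) by ring.
have m1 : `|a2 * (Ic - a1 * (L / 2))| <= (2 * K + 2) * (d * L) by rewrite normrM ler_pM.
have m2 : `|b2 * (Is - b1 * (L / 2))| <= (2 * K + 2) * (d * L) by rewrite normrM ler_pM.
rewrite (le_trans (ler_normD _ _))//.
have := ler_normD (a2 * (Ic - a1 * (L / 2))) (b2 * (Is - b1 * (L / 2))).
have -> : d * (L * (5 * K + 4)) = d * K * L + (2 * K + 2) * (d * L) + (2 * K + 2) * (d * L) by ring.
lra.
Qed.

Lemma ip_pair0 u1 u2 a1 b1 a2 b2 :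
  continuous u1 -> (forall x, `|u1 x| <= K) -> sinusoidal L y d u1 0 a1 b1 ->
  continuous u2 -> (forall x, `|u2 x| <= K) -> sinusoidal L y d u2 0 a2 b2 ->
  `|ip u1 u2 - L * (a1 * a2)| <= d * (L * (5 * K + 4)).
Proof.
move=> c1 k1 s1 c2 k2 s2.
have a2b := coef_bound0 k2 s2 erefl.
have cc (k : R) : continuous (fun _ : R => k) by move=> x; exact: cst_continuous.
have h1 : `|ip u1 (fun=> a2) - ip (fun=> a1) (fun=> a2)| <= d * `|a2| * L.
  by apply: ip_perturb => // x; have [] := near_const s1 x erefl.
have h2 : `|ip u2 u1 - ip (fun=> a2) u1| <= d * K * L.
  by apply: ip_perturb => // x; have [] := near_const s2 x erefl.
have E : ip (fun=> a1) (fun=> a2) = L * (a1 * a2).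
  by rewrite /ip intab_cst ?lerDl ?(ltW L0)//; ring.
rewrite E in h1; rewrite ipC [ip (fun=> a2) _]ipC in h2.
have -> : ip u1 u2 - L * (a1 * a2) = (ip u1 u2 - ip u1 (fun=> a2)) +
   (ip u1 (fun=> a2) - L * (a1 * a2)) by ring.
rewrite (le_trans (ler_normD _ _))//.
have : d * `|a2| * L <= d * (2 * K + 2) * L by rewrite ler_wpM2r ?(ltW L0)// ler_wpM2l.
have : 0 <= d * (L * (2 * K + 2)) by rewrite !mulr_ge0// ?(ltW L0)// addr_ge0// mulr_ge0.
have -> : d * (L * (5 * K + 4)) = d * K * L + d * (2 * K + 2) * L + d * (L * (2 * K + 2)) by ring.
lra.
Qed.

End Coefficients.

Lemma constant_sign u a b : a <= b -> continuous u ->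
  (forall x, a <= x <= b -> u x != 0) ->
  exists s : R, (s = 1 \/ s = -1) /\ forall x, a <= x <= b -> 0 < s * u x.
Proof.
move=> ab cu u0.
have aJ : a <= a <= b by rewrite lexx.
have key x : a <= x <= b -> 0 < u a * u x.
  move=> /andP[ax xb]; rewrite ltNge; apply/negP => neg.
  have cw : {within `[a, x], continuous u} by exact: continuous_subspaceT.
  have [] := @IVT _ u a x 0 ax cw.
    have [ua|ua|ua] := ltgtP (u a) 0.
    - have ux : 0 <= u x by rewrite -(nmulr_rle0 _ ua).
      by rewrite min_l ?max_r ?(ltW ua)// (le_trans (ltW ua)).
    - have ux : u x <= 0 by rewrite -(pmulr_rle0 _ ua).
      by rewrite min_r ?max_l ?(ltW ua)// ?ux// (le_trans ux)// ltW.
    - by have := u0 a aJ; rewrite ua eqxx.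
  move=> c; rewrite in_itv /= => /andP[ac cx] /eqP; apply/negP; apply: u0.
  by rewrite ac (le_trans cx).
have [ua|ua|ua] := ltgtP (u a) 0.
- exists (-1); split; first by right.
  by move=> x /key; rewrite nmulr_rgt0// mulN1r oppr_gt0.
- exists 1; split; first by left.
  by move=> x /key; rewrite pmulr_rgt0// mul1r.
- by have := u0 a aJ; rewrite ua eqxx.
Qed.

Section NonVanishing.
Variables (V : R -> R) (eps lam : R) (u : R -> R) (j : nat).
Hypotheses (eps0 : 0 < eps) (epsL : eps < L).
Hypotheses (Vi : integrable_on y (y + L) (fun x => V x - 1))
  (V1 : forall x, V x <= 1)
  (Vin : forall x, y <= x <= y + eps -> V x < 1)
  (Vout : forall x, y + eps < x < y + L -> V x = 1).
Hypothesis eu : eigenfunction L V lam u.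
Hypothesis u0 : forall x, y <= x <= y + eps -> u x != 0.
Hypothesis we : freq L j * eps <= 2^-1.

Let yL : y < y + L. Proof. by rewrite ltrDl. Qed.
Let cu : continuous u.
Proof. by have [/C1_continuous] := eigenfunction_C1 eu. Qed.
Let uL : periodic_on L u. Proof. by have [] := eu. Qed.

Let mass := \intab_[y, y + L] (fun x => `|V x - 1| * `|u x|).

Let cnu : continuous (fun x => `|u x|).
Proof. by move=> x; apply: cvg_norm; exact: cu. Qed.

Lemma mass_gt0 : 0 < mass.
Proof.
have fi : integrable_on y (y + L) (fun x => (V x - 1) * u x) by exact: integrableM_on.
have -> : mass = \intab_[y, y + L] (fun x => `|(V x - 1) * u x|).
  by apply: eq_intab => x _; rewrite normrM.
rewrite lt_neqAle intab_ge0// andbT eq_sym; apply/eqP => m0.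
have mf : measurable_fun `[y, y + L] (EFin \o (fun x => (V x - 1) * u x)).
  by have /integrableP[] := fi.
have : (\int[lebesgue_measure]_(x in `[y, (y + L)%R]) `|((V x - 1) * u x)%:E| = 0)%E.
  have /integrable_norm/integrable_fin_num fin := fi.
  have := fin (measurable_itv _) => {}fin.
  by rewrite -[LHS](fineK fin) -[fine _]/(\intab_[y, y + L] (fun x => `|(V x - 1) * u x|)) m0.
move=> /(iffLR (ae_eq_integral_abs (@lebesgue_measure R) (measurable_itv _) mf))[A [mA A0 sA]].
have : (lebesgue_measure `[y, (y + eps)%R]%classic <= lebesgue_measure A)%E.
  apply: le_measure => [| |x /= /[!in_itv] /= xI]; rewrite ?inE//.
  apply: sA => /= H.
  have xJ : x \in `[y, y + L].
    by move: xI; rewrite in_itv /= => /andP[-> xe]; rewrite (le_trans xe)// lerD2l ltW.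
  have /eqP := H xJ; rewrite eqe mulf_eq0 (negbTE (u0 xI)) orbF subr_eq0.
  by rewrite lt_eqF// Vin.
rewrite A0 lebesgue_measure_itv /= lte_fin ltrDl eps0 -EFinB lee_fin.
by rewrite addrAC subrr add0r leNgt eps0.
Qed.

Let Ipsi h := \intab_[y, y + L] (fun x => (V x - 1) * (u x * h x)).

(** The Wronskian of u with a wave of period L takes the same value at both ends of
    a period. *)
Lemma resonance_identity c :
  (lam - 1 - freq L j ^+ 2) * ip u (wave y (freq L j) c).1 = Ipsi (wave y (freq L j) c).1.
Proof.
have Cw := C1_wave y (freq L j) c.
have wL := wave_periodic y L0 j c.
have w'L := C1_periodic_derive Cw wL.
have [C1u _] := eigenfunction_C1 eu; have u'L := C1_periodic_derive C1u uL.
have := wronskian Vi eu (lexx y) yL (lexx _) Cw (C1_wave_derive y (freq L j) c) (fun=> erefl).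
have u'Ly : derive1 u (y + L) = derive1 u y by exact: u'L.
rewrite u'Ly wL w'L uL subrr => /esym/eqP; rewrite addr_eq0 => /eqP.
by rewrite /Ipsi => ->; rewrite /ip; ring.
Qed.

(** On the support of V - 1 the sine is at most freq L j * eps and the cosine at least
    1 / 2, and (V - 1) u has a constant sign there: in the two resonance identities the
    right-hand sides are at most freq L j * eps and at least 1 / 2 times the same
    positive mass.  The quotient of the identities eliminates the unknown shift
    lam - 1 - freq L j ^ 2, however small it is. *)
Lemma phase_bound : `|ip u (sinj j)| <= 2 * (freq L j * eps) * `|ip u (cosj j)|.
Proof.
have w0 : 0 <= freq L j by exact: freq_ge0.
have [s [s1 sP]] := constant_sign (a := y) (b := y + eps) ltac:(by rewrite lerDl ltW) cu u0.
have ss : s * s = 1 by case: s1 => ->; rewrite ?mulrNN mulr1.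
have sn : `|s| = 1 by case: s1 => ->; rewrite ?normrN normr1.
have cc := @continuous_cosj j; have cs := @continuous_sinj j.
have nui : integrable_on y (y + L) (fun x => `|V x - 1| * `|u x|).
  by apply: integrableM_on => //; exact: integrable_norm_on.
have fci h : continuous h -> integrable_on y (y + L) (fun x => (V x - 1) * (u x * h x)).
  by move=> ch; apply: integrableM_on => //; exact: continuousM_fun.
have cL : cos (freq L j * (y + L - y)) = 1.
  have := wave_periodic y L0 j 0 y; rewrite /= !addr0 => ->.
  by rewrite subrr mulr0 cos0.
have sL : sin (freq L j * (y + L - y)) = 0.
  have := wave_periodic y L0 j (- (pi / 2)) y; rewrite /= !cosBpihalf => ->.
  by rewrite subrr mulr0 sin0.
have small x : y <= x <= y + eps -> `|freq L j * (x - y)| <= freq L j * eps.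
  by move=> /andP[yx xe]; rewrite normrM ger0_norm// ler_wpM2l// ger0_norm; lra.
have cases x : y <= x <= y + L -> [\/ y <= x <= y + eps, V x = 1 | x = y + L].
  move=> /andP[yx]; rewrite le_eqVlt => /predU1P[->|xL]; first by constructor 3.
  have [xe|xe] := leP x (y + eps); first by constructor 1; rewrite yx.
  by constructor 2; apply: Vout; rewrite xe.
have psis : `|Ipsi (sinj j)| <= freq L j * eps * mass.
  rewrite /mass -intabZ// (le_trans (le_norm_intab (fci _ cs)))//.
  apply: le_intab; [exact/integrable_norm_on/fci|exact: integrableZ_on|].
  move=> x /cases[xI|Vx|->].
  - rewrite !normrM mulrA mulrC ler_wpM2r ?mulr_ge0//.
    have := sin_lip (freq L j * (x - y)) 0; rewrite sin0 !subr0 => /le_trans; apply.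
    exact: small.
  - by rewrite Vx subrr !mul0r normr0 mul0r mulr0.
  - rewrite sL !mulr0 normr0; apply: mulr_ge0; apply: mulr_ge0 => //; exact: ltW.
have psic : 2^-1 * mass <= `|Ipsi (cosj j)|.
  have -> : `|Ipsi (cosj j)| = `| - s * Ipsi (cosj j)| by rewrite normrM normrN sn mul1r.
  apply: le_trans (ler_norm _); rewrite /mass /Ipsi -!intabZ//; last exact: fci.
  apply: le_intab; [exact: integrableZ_on|exact/integrableZ_on/fci|].
  have aux x : 0 < s * u x -> 2^-1 <= cos (freq L j * (x - y)) ->
      2^-1 * (`|V x - 1| * `|u x|) <= - s * ((V x - 1) * (u x * cos (freq L j * (x - y)))).
    move=> sx cx.
    have -> : `|u x| = s * u x by rewrite -[LHS]mul1r -sn -normrM gtr0_norm.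
    rewrite ler0_norm ?subr_le0//.
    have p : 0 <= (1 - V x) * (s * u x) by rewrite mulr_ge0 ?subr_ge0// ltW.
    have := ler_wpM2l p cx; lra.
  move=> x /cases[xI|Vx|->].
  - apply: aux; first exact: sP.
    have := cos_lip 0 (freq L j * (x - y)); rewrite cos0 sub0r normrN.
    move=> /le_trans /(_ (le_trans (small _ xI) we)); rewrite ler_norml => /andP[_]; lra.
  - by rewrite Vx subrr normr0 !mul0r !mulr0.
  - apply: aux; last by rewrite cL invf_le1// ler1n.
    by rewrite uL; apply: sP; rewrite lexx lerDl ltW.
have Ec := resonance_identity 0; have Es := resonance_identity (- (pi / 2)).
rewrite -cosjE in Ec; rewrite -sinjE in Es.
have m0 := mass_gt0.
have k0 : 0 < `|lam - 1 - freq L j ^+ 2|.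
  rewrite normr_gt0; apply/eqP => k0; move: Ec; rewrite k0 mul0r => Ec.
  by move: psic; rewrite -Ec normr0; lra.
rewrite -(ler_pM2l k0) -normrM Es mulrCA -normrM Ec.
rewrite (le_trans psis)// [leLHS](_ : _ = 2 * (freq L j * eps) * (2^-1 * mass)); last by field.
by rewrite ler_wpM2l// mulr_ge0// mulr_ge0// ltW.
Qed.

End NonVanishing.

End Dichotomy.

(** * Strict minima of weighted sums of absolute values *)

Section Kinks.
Context {R : realType}.

Lemma sum_one_dominates N (t : 'I_N -> R) k (A B : R) : 0 <= A ->
  (forall i, - A <= t i) -> B <= t k -> B - N%:R * A <= \sum_(i < N) t i.
Proof.
move=> A0 tA tk; rewrite lerBlDr.
have -> : N%:R * A = \sum_(i < N) A.
  by rewrite sumr_const card_ord mulr_natl.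
rewrite -big_split /= (bigD1 k)//=.
have : 0 <= \sum_(i < N | i != k) (t i + A).
  by apply: sumr_ge0 => i _; rewrite -lerBlDr sub0r.
have := A0; have := tk; lra.
Qed.

Implicit Types (x p q : R).
Variables (y eps : R) (N : nat) (V : R -> R) (lam c : 'I_N -> R) (u : 'I_N -> R -> R).
Variables (g s0 m0 cmin cmax : R).
Implicit Types (k : 'I_N).
Hypotheses (eps0 : 0 < eps) (V1 : forall x, V x <= 1).
Hypothesis Cu : forall k, C1 (u k) (derive1 (u k)).
Hypothesis u2 : forall k a b, a <= b ->
  integrable_on a b (fun x => (V x - lam k) * u k x) /\
  derive1 (u k) b - derive1 (u k) a = \intab_[a, b] (fun x => (V x - lam k) * u k x).
Hypotheses (cmin0 : 0 < cmin) (c1 : forall k, cmin <= c k) (c2 : forall k, c k <= cmax).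
Hypotheses (g0 : 0 <= g) (s00 : 0 < s0) (m00 : 0 < m0).

Let I x := y - eps <= x <= y + eps + eps.

Definition flat k := (forall x, y <= x <= y + eps -> u k x != 0) /\
  (forall x, I x -> `|derive1 (u k) x| <= g).

Definition crossing k := exists2 z, y <= z <= y + eps & u k z = 0 /\
  exists2 s : R, s = 1 \/ s = -1 & forall x, I x -> s0 <= s * derive1 (u k) x.

Hypothesis alt : forall k, flat k \/ crossing k.
Hypothesis cross1 : exists k, crossing k.
Hypothesis curv : forall k x, I x -> (1 - lam k) * `|u k x| <= g.
Hypothesis curv1 : exists k, forall x, I x -> (1 - lam k) * `|u k x| <= - m0.
Hypothesis gs : N%:R * (cmax * g) < cmin * s0.
Hypothesis gm : N%:R * (cmax * g) < cmin * m0.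

Definition weighted_sum x := \sum_(k < N) c k * `|u k x|.
Local Notation F := weighted_sum.

Let du k x : is_derive x 1 (u k) (derive1 (u k) x).
Proof. by have [] := Cu k. Qed.
Let cu k : continuous (u k). Proof. exact: C1_continuous (Cu k). Qed.
Let ck0 k : 0 <= c k. Proof. by rewrite (le_trans _ (c1 k))// ltW. Qed.
Let cg0 k : 0 <= cmax * g. Proof. by rewrite mulr_ge0// (le_trans (ck0 k)). Qed.

Let mvt k p q : p < q -> exists2 z, p < z < q & u k q - u k p = derive1 (u k) z * (q - p).
Proof.
move=> pq; have [||z] := @MVT _ (u k) (derive1 (u k)) p q pq.
- by move=> z _; exact: du.
- by apply: continuous_subspaceT; exact: cu.
by rewrite in_itv /= => pzq E; exists z.
Qed.

Lemma weighted_sum_continuous : continuous F.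
Proof.
apply: continuous_big => [|k _ x]; first exact: add_continuous.
by apply: cvgM; [exact: cvg_cst|apply: cvg_norm; exact: cu].
Qed.

Lemma crossing_increasing k s p q :
  (forall x, I x -> s0 <= s * derive1 (u k) x) -> I p -> I q -> p <= q ->
  s0 * (q - p) <= s * u k q - s * u k p.
Proof.
move=> sP Ip Iq; rewrite le_eqVlt => /predU1P[->|pq]; first by rewrite !subrr mulr0.
have [z /andP[pz zq] E] := mvt k pq.
rewrite -mulrBr E mulrA ler_wpM2r// ?subr_ge0 ?(ltW pq)//; apply: sP.
by move: Ip Iq; rewrite /I => /andP[? ?] /andP[? ?]; apply/andP; split; lra.
Qed.

Lemma flat_lip k p q : flat k -> I p -> I q -> `| `|u k p| - `|u k q| | <= g * `|p - q|.
Proof.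
move=> [_ fP] Ip Iq; rewrite (le_trans (ler_dist_dist _ _))//.
wlog pq : p q Ip Iq / q <= p.
  move=> H; have [|/ltW pq] := leP q p; first exact: H.
  by rewrite distrC [`|p - q|]distrC; exact: H.
move: pq; rewrite le_eqVlt => /predU1P[->|pq]; first by rewrite !subrr !normr0 mulr0.
have [z /andP[pz zq] ->] := mvt k pq.
rewrite normrM ler_wpM2r//; apply: fP.
by move: Ip Iq; rewrite /I => /andP[? ?] /andP[? ?]; apply/andP; split; lra.
Qed.

(** Away from its zero the absolute value of a crossing function increases with slope
    at least s0; the point q lies between that zero and p.  The flat terms lose at most
    g per unit of length. *)
Lemma outside_larger p q : I p -> (p < q /\ q = y) \/ (q < p /\ q = y + eps) -> F q < F p.
Proof.
move=> Ip H; have e0 := eps0.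
have Iq : I q by case: H => -[_ ->]; rewrite /I; apply/andP; split; lra.
have pq0 : 0 < `|p - q| by rewrite normr_gt0 subr_eq0; case: H => -[pq _]; [rewrite lt_eqF|rewrite gt_eqF].
have cr k : crossing k -> s0 * `|p - q| <= `|u k p| - `|u k q|.
  move=> [z zI [uz [s s1 sP]]].
  have Iz : I z by move: zI => /andP[? ?]; rewrite /I; apply/andP; split; lra.
  have sn x : `|u k x| = `|s * u k x|.
    by case: s1 => ->; rewrite ?mul1r// mulN1r normrN.
  rewrite !sn; have sz : s * u k z = 0 by rewrite uz mulr0.
  case: H => -[pq qE].
    have qz : q <= z by rewrite qE; case/andP: zI.
    have h1 := crossing_increasing sP Ip Iq (ltW pq).
    have h2 := crossing_increasing sP Iq Iz qz; rewrite sz in h2.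
    have h3 : 0 <= s0 * (z - q) by rewrite mulr_ge0 ?subr_ge0// ltW.
    have h4 : 0 <= s0 * (q - p) by rewrite mulr_ge0 ?subr_ge0// ltW.
    by rewrite distrC gtr0_norm ?subr_gt0// !ler0_norm; lra.
  have zq : z <= q by rewrite qE; case/andP: zI.
  have h1 := crossing_increasing sP Iq Ip (ltW pq).
  have h2 := crossing_increasing sP Iz Iq zq; rewrite sz in h2.
  have h3 : 0 <= s0 * (q - z) by rewrite mulr_ge0 ?subr_ge0// ltW.
  have h4 : 0 <= s0 * (p - q) by rewrite mulr_ge0 ?subr_ge0// ltW.
  by rewrite gtr0_norm ?subr_gt0// !ger0_norm; lra.
have [k1 /cr h1] := cross1.
rewrite -subr_gt0 /F -sumrB.
have -> : \sum_(k < N) (c k * `|u k p| - c k * `|u k q|) =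
          \sum_(k < N) c k * (`|u k p| - `|u k q|).
  by apply: eq_bigr => k _; rewrite mulrBr.
apply: lt_le_trans (sum_one_dominates (k := k1) (A := cmax * g * `|p - q|)
  (B := cmin * s0 * `|p - q|) _ _ _).
- by rewrite mulrA -mulrBl mulr_gt0// subr_gt0.
- by rewrite mulr_ge0// cg0.
- move=> k; have [fk|/cr h] := alt k; last first.
    rewrite (@le_trans _ _ 0)//; first by rewrite oppr_le0 mulr_ge0// cg0.
    by rewrite mulr_ge0// (le_trans _ h)// mulr_ge0// ltW.
  have := flat_lip fk Ip Iq; rewrite ler_norml => /andP[h _].
  have h2 := ler_wpM2l (ck0 k) h; apply: le_trans h2.
  rewrite mulrN lerN2 mulrA ler_wpM2r// ler_wpM2r//.
- by rewrite -mulrA; apply: ler_pM => //; [exact: ltW|apply: mulr_ge0 => //; exact: ltW].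
Qed.

(** Where no u_k changes sign, F is a combination of the functions sg k * u k, and its
    derivative is strictly decreasing: the well V <= 1 only helps concavity.  A strictly
    concave function exceeds the smaller of its end values at each interior point. *)
Lemma concave_between p q (sg : 'I_N -> R) : I p -> I q -> p < q ->
  (forall k, sg k = 1 \/ sg k = -1) ->
  (forall k x, p <= x <= q -> 0 <= sg k * u k x) ->
  forall x, p < x < q -> F p < F x \/ F q < F x.
Proof.
move=> Ip Iq pq sg1 sgP x /andP[px xq]; have e0 := eps0.
have abs k z : p <= z <= q -> `|u k z| = sg k * u k z.
  move=> zI; rewrite -[RHS]ger0_norm ?sgP// normrM.
  by case: (sg1 k) => ->; rewrite ?normrN normr1 mul1r.
pose G z := \sum_(k < N) (c k * sg k) * u k z.
pose G' z := \sum_(k < N) (c k * sg k) * derive1 (u k) z.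
have FG z : p <= z <= q -> F z = G z.
  by move=> zI; apply: eq_bigr => k _; rewrite abs// mulrA.
have dG (z : R) : is_derive z 1 G (G' z).
  have dk k : is_derive z 1 (fun x => (c k * sg k) * u k x) (c k * sg k * derive1 (u k) z).
    by have dz := du k z; exact: (is_deriveZ (c k * sg k) dz).
  have := is_derive_sum dk.
  by rewrite (_ : \sum_(i < N) _ = G)//; apply/funext => w; rewrite fct_sumE.
have cG : continuous G.
  by move=> z; apply/differentiable_continuous/derivable1_diffP; have [] := dG z.
have Iin z : p <= z <= q -> I z.
  by move: Ip Iq; rewrite /I => /andP[? ?] /andP[? ?] /andP[? ?]; apply/andP; split; lra.
have G'dec (a b : R) : p <= a -> a < b -> b <= q -> G' b < G' a.
  move=> pa ab bq; have Iab z : a <= z <= b -> p <= z <= q.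
    by move=> /andP[az zb]; rewrite (le_trans pa)//= (le_trans zb).
  rewrite -subr_gt0 /G' -sumrB.
  have -> : \sum_(k < N) (c k * sg k * derive1 (u k) a - c k * sg k * derive1 (u k) b) =
      \sum_(k < N) c k * (- (sg k * (derive1 (u k) b - derive1 (u k) a))).
    by apply: eq_bigr => k _; ring.
  have term k (h : R) : (forall z, a <= z <= b -> (1 - lam k) * `|u k z| <= - h) ->
      h * (b - a) <= - (sg k * (derive1 (u k) b - derive1 (u k) a)).
    move=> hP; have [i ->] := u2 k (ltW ab).
    rewrite -mulNr -(intabZ _ i) -intab_cst ?(ltW ab)//; apply: le_intab.
    - by apply: continuous_integrable => z; exact: cst_continuous.
    - exact: integrableZ_on.
    move=> z zI; have := hP z zI; have zJ := Iab z zI; rewrite abs// => hz.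
    have := mulr_ge0 (_ : 0 <= 1 - V z) (sgP k z zJ); rewrite subr_ge0 => /(_ (V1 z)) vz.
    lra.
  have [k0 k0P] := curv1.
  apply: lt_le_trans (sum_one_dominates (k := k0) (A := cmax * g * (b - a))
    (B := cmin * m0 * (b - a)) _ _ _).
  - by rewrite mulrA -mulrBl mulr_gt0 ?subr_gt0.
  - by rewrite mulr_ge0 ?cg0// subr_ge0 ltW.
  - move=> k; have h : - g * (b - a) <= - (sg k * (derive1 (u k) b - derive1 (u k) a)).
      by apply: term => z /Iab/Iin Iz; rewrite opprK; exact: curv.
    apply: le_trans (ler_wpM2l (ck0 k) h).
    rewrite mulrA mulrN mulNr lerN2 ler_wpM2r ?subr_ge0 ?(ltW ab)//.
    by rewrite ler_wpM2r.
  - have h : m0 * (b - a) <= - (sg k0 * (derive1 (u k0) b - derive1 (u k0) a)).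
      by apply: term => z /Iab/Iin Iz; exact: k0P.
    rewrite -mulrA ler_pM//; first exact: ltW.
    by rewrite mulr_ge0 ?(ltW m00)// subr_ge0 ltW.
have [|xp] := ltP (F p) (F x); first by left.
have [|xqF] := ltP (F q) (F x); first by right.
have pI : p <= p <= q by rewrite lexx ltW.
have qI : p <= q <= q by rewrite lexx ltW.
have xI : p <= x <= q by rewrite !ltW.
rewrite !FG// in xp xqF.
have mvtG (a b : R) : a < b -> exists2 z, a < z < b & G b - G a = G' z * (b - a).
  move=> ab; have [|z] := @MVT _ G G' a b ab (fun z _ => dG z).
    by apply: continuous_subspaceT; exact: cG.
  by rewrite in_itv /= => azb E; exists z.
have [z1 /andP[pz1 z1x] E1] := mvtG p x px.
have [z2 /andP[xz2 z2q] E2] := mvtG x q xq.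
have := G'dec z1 z2 (ltW pz1) (lt_trans z1x xz2) (ltW z2q).
have h1 : G' z1 <= 0 by rewrite -(pmulr_lle0 _ (_ : 0 < x - p)) ?subr_gt0// -E1 subr_le0.
have h2 : 0 <= G' z2 by rewrite -(pmulr_lge0 _ (_ : 0 < q - x)) ?subr_gt0// -E2 subr_ge0.
lra.
Qed.

(** The one-sided intervals are what makes this true for a crossing function that
    vanishes at x0 itself. *)
Lemma sign_near k x0 (l : bool) : y <= x0 <= y + eps -> exists s : R, (s = 1 \/ s = -1) /\
  \forall h \near 0^'+, forall x, (if l then x0 - h <= x <= x0 else x0 <= x <= x0 + h) ->
     0 <= s * u k x.
Proof.
move=> x0I; have e0 := eps0.
have Ix0 : I x0 by move: x0I => /andP[? ?]; rewrite /I; apply/andP; split; lra.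
have [[ne _]|[z zI [uz [s s1 sP]]]] := alt k.
  have ux0 := ne x0 x0I.
  have [s [s1 s0x]] : exists s : R, (s = 1 \/ s = -1) /\ 0 < s * u k x0.
    move: ux0; rewrite neq_lt => /orP[un|up]; [exists (-1)|exists 1].
      by split; [right|rewrite mulN1r oppr_gt0].
    by split; [left|rewrite mul1r].
  exists s; split=> //.
  have cs : {for x0, continuous (fun x => s * u k x)}.
    by apply: cvgM; [exact: cvg_cst|exact: cu].
  have /cvgrPdist_lt /(_ _ s0x) [d /= d0 dP] := cs.
  near=> h => x xh; have hd : h < d by near: h; exact: nbhs_right_lt.
  have h0 : 0 < h by near: h; exact: nbhs_right_gt.
  have : `|s * u k x0 - s * u k x| < s * u k x0.
    apply: dP; rewrite /= (le_lt_trans _ hd)// ler_norml.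
    by case: l xh => /andP[? ?]; apply/andP; split; lra.
  by rewrite ltr_norml => /andP[? ?]; lra.
have Iz : I z by move: zI => /andP[? ?]; rewrite /I; apply/andP; split; lra.
have pos x : I x -> z <= x -> 0 <= s * u k x.
  move=> Ix zx; have := crossing_increasing sP Iz Ix zx; rewrite uz mulr0 subr0.
  by apply: le_trans; rewrite mulr_ge0 ?subr_ge0// ltW.
have neg x : I x -> x <= z -> s * u k x <= 0.
  move=> Ix xz; have := crossing_increasing sP Ix Iz xz; rewrite uz mulr0 sub0r.
  have : 0 <= s0 * (z - x) by rewrite mulr_ge0 ?subr_ge0// ltW.
  lra.
have near_I : \forall h \near (0:R)^'+, forall x,
    (if l then x0 - h <= x <= x0 else x0 <= x <= x0 + h) -> I x.
  near=> h => x xh; have he : h < eps by near: h; exact: nbhs_right_lt.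
  move: x0I => /andP[? ?]; rewrite /I.
  by case: l xh => /andP[? ?]; apply/andP; split; lra.
have sN : -s = 1 \/ -s = -1 by case: s1 => ->; [right|left; rewrite opprK].
case: l near_I => near_I.
  have [x0z|zx0] := leP x0 z.
    exists (-s); split=> //; apply: filterS near_I => h hI x xh.
    rewrite mulNr oppr_ge0 neg// ?hI//.
    by case/andP: xh => _ /le_trans; apply.
  exists s; split=> //; near=> h => x xh; apply: pos.
    by apply: (near near_I h).
  have hz : h < x0 - z by near: h; apply: nbhs_right_lt; rewrite subr_gt0.
  by case/andP: xh => ? ?; lra.
have [zx0|x0z] := leP z x0.
  exists s; split=> //; apply: filterS near_I => h hI x xh.
  rewrite pos ?hI//.
  by case/andP: xh => + _; exact: le_trans.
exists (-s); split=> //; near=> h => x xh; rewrite mulNr oppr_ge0; apply: neg.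
  by apply: (near near_I h).
have hz : h < z - x0 by near: h; apply: nbhs_right_lt; rewrite subr_gt0.
by case/andP: xh => ? ?; lra.
Unshelve. all: by end_near. Qed.

Lemma signs_near x0 (l : bool) : y <= x0 <= y + eps -> exists s : 'I_N -> R,
  (forall k, s k = 1 \/ s k = -1) /\
  \forall h \near 0^'+, forall k x, (if l then x0 - h <= x <= x0 else x0 <= x <= x0 + h) ->
     0 <= s k * u k x.
Proof.
move=> x0I; have [s sP] := choice (fun k => sign_near k l x0I).
exists s; split; first by move=> k; have [] := sP k.
by apply: filter_forall => k; have [] := sP k.
Qed.

Lemma strict_local_min_weighted_sum :
  exists2 x0, y <= x0 <= y + eps & strict_local_min F x0.
Proof.
have e0 := eps0; have yI : y - eps <= y + eps + eps by lra.
have cF : {within `[y - eps, y + eps + eps], continuous F}.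
  by apply: continuous_subspaceT; exact: weighted_sum_continuous.
have [x0 x0I x0min] := EVT_min yI cF; rewrite in_itv /= in x0I.
have Fmin x : I x -> F x0 <= F x by move=> Ix; apply: x0min; rewrite in_itv.
have x0J : y <= x0 <= y + eps.
  apply/andP; split; rewrite leNgt; apply/negP => H.
    have Iy : I y by rewrite /I; apply/andP; split; lra.
    by have := outside_larger x0I (or_introl (conj H erefl)); rewrite ltNge Fmin.
  have Iy : I (y + eps) by rewrite /I; apply/andP; split; lra.
  by have := outside_larger x0I (or_intror (conj H erefl)); rewrite ltNge Fmin.
exists x0 => //.
have [sl [sl1 slP]] := signs_near true x0J.
have [sr [sr1 srP]] := signs_near false x0J.
near (0:R)^'+ => h.
have h0 : 0 < h by near: h; exact: nbhs_right_gt.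
have he : h < eps by near: h; exact: nbhs_right_lt.
have Pl : forall k x, x0 - h <= x <= x0 -> 0 <= sl k * u k x by near: h.
have Pr : forall k x, x0 <= x <= x0 + h -> 0 <= sr k * u k x by near: h.
have Il : I (x0 - h) by move: x0J => /andP[? ?]; rewrite /I; apply/andP; split; lra.
have Ir : I (x0 + h) by move: x0J => /andP[? ?]; rewrite /I; apply/andP; split; lra.
rewrite /strict_local_min; near=> x.
have xx0 : x != x0 by near: x; exact: nbhs_dnbhs_neq.
have xh : `|x0 - x| < h.
  by near: x; apply: nbhs_dnbhs; exists h.
move: xh; rewrite ltr_norml => /andP[h1 h2].
move: xx0; rewrite neq_lt => /orP[xx0|x0x].
  have lh : x0 - h < x0 by lra.
  have xlh : x0 - h < x < x0 by apply/andP; split; lra.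
  by have [|//] := concave_between Il x0I lh sl1 Pl xlh; apply: le_lt_trans; exact: Fmin.
have rh : x0 < x0 + h by lra.
have xrh : x0 < x < x0 + h by apply/andP; split; lra.
by have [//|] := concave_between x0I Ir rh sr1 Pr xrh; apply: le_lt_trans; exact: Fmin.
Unshelve. all: by end_near. Qed.

End Kinks.

(** * Flat and crossing eigenfunctions *)

Section Classification.
Context {R : realType}.

Lemma three_classes (P0 P1 P2 : nat -> Prop) :
  (forall k, (k < 3)%N -> [\/ P0 k, P1 k | P2 k]) ->
  (forall i k, (i < k)%N -> (k < 3)%N -> [/\ ~ (P0 i /\ P0 k), ~ (P1 i /\ P1 k) & ~ (P2 i /\ P2 k)]) ->
  (exists2 k, (k < 3)%N & P1 k) /\ (exists2 k, (k < 3)%N & P2 k).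
Proof.
move=> T D.
have [n01 c01 s01] := D 0%N 1%N isT isT; have [n02 c02 s02] := D 0%N 2%N isT isT.
have [n12 c12 s12] := D 1%N 2%N isT isT.
have := T 0%N isT; have := T 1%N isT; have := T 2%N isT.
by move=> [t2|t2|t2] [t1|t1|t1] [t0|t0|t0]; try (by exfalso; tauto); split;
  solve [by exists 0%N|by exists 1%N|by exists 2%N].
Qed.

Lemma product_not_small (c a b : R) : 0 <= c -> 3 / 4 <= c * a ^+ 2 ->
  3 / 4 <= c * b ^+ 2 -> ~ (`|c * (a * b)| <= 2^-1).
Proof.
move=> c0 ha hb /sqr_le_norm h.
have : (3 / 4) * (3 / 4) <= (c * a ^+ 2) * (c * b ^+ 2) :> R by rewrite ler_pM// divr_ge0.
have -> : c * a ^+ 2 * (c * b ^+ 2) = (c * (a * b)) ^+ 2 by ring.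
move=> h2; have := le_trans h2 h; lra.
Qed.

Variables (L y Lam K eps d : R) (V : R -> R).
Hypotheses (L0 : 0 < L) (eps0 : 0 < eps) (epsL : eps < L).
Hypotheses (Vi : integrable_on y (y + L) (fun x => V x - 1))
  (V1 : forall x, V x <= 1)
  (Vin : forall x, y <= x <= y + eps -> V x < 1)
  (Vout : forall x, y + eps < x < y + L -> V x = 1).
Hypotheses (K0 : 0 <= K) (d0 : 0 <= d) (d1 : d <= 1) (Lam1 : 1 <= Lam).

(** The bound on the coefficient that should vanish: b for a function without zero in
    [y, y + eps], a for a function with one. *)
Definition residue := 2 * d + 4 * (K + (2 * K + 2)) * (Lam * eps).
Local Notation t := residue.
Local Notation B2 := (2 * K + 2).
Local Notation w1 := (freq L 1).
Local Notation sq := (Num.sqrt L^-1).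

Hypotheses (small_phase : 2 * (Lam * eps) <= 2^-1)
  (small_ip : d * (L * (5 * K + 4)) + L / 2 * t ^+ 2 <= 4^-1)
  (small_const : L * d ^+ 2 < 2^-1)
  (small_d : d <= w1 ^+ 2 / 2)
  (small_td : t + d <= sq / 4)
  (small_slope : Lam * t + d <= w1 * sq / 4).

Local Notation ip := (ip L y).

Definition mode (lam : R) u j a b :=
  [/\ eigenfunction L V lam u, ip u u = 1, forall x, `|u x| <= K,
      `|lam - 1 - freq L j ^+ 2| <= d & freq L j <= Lam] /\ sinusoidal L y d u j a b.

(** The classes share the arguments u j a b so that they can be handled uniformly;
    they are the almost constant functions, the cosines and the sines. *)
Definition class0 (u : R -> R) (j : nat) (a b : R) := j = 0%N.
Definition classC (u : R -> R) (j : nat) (a b : R) := [/\ (0 < j)%N,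
  forall x, y <= x <= y + eps -> u x != 0 & `|b| <= t].
Definition classS (u : R -> R) (j : nat) (a b : R) := [/\ (0 < j)%N,
  exists2 z, y <= z <= y + eps & u z = 0 & `|a| <= t].

Let I x := y - eps <= x <= y + eps + eps.

Let Lam0 : 0 <= Lam. Proof. exact: le_trans Lam1. Qed.
Let Le0 : 0 <= Lam * eps. Proof. by rewrite mulr_ge0// ltW. Qed.
Let B20 : 0 <= B2. Proof. by rewrite addr_ge0// mulr_ge0. Qed.

Let t0 : 0 <= t.
Proof.
apply: addr_ge0; first exact: mulr_ge0.
by apply: mulr_ge0 Le0; apply: mulr_ge0 => //; exact: addr_ge0.
Qed.

Lemma phase_small j x : freq L j <= Lam -> I x ->
  `|freq L j * (x - y)| <= 2 * (Lam * eps).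
Proof.
move=> jL /andP[h1 h2]; rewrite normrM ger0_norm ?freq_ge0//.
have -> : 2 * (Lam * eps) = Lam * (2 * eps) by ring.
rewrite ler_pM ?freq_ge0// ler_norml; apply/andP; have := eps0; split; lra.
Qed.

Lemma cos_ge_half j x : freq L j <= Lam -> I x -> 2^-1 <= cos (freq L j * (x - y)).
Proof.
move=> jL Ix; have := cos_lip 0 (freq L j * (x - y)); rewrite cos0 sub0r normrN.
move=> /le_trans /(_ (le_trans (phase_small jL Ix) small_phase)).
by rewrite ler_norml => /andP[_]; lra.
Qed.

Lemma sin_small j x : freq L j <= Lam -> I x ->
  `|sin (freq L j * (x - y))| <= 2 * (Lam * eps).
Proof.
move=> jL Ix; have := sin_lip (freq L j * (x - y)) 0; rewrite sin0 !subr0.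
by move=> /le_trans; apply; exact: phase_small.
Qed.

Let I_in x : y <= x <= y + eps -> I x.
Proof. by move=> /andP[? ?]; have := eps0; rewrite /I => ?; apply/andP; split; lra. Qed.

Section OneMode.
Variables (lam : R) (u : R -> R) (j : nat) (a b : R).
Hypothesis mu : mode lam u j a b.

Let eu : eigenfunction L V lam u. Proof. by have [[]] := mu. Qed.
Let un : ip u u = 1. Proof. by have [[]] := mu. Qed.
Let uK x : `|u x| <= K. Proof. by have [[]] := mu. Qed.
Let lj : `|lam - 1 - freq L j ^+ 2| <= d. Proof. by have [[]] := mu. Qed.
Let jL : freq L j <= Lam. Proof. by have [[]] := mu. Qed.
Let us : sinusoidal L y d u j a b. Proof. by have [] := mu. Qed.
Let cu : continuous u. Proof. by have [/C1_continuous] := eigenfunction_C1 eu. Qed.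

Lemma mode_classes : [\/ class0 u j a b, classC u j a b | classS u j a b].
Proof.
have [j0|j0] := posnP j; first by constructor 1.
have wLam : freq L j * eps <= Lam * eps by rewrite ler_wpM2r// ltW.
have we0 : 0 <= freq L j * eps by rewrite mulr_ge0 ?freq_ge0// ltW.
have [nz|[z zI uz]] : (forall x, y <= x <= y + eps -> u x != 0) \/
    (exists2 z, y <= z <= y + eps & u z = 0).
  have [h|h] := pselect (exists2 z, y <= z <= y + eps & u z = 0); first by right.
  by left => x xI; apply/eqP => ux; apply: h; exists x.
- constructor 2; split => //.
  have we : freq L j * eps <= 2^-1 by have := small_phase; lra.
  have := phase_bound L0 eps0 epsL Vi V1 Vin Vout eu nz we.
  have := ip_bounded y L0 cu uK (@continuous_cosj _ L y j) (fun x => cos_max _).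
  have := ip_sinj L0 cu us j0.
  set Is := ip u _; set Ic := ip u _ => h1 h2 h3.
  have h4 : 2 * (freq L j * eps) * `|Ic| <= 2 * (Lam * eps) * (K * L).
    by apply: ler_pM => //; [exact: mulr_ge0|exact: ler_wpM2l].
  have L2 : 0 < L / 2 by rewrite divr_gt0.
  rewrite -(ler_pM2r L2) -[X in _ * X <= _](gtr0_norm L2) -normrM.
  have -> : b * (L / 2) = Is - (Is - b * (L / 2)) by ring.
  rewrite (le_trans (ler_normB _ _))//.
  have -> : t * (L / 2) = d * L + 2 * (Lam * eps) * (K * L) + 2 * B2 * (Lam * eps) * L.
    by rewrite /t; field.
  have h6 : 0 <= 2 * B2 * (Lam * eps) * L.
    by apply: mulr_ge0 (ltW L0); apply: mulr_ge0 Le0; apply: mulr_ge0 B20.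
  lra.
- constructor 3; split; [by []|by exists z|].
  have [_ bB] := coef_bound L0 d1 cu uK us j0.
  have [h _] := us z; rewrite uz sub0r normrN in h.
  have Iz := I_in zI.
  have hc := cos_ge_half jL Iz; have hs := sin_small jL Iz.
  have hb : `|b * sin (freq L j * (z - y))| <= B2 * (2 * (Lam * eps)) by rewrite normrM ler_pM.
  have ha : `|a * cos (freq L j * (z - y))| <= d + B2 * (2 * (Lam * eps)).
    set p := a * _ in h *; set q := b * _ in h hb *.
    have -> : p = p + q - q by ring.
    rewrite (le_trans (ler_normB _ _))//; lra.
  rewrite normrM in ha.
  have c0 : 0 <= cos (freq L j * (z - y)) by apply: le_trans hc.
  rewrite (ger0_norm c0) in ha.
  have := ler_wpM2l (normr_ge0 a) hc => h2.
  have h3 : 0 <= 4 * K * (Lam * eps) by apply: mulr_ge0 Le0; apply: mulr_ge0.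
  have -> : t = 2 * (d + B2 * (2 * (Lam * eps))) + 4 * K * (Lam * eps) by rewrite /t; ring.
  lra.
Qed.

Lemma tsq : 0 <= L / 2 * t ^+ 2.
Proof. by rewrite mulr_ge0 ?sqr_ge0// divr_ge0// ltW. Qed.

Lemma amp0 : class0 u j a b -> 3 / 4 <= L * a ^+ 2.
Proof.
move=> j0; have us0 : sinusoidal L y d u 0 a b by rewrite -j0.
have := ip_pair0 L0 K0 d0 d1 cu uK us0 cu uK us0.
rewrite un ler_norml -expr2 => /andP[_ h].
have := tsq; have := small_ip; lra.
Qed.

Lemma ampC : classC u j a b -> 3 / 4 <= L / 2 * a ^+ 2.
Proof.
move=> [j0 _ bt].
have := ip_pair L0 d1 j0 cu uK us cu uK us.
rewrite un ler_norml -!expr2 mulrDr => /andP[_ h].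
have L2 : 0 <= L / 2 by rewrite divr_ge0// ltW.
have := ler_wpM2l L2 (sqr_le_norm bt); have := small_ip; lra.
Qed.

Lemma ampS : classS u j a b -> 3 / 4 <= L / 2 * b ^+ 2.
Proof.
move=> [j0 _ att].
have := ip_pair L0 d1 j0 cu uK us cu uK us.
rewrite un ler_norml -!expr2 mulrDr => /andP[_ h].
have L2 : 0 <= L / 2 by rewrite divr_ge0// ltW.
have := ler_wpM2l L2 (sqr_le_norm att); have := small_ip; lra.
Qed.

Lemma amplitude_ge (e : R) : 3 / 4 <= L / 2 * e ^+ 2 -> sq <= `|e|.
Proof.
move=> h; rewrite -sqrtr_sqr ler_wsqrtr//.
rewrite -(ler_pM2l L0) divff ?gt_eqF//; lra.
Qed.

Lemma const_nonvanishing x : class0 u j a b -> u x != 0.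
Proof.
move=> j0; apply/eqP => ux.
have [h _] := near_const us x j0; rewrite ux sub0r normrN in h.
have := amp0 j0; have := ler_wpM2l (ltW L0) (sqr_le_norm h); have := small_const; lra.
Qed.

Lemma curvature_le x : (1 - lam) * `|u x| <= d * K.
Proof.
have : 1 - lam <= d by have := lj; rewrite ler_norml => /andP[]; have := sqr_ge0 (freq L j); lra.
move=> h; rewrite (le_trans (ler_wpM2r (normr_ge0 _) h))// ler_wpM2l//.
Qed.

Lemma mode_lower : 1 - d <= lam.
Proof. by have := lj; rewrite ler_norml => /andP[]; have := sqr_ge0 (freq L j); lra. Qed.

Lemma curvatureC x : classC u j a b -> I x ->
  (1 - lam) * `|u x| <= - (w1 ^+ 2 / 2 * (sq / 4)).
Proof.
move=> cC Ix; have [j0 _ bt] := cC.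
have sa := amplitude_ge (ampC cC).
have hc := cos_ge_half jL Ix.
have [h _] := us x.
have w1j : w1 ^+ 2 <= freq L j ^+ 2.
  by rewrite lerXn2r ?nnegrE ?freq_ge0// freq_le.
have lam1 : w1 ^+ 2 / 2 <= lam - 1.
  by have := lj; rewrite ler_norml => /andP[+ _]; have := small_d; lra.
have hs : `|b * sin (freq L j * (x - y))| <= t.
  by rewrite normrM -[leRHS]mulr1 ler_pM// sin_max.
have ha : sq / 2 <= `|a * cos (freq L j * (x - y))|.
  have c0 : 0 <= cos (freq L j * (x - y)) by apply: le_trans hc.
  by rewrite normrM (ger0_norm c0) ler_pM// sqrtr_ge0.
have hu : sq / 4 <= `|u x|.
  set p := a * _ in h ha; set q := b * _ in h hs.
  have : `|p| <= `|u x| + `|u x - (p + q)| + `|q|.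
    have -> : p = u x - (u x - (p + q)) - q by ring.
    rewrite (le_trans (ler_normB _ _))// lerD2r.
    rewrite [X in _ <= _ + `|X|](_ : _ = u x - (p + q)); last by ring.
    exact: ler_normB.
  have := small_td; lra.
have w0 : 0 <= w1 ^+ 2 / 2 by rewrite divr_ge0// sqr_ge0.
have s4 : 0 <= sq / 4 by rewrite divr_ge0// sqrtr_ge0.
have := ler_pM w0 s4 lam1 hu; lra.
Qed.

Lemma slope_flat x : class0 u j a b \/ classC u j a b -> I x ->
  `|derive1 u x| <= d + Lam * (t + B2 * (2 * (Lam * eps))).
Proof.
have e0 : 0 <= Lam * (t + B2 * (2 * (Lam * eps))).
  have le0 : 0 <= 2 * (Lam * eps) by exact: mulr_ge0.
  by rewrite mulr_ge0// addr_ge0// mulr_ge0.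
case=> [j0 _|[j0 _ bt] Ix].
  by have [_ h] := near_const us x j0; rewrite (le_trans h)// lerDl.
have [aB _] := coef_bound L0 d1 cu uK us j0.
have hs := sin_small jL Ix; have [_ h] := us x.
have h1 : `|b * cos (freq L j * (x - y))| <= t.
  by rewrite normrM -[leRHS]mulr1 ler_pM// cos_max.
have h2 : `|a * sin (freq L j * (x - y))| <= B2 * (2 * (Lam * eps)) by rewrite normrM ler_pM.
have h3 : `|freq L j * (b * cos (freq L j * (x - y)) - a * sin (freq L j * (x - y)))| <=
    Lam * (t + B2 * (2 * (Lam * eps))).
  rewrite normrM ger0_norm ?freq_ge0// ler_pM ?freq_ge0//.
  by rewrite (le_trans (ler_normB _ _))// lerD.
rewrite -[derive1 u x](subrK (freq L j * (b * cos (freq L j * (x - y)) - a * sin (freq L j * (x - y))))).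
by rewrite (le_trans (ler_normD _ _))// lerD.
Qed.

Lemma slope_crossing : classS u j a b ->
  exists2 s : R, s = 1 \/ s = -1 & forall x, I x -> w1 * sq / 4 <= s * derive1 u x.
Proof.
move=> cS; have [j0 _ att] := cS.
have sb := amplitude_ge (ampS cS).
have [s s1 sE] : exists2 s : R, s = 1 \/ s = -1 & s * b = `|b|.
  have [b0|b0] := leP 0 b; first by exists 1; [left|rewrite mul1r ger0_norm].
  by exists (-1); [right|rewrite mulN1r ltr0_norm].
have sn : `|s| = 1 by case: s1 => ->; rewrite ?normrN normr1.
exists s => // x Ix; have [_ h] := us x.
have hc := cos_ge_half jL Ix.
set C := cos _ in h hc; set S := sin _ in h.
have w1j : w1 <= freq L j by exact: freq_le.
have h1 : `|s * (derive1 u x - freq L j * (b * C - a * S))| <= d by rewrite normrM sn mul1r.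
have h2 : `|s * (freq L j * (a * S))| <= Lam * t.
  rewrite normrM sn mul1r normrM ger0_norm ?freq_ge0// ler_pM ?freq_ge0//.
  by rewrite normrM -[leRHS]mulr1 ler_pM// sin_max.
have h3 : w1 * (sq / 2) <= freq L j * (`|b| * C).
  by apply: ler_pM; rewrite ?freq_ge0// ?divr_ge0 ?sqrtr_ge0//; apply: ler_pM; rewrite ?sqrtr_ge0.
have E : s * derive1 u x = s * (derive1 u x - freq L j * (b * C - a * S)) +
    freq L j * (`|b| * C) - s * (freq L j * (a * S)) by rewrite -sE; ring.
move: h1 h2; rewrite !ler_norml => /andP[h1 _] /andP[_ h2].
have := small_slope; rewrite E; lra.
Qed.

End OneMode.

(** Two members of the same class with the same frequency are almost proportional,
    hence cannot be orthogonal. *)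
Lemma same_class lam1 u1 j1 a1 b1 lam2 u2 j2 a2 b2 :
  mode lam1 u1 j1 a1 b1 -> mode lam2 u2 j2 a2 b2 -> ip u1 u2 = 0 ->
  (j1 < 2)%N -> (j2 < 2)%N ->
  [/\ ~ (class0 u1 j1 a1 b1 /\ class0 u2 j2 a2 b2),
      ~ (classC u1 j1 a1 b1 /\ classC u2 j2 a2 b2) &
      ~ (classS u1 j1 a1 b1 /\ classS u2 j2 a2 b2)].
Proof.
move=> m1 m2 u12 j12 j22.
have [[eu1 _ k1 _ _] s1] := m1; have [[eu2 _ k2 _ _] s2] := m2.
have c1 : continuous u1 by have [/C1_continuous] := eigenfunction_C1 eu1.
have c2 : continuous u2 by have [/C1_continuous] := eigenfunction_C1 eu2.
have L2 : 0 <= L / 2 by rewrite divr_ge0// ltW.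
have T := tsq; have sip := small_ip.
split.
- move=> [z1 z2]; apply: (product_not_small (ltW L0) (amp0 m1 z1) (amp0 m2 z2)).
  have s1' : sinusoidal L y d u1 0 a1 b1 by rewrite -z1.
  have s2' : sinusoidal L y d u2 0 a2 b2 by rewrite -z2.
  have := ip_pair0 L0 K0 d0 d1 c1 k1 s1' c2 k2 s2'.
  by rewrite u12 sub0r normrN; lra.
- move=> [C1 C2]; apply: (product_not_small L2 (ampC m1 C1) (ampC m2 C2)).
  have [p1 _ b1t] := C1; have [p2 _ b2t] := C2.
  have j21 : j2 = j1 by case: j1 j12 p1 {m1 s1 C1} => [|[]]//; case: j2 j22 p2 {m2 s2 C2} => [|[]].
  rewrite j21 in s2.
  have := ip_pair L0 d1 p1 c1 k1 s1 c2 k2 s2.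
  rewrite u12 sub0r normrN mulrDr.
  have : `|L / 2 * (b1 * b2)| <= L / 2 * t ^+ 2.
    by rewrite normrM ger0_norm// ler_wpM2l// normrM expr2 ler_pM.
  move: (L / 2 * (b1 * b2)) (L / 2 * (a1 * a2)) => q p hq hp.
  have -> : p = p + q - q by ring.
  rewrite (le_trans (ler_normB _ _))//; lra.
- move=> [C1 C2]; apply: (product_not_small L2 (ampS m1 C1) (ampS m2 C2)).
  have [p1 _ b1t] := C1; have [p2 _ b2t] := C2.
  have j21 : j2 = j1 by case: j1 j12 p1 {m1 s1 C1} => [|[]]//; case: j2 j22 p2 {m2 s2 C2} => [|[]].
  rewrite j21 in s2.
  have := ip_pair L0 d1 p1 c1 k1 s1 c2 k2 s2.
  rewrite u12 sub0r normrN mulrDr.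
  have : `|L / 2 * (a1 * a2)| <= L / 2 * t ^+ 2.
    by rewrite normrM ger0_norm// ler_wpM2l// normrM expr2 ler_pM.
  move: (L / 2 * (b1 * b2)) (L / 2 * (a1 * a2)) => q p hq hp.
  have -> : q = p + q - p by ring.
  rewrite (le_trans (ler_normB _ _))//; lra.
Qed.

Section Landscape.
Variables (N : nat) (lam : nat -> R) (u : nat -> R -> R).
Hypotheses (N3 : (3 <= N)%N) (d2 : d <= 2^-1).
Hypothesis modes : forall k, (k < N)%N ->
  lam k <= Lam /\ exists jab : nat * (R * R), mode (lam k) (u k) jab.1 jab.2.1 jab.2.2.
Hypothesis u_ortho : forall i k, (i < k)%N -> ip (u i) (u k) = 0.
Hypothesis lam_low : forall k, (k < 3)%N -> lam k <= 1 + w1 ^+ 2.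

Definition slope_error := d + Lam * (t + B2 * (2 * (Lam * eps))) + d * K.
Definition weight_max := 2 / sq.
Definition weight_min := (Lam * (K + 1))^-1.

Hypotheses (slope_lt : N%:R * (weight_max * slope_error) < weight_min * (w1 * sq / 4))
  (curv_lt : N%:R * (weight_max * slope_error) < weight_min * (w1 ^+ 2 / 2 * (sq / 4))).

Let sq0 : 0 < sq. Proof. by rewrite sqrtr_gt0 invr_gt0. Qed.
Let w10 : 0 < w1. Proof. exact: freq_gt0. Qed.
Let K1 : 0 < K + 1. Proof. by rewrite ltr_wpDl. Qed.
Let Lam_gt0 : 0 < Lam. Proof. exact: lt_le_trans Lam1. Qed.

Lemma sup_norm_mode k : (k < N)%N -> sq <= sup_norm L (u k) /\ sup_norm L (u k) <= K.
Proof.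
move=> kN; have [_ [[j [a b]] [/= [ek un uK _ _] _]]] := modes kN.
have cu : continuous (u k) by have [/C1_continuous] := eigenfunction_C1 ek.
have [pu _ _ _] := ek.
have [s0 sK] := sup_norm_bounds L0 cu pu uK.
have -> : \intab_[0, L] (fun x => u k x ^+ 2) = 1.
  rewrite -un /ip (intab_shift L0 y).
  - by apply: eq_intab => x _; rewrite expr2.
  - by move=> x; apply: cvgM; exact: cu.
  - by move=> x; rewrite pu.
move=> h; split => //.
by rewrite -(ger0_norm s0) -sqrtr_sqr ler_wsqrtr// -[L^-1]mul1r ler_pdivrMr.
Qed.

Lemma weight_bounds k : (k < N)%N ->
  weight_min <= (Num.sqrt (lam k))^-1 / sup_norm L (u k) <= weight_max.
Proof.
move=> kN; have [s1 s2] := sup_norm_mode kN.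
have [lL [[j [a b]] /= mk]] := modes kN.
have l2 : 2^-1 <= lam k by have := mode_lower mk; have := d2; lra.
have h1 : Num.sqrt (lam k) <= Lam.
  rewrite -[Lam](ger0_norm Lam0) -sqrtr_sqr ler_wsqrtr//.
  by rewrite (le_trans lL)// expr2 ler_peMr.
have h2 : 2^-1 <= Num.sqrt (lam k).
  have h20 : (0 : R) <= 2^-1 by rewrite invr_ge0.
  rewrite -(ger0_norm h20) -sqrtr_sqr ler_wsqrtr//.
  by apply: le_trans l2; rewrite expr2; lra.
have l0 : 0 < Num.sqrt (lam k) by apply: lt_le_trans h2; rewrite invr_gt0.
have n0 : 0 < sup_norm L (u k) by exact: lt_le_trans s1.
rewrite -invfM /weight_min /weight_max; apply/andP; split.
  rewrite lef_pV2 ?posrE ?mulr_gt0// ler_pM ?(ltW l0) ?(ltW n0)//.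
  by rewrite (le_trans s2)// lerDl.
rewrite -[X in X / _]invrK -invfM lef_pV2 ?posrE ?mulr_gt0 ?invr_gt0//.
by rewrite ler_pM// ?invr_ge0// ltW.
Qed.

Lemma low_index k jab : (k < 3)%N -> mode (lam k) (u k) jab.1 jab.2.1 jab.2.2 ->
  (jab.1 < 2)%N.
Proof.
move=> k3 [[_ _ _ lj _] _]; rewrite ltnNge; apply/negP => j2.
have := freq_le L0 j2; have -> : freq L 2 = 2 * w1 by rewrite /freq; ring.
move=> h; have h2 : (2 * w1) ^+ 2 <= freq L jab.1 ^+ 2.
  by rewrite lerXn2r ?nnegrE ?freq_ge0// mulr_ge0// ltW.
move: lj; rewrite ler_norml => /andP[+ _].
have := lam_low k3; have := small_d; have : 0 < w1 ^+ 2 by rewrite exprn_gt0.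
move: h2; rewrite exprMn; lra.
Qed.

(** The first three eigenfunctions have frequency index at most 1 and are pairwise
    orthogonal, so that they fall into the three different classes: the sine provides
    the kink and the cosine the concavity. *)
Lemma landscape_strict_local_min :
  exists2 x0 : R, y <= x0 <= y + eps & strict_local_min (landscape L lam u N) x0.
Proof.
have /choice [J JP] : forall k, exists jab : nat * (R * R),
    (k < N)%N -> mode (lam k) (u k) jab.1 jab.2.1 jab.2.2.
  move=> k; have [kN|_] := boolP (k < N)%N; last by exists (0%N, (0, 0)).
  by have [_ [jab mk]] := modes kN; exists jab.
pose c (k : 'I_N) := (Num.sqrt (lam k))^-1 / sup_norm L (u k).
have -> : landscape L lam u N = weighted_sum c (fun k : 'I_N => u k).
  apply/funext => x; apply: eq_bigr => k _.
  by rewrite /c -!mulrA [`|_| / _]mulrC.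
have eig (k : 'I_N) : eigenfunction L V (lam k) (u k) by have [[]] := JP k (ltn_ord k).
pose cl (P : (R -> R) -> nat -> R -> R -> Prop) k := P (u k) (J k).1 (J k).2.1 (J k).2.2.
have cls k : (k < N)%N -> [\/ cl class0 k, cl classC k | cl classS k].
  by move=> kN; exact: mode_classes (JP k kN).
have kN3 k : (k < 3)%N -> (k < N)%N by move=> /leq_trans; apply.
have [[kC kC3 clC] [kS kS3 clS]] : (exists2 k, (k < 3)%N & cl classC k) /\
    (exists2 k, (k < 3)%N & cl classS k).
  apply: (@three_classes (cl class0)) => [k /kN3|i k ik k3]; first exact: cls.
  have i3 := ltn_trans ik k3.
  apply: (same_class (JP i (kN3 _ i3)) (JP k (kN3 _ k3)) (u_ortho ik)).
    exact: low_index i3 (JP i (kN3 _ i3)).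
  exact: low_index k3 (JP k (kN3 _ k3)).
have dK : 0 <= d * K by exact: mulr_ge0.
have e0 : 0 <= Lam * (t + B2 * (2 * (Lam * eps))).
  by apply: mulr_ge0 => //; apply: addr_ge0 => //; apply: mulr_ge0 => //; exact: mulr_ge0.
have cross (k : 'I_N) : cl classS k -> crossing y eps (fun i : 'I_N => u i) (w1 * sq / 4) k.
  move=> cS; have [_ [z zI uz] _] := cS; exists z => //; split=> //.
  exact: slope_crossing (JP k (ltn_ord k)) cS.
apply: (@strict_local_min_weighted_sum _ y eps N V (fun k => lam k) c _ slope_error
  (w1 * sq / 4) (w1 ^+ 2 / 2 * (sq / 4)) weight_min weight_max) => //.
- by move=> k; have [] := eigenfunction_C1 (eig k).
- by move=> k; have [_ _ _] := eig k.
- by rewrite invr_gt0 mulr_gt0.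
- by move=> k; have /andP[] := weight_bounds (ltn_ord k).
- by move=> k; have /andP[] := weight_bounds (ltn_ord k).
- by rewrite /slope_error !addr_ge0.
- by rewrite divr_gt0// mulr_gt0.
- by rewrite mulr_gt0// divr_gt0// exprn_gt0.
- move=> k; have kN := ltn_ord k; have mk := JP k kN.
  have fl : cl class0 k \/ cl classC k -> forall x, I x -> `|derive1 (u k) x| <= slope_error.
    move=> h x Ix; have := slope_flat mk h Ix; rewrite /slope_error; lra.
  have [h|h|h] := cls k kN; last by right; exact: cross.
    by left; split; [move=> x _; exact: const_nonvanishing mk _ h|apply: fl; left].
  by left; split; [have [] := h|apply: fl; right].
- by exists (Ordinal (kN3 _ kS3)); exact: cross.
- move=> k x _; have := curvature_le (JP k (ltn_ord k)) x.
  by rewrite /slope_error; have := d0; move: e0; lra.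
- exists (Ordinal (kN3 _ kC3)) => x Ix.
  exact: (@curvatureC _ _ _ _ _ (JP kC (kN3 _ kC3)) x clC Ix).
Qed.

End Landscape.

End Classification.

(** * Choice of the thresholds *)

Section Assembly.
Context {R : realType}.

Lemma le_of_sqr_le (x M : R) : 1 <= M -> x ^+ 2 <= M -> x <= M.
Proof.
move=> M1 xM; rewrite (le_trans (ler_norm x))// -sqrtr_sqr.
by rewrite -[M]ger0_norm ?(le_trans _ M1)// -sqrtr_sqr ler_wsqrtr// (le_trans xM)// expr2 ler_peMr// (le_trans _ M1).
Qed.

Variables (L y : R) (phi : R -> R).
Hypotheses (L0 : 0 < L) (phi0 : forall t, t \in `[0, 1] -> phi t < 0)
  (phii : integrable_on 0 1 phi).

Local Notation V := (potential L phi y).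
Local Notation ip := (ip L y).

Definition landscape_has_min (eps : R) (N : nat) := forall (lambda : nat -> R) (u : nat -> R -> R),
  eigenbasis L (V eps) lambda u ->
  exists2 x0 : R, y <= x0 <= y + eps & strict_local_min (landscape L lambda u N) x0.

(** The precision d on the eigenfunctions is chosen first, in terms of L and N;
    eps comes second, because the bound on the perturbation which guarantees the
    precision d depends on d. *)
Lemma landscape_has_min_small N : (3 <= N)%N -> \forall eps \near 0^'+, landscape_has_min eps N.
Proof.
move=> N3.
pose Lam : R := 1 + freq L N ^+ 2.
have Lam1 : 1 <= Lam by rewrite lerDl sqr_ge0.
have Lam0 : 0 <= Lam by exact: le_trans Lam1.
pose K := sup_bound L Lam.
have K0 : 0 <= K by exact: sqrtr_ge0.
pose sq := Num.sqrt L^-1.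
have sq0 : 0 < sq by rewrite sqrtr_gt0 invr_gt0.
have w10 : 0 < freq L 1 by exact: freq_gt0.
pose Phi := \intab_[0, 1] (fun t => `|phi t|).
have Phi0 : 0 <= Phi by apply: intab_ge0.
have S0 := sobolev_const_gt0 L0.
pose s0 := freq L 1 * sq / 4.
have s00 : 0 < s0 by rewrite /s0 divr_gt0// mulr_gt0.
pose m0 := freq L 1 ^+ 2 / 2 * (sq / 4).
have m00 : 0 < m0 by rewrite mulr_gt0// divr_gt0// exprn_gt0.
pose cmin := (Lam * (K + 1))^-1.
have cmin0 : 0 < cmin.
  by rewrite invr_gt0 mulr_gt0// ?(lt_le_trans ltr01)// lerDr.
pose cmax := 2 * sq^-1.
have cmax0 : 0 < cmax by rewrite mulr_gt0// invr_gt0.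
pose B2 := 2 * K + 2.
have B20 : 0 <= B2 by rewrite addr_ge0// mulr_ge0.
pose g0 := Num.min (cmin * s0) (cmin * m0) / (2 * (N%:R * cmax + 1)).
have g00 : 0 < g0.
  have n0 : 0 <= N%:R * cmax by apply: mulr_ge0 => //; exact: ltW.
  by apply: divr_gt0; [rewrite lt_min; apply/andP; split; exact: mulr_gt0|apply: mulr_gt0 => //; exact: ltr_wpDl].
(* The bound residue is the sum of 2 * d and of a multiple of eps: the conditions on
   d leave half of the room in each inequality for the later conditions on eps. *)
near (0 : R)^'+ => d.
have d0 : 0 < d by near: d; exact: nbhs_right_gt.
have d1 : d <= 1 by near: d; exact: nbhs_right_le.
have d2 : d < 2^-1 by near: d; apply: nbhs_right_lt; rewrite invr_gt0.
have dip : d * (L * (5 * K + 4)) < 16^-1 by near: d; apply: near0_mul_lt; rewrite invr_gt0.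
have dL : d * L < 2^-1 by near: d; apply: near0_mul_lt; rewrite invr_gt0.
have dw : d < freq L 1 ^+ 2 / 2 by near: d; apply: nbhs_right_lt; rewrite divr_gt0// exprn_gt0.
have dt1 : d * (4 * (L / 2)) < 16^-1 by near: d; apply: near0_mul_lt; rewrite invr_gt0.
have dsq : d * 3 < sq / 8 by near: d; apply: near0_mul_lt; rewrite divr_gt0.
have dslope : d * (2 * Lam + 1) < s0 / 2 by near: d; apply: near0_mul_lt; rewrite divr_gt0.
have dg : d * (K + 1 + 2 * Lam) < g0 / 2 by near: d; apply: near0_mul_lt; rewrite divr_gt0.
have [rho0 rho00 near_sin] := near_sinusoid y L0 Lam1 d0.
near=> eps.
have eps0 : 0 < eps by near: eps; exact: nbhs_right_gt.
have eps1 : eps <= 1 by near: eps; exact: nbhs_right_le.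
have epsL : eps < L by near: eps; exact: nbhs_right_lt.
have e1 : eps * (2 * Lam) < 2^-1 by near: eps; apply: near0_mul_lt; rewrite invr_gt0.
have e2 : eps * Phi < rho0 by near: eps; exact: near0_mul_lt.
have e3 : eps * (sobolev_const L * Phi) < 2^-1 by near: eps; apply: near0_mul_lt; rewrite invr_gt0.
pose Q := 4 * (K + B2) * Lam.
have Q0 : 0 <= Q by rewrite !mulr_ge0// addr_ge0.
have e4 : eps * Q < 1 by near: eps; exact: near0_mul_lt.
have e5 : eps * (Q * (4 * (L / 2))) < 16^-1 by near: eps; apply: near0_mul_lt; rewrite invr_gt0.
have e6 : eps * Q < sq / 8 by near: eps; apply: near0_mul_lt; rewrite divr_gt0.
have e7 : eps * (Lam * Q) < s0 / 2 by near: eps; apply: near0_mul_lt; rewrite divr_gt0.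
have e8 : eps * (Lam * (Q + B2 * (2 * Lam))) < g0 / 2 by near: eps; apply: near0_mul_lt; rewrite divr_gt0.
set t := residue Lam K eps d.
have tE : t = 2 * d + eps * Q by rewrite /t /residue /Q /B2; ring.
have [Vi rhoE] := potential_integrable y eps0 epsL phii.
have rhoPhi : perturbation L y (V eps) <= eps * Phi.
  rewrite /perturbation rhoE -/Phi ler_wpM2r// expr2 ler_piMl// ltW.
have V1 x : V eps x <= 1 by exact: potential_le1.
have Vin x : y <= x <= y + eps -> V eps x < 1.
  move=> /[dup] xI /andP[yx xe]; rewrite potential_in// gtrDl pmulr_rlt0// phi0// in_itv /=.
  by rewrite divr_ge0 ?subr_ge0 ?(ltW eps0)//= ler_pdivrMr// mul1r lerBlDl.
have Vout x : y + eps < x < y + L -> V eps x = 1 by exact: potential_out.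
have small : sobolev_const L * perturbation L y (V eps) <= 2^-1.
  by rewrite (le_trans (ler_wpM2l (ltW S0) rhoPhi))// mulrCA ltW.
have rho_le : perturbation L y (V eps) <= rho0 by rewrite (le_trans rhoPhi)// ltW.
move=> lambda u eb.
have lamk k : (k < N)%N -> lambda k <= Lam.
  move=> kN; rewrite (le_trans (eigenvalue_upper L0 k Vi V1 small eb))// lerD2l.
  rewrite lerXn2r ?nnegrE ?freq_ge0// freq_le//.
  by rewrite (leq_trans _ (ltnW kN))// leq_uphalf_double -addnn leq_addr.
have uk k : ip (u k) (u k) = 1 by rewrite (ip_orthonormal y L0 eb) eqxx.
have ujk i k : (i < k)%N -> ip (u i) (u k) = 0.
  by move=> ik; rewrite (ip_orthonormal y L0 eb) ltn_eqF.
have eigk k := eigenbasis_eigen eb k.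
have dataE k : (k < N)%N -> exists jab : nat * (R * R),
    mode L y Lam K d (V eps) (lambda k) (u k) jab.1 jab.2.1 jab.2.2.
  move=> kN; have [j [a [b [lj us]]]] :=
    near_sin _ _ _ Vi small rho_le (eigk k) (uk k) (lamk k kN).
  exists (j, (a, b)); split=> //=; split=> //.
    by move=> x; exact: (eigenfunction_bound L0 Vi small (eigk k) (uk k) (lamk k kN)).
  have : freq L j ^+ 2 <= Lam.
    move: lj (lamk k kN); rewrite ler_norml => /andP[lj _] lL; clear - lj lL d1; lra.
  by move=> fL; exact: le_of_sqr_le.
have h_phase : 2 * (Lam * eps) <= 2^-1 by clear -e1; lra.
have tt : t ^+ 2 <= 4 * t.
  have t0 : 0 <= t by rewrite tE; apply: addr_ge0; apply: mulr_ge0 => //; exact: ltW.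
  by rewrite expr2 ler_wpM2r// tE; clear -e4 d1; lra.
have L20 : 0 <= L / 2 by rewrite divr_ge0// ltW.
have h_ip : d * (L * (5 * K + 4)) + L / 2 * t ^+ 2 <= 4^-1.
  have := ler_wpM2l L20 tt; rewrite tE; clear -dip dt1 e5; lra.
have h_const : L * d ^+ 2 < 2^-1.
  have dd : d ^+ 2 <= d by rewrite expr2 ler_piMl// ltW.
  by rewrite mulrC in dL; exact: le_lt_trans (ler_wpM2l (ltW L0) dd) dL.
have h_td : t + d <= sq / 4 by rewrite tE; clear -dsq e6; lra.
have h_slope : Lam * t + d <= freq L 1 * sq / 4.
  by rewrite -/s0 tE; clear -dslope e7; lra.
have gg0 : slope_error Lam K eps d <= g0.
  have -> : slope_error Lam K eps d =
      d * (K + 1 + 2 * Lam) + eps * (Lam * (Q + B2 * (2 * Lam))).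
    by rewrite /slope_error -/t -/B2 tE; ring.
  by rewrite [leRHS]splitr ltW// ltrD.
have cg n0 : 0 < n0 -> Num.min (cmin * s0) (cmin * m0) <= cmin * n0 ->
    N%:R * (cmax * slope_error Lam K eps d) < cmin * n0.
  move=> n00 /lt_le_trans; apply.
  have nc0 : 0 <= N%:R * cmax by apply: mulr_ge0 => //; exact: ltW.
  rewrite mulrA (le_lt_trans (ler_wpM2l nc0 gg0))//.
  have -> : N%:R * cmax * g0 = Num.min (cmin * s0) (cmin * m0) * (N%:R * cmax / (2 * (N%:R * cmax + 1))).
    by rewrite /g0 mulrCA.
  have mm0 : 0 < Num.min (cmin * s0) (cmin * m0).
    by rewrite lt_min; apply/andP; split; exact: mulr_gt0.
  rewrite gtr_pMr// ltr_pdivrMr ?mul1r; first by clear -nc0; lra.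
  by apply: mulr_gt0 => //; exact: ltr_wpDl.
apply: (@landscape_strict_local_min _ L y Lam K eps d (V eps)) => //; rewrite ?ltW//.
- move=> k kN; split; first exact: lamk.
  exact: dataE.
- move=> k k3; rewrite (le_trans (eigenvalue_upper L0 k Vi V1 small eb))// lerD2l.
  by rewrite lerXn2r ?nnegrE ?freq_ge0// freq_le//; case: k k3 => [|[|[]]].
- by apply: cg => //; rewrite ge_min lexx.
- by apply: cg => //; rewrite ge_min lexx orbT.
Unshelve. all: by end_near. Qed.

Lemma landscape_has_min_upto M : \forall eps \near 0^'+, forall N, (3 <= N <= M)%N -> landscape_has_min eps N.
Proof.
elim: M => [|M IH]; first by near=> eps => N /andP[N3]; rewrite leqn0 => /eqP N0; rewrite N0 in N3.
have [M3|M3] := leqP 3 M.+1; last first.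
  by near=> eps => N /andP[N3 /(leq_trans N3)]; rewrite leqNgt ltnS -ltnS M3.
have H := landscape_has_min_small M3.
near=> eps => N /andP[N3]; rewrite leq_eqVlt ltnS => /predU1P[->|NM].
  by near: eps.
have h : forall N, (3 <= N <= M)%N -> landscape_has_min eps N by near: eps.
by apply: h; rewrite N3.
Unshelve. all: by end_near. Qed.

(** The cap 1 / eps only serves to make the maximum finite. *)
Definition safe_length (eps : R) : nat :=
  \max_(M < (Num.truncn eps^-1).+1 | `[< forall N, (3 <= N <= M)%N -> landscape_has_min eps N >]) M.

Lemma safe_lengthP eps N : (3 <= N <= safe_length eps)%N -> landscape_has_min eps N.
Proof.
rewrite /safe_length.
elim/big_ind: _ => [|m n hm hn|M /asboolP]; last exact.
  by move=> /andP[N3]; rewrite leqn0 => /eqP N0; rewrite N0 in N3.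
by move=> /andP[N3]; rewrite leq_max => /orP[h|h]; [apply: hm|apply: hn]; rewrite N3.
Qed.

Lemma safe_length_cvg : (safe_length eps)%:R @[eps --> 0^'+] --> (+oo : set_system R).
Proof.
apply/cvgryPge => A; pose M := (Num.truncn A).+1.
have AM : A <= M%:R by rewrite ltW// truncnS_gt.
have M0 : 0 < (M%:R : R)^-1 by rewrite invr_gt0 ltr0n.
near=> eps.
have e0 : 0 < eps by near: eps; exact: nbhs_right_gt.
rewrite (le_trans AM)// ler_nat.
have Me : (M < (Num.truncn eps^-1).+1)%N.
  rewrite ltnS truncn_ge_nat ?invr_ge0 ?(ltW e0)// -[M%:R]invrK lef_pV2 ?posrE//.
  by near: eps; exact: nbhs_right_le.
have h : `[< forall N, (3 <= N <= M)%N -> landscape_has_min eps N >].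
  by apply/asboolP; near: eps; exact: landscape_has_min_upto.
exact: (@leq_bigmax_cond _ _ (fun m : 'I_ _ => m : nat) (Ordinal Me)).
Unshelve. all: by end_near. Qed.

End Assembly.

Theorem theorem3 (R : realType) (L : R) (phi : R -> R) (y : R) :
  0 < L ->
  (forall t, t \in `[0, 1] -> phi t < 0) ->
  (@lebesgue_measure R).-integrable `[0, 1] (EFin \o phi) ->
  exists Neps : R -> R,
    (forall eps : R, 0 < eps ->
      forall (lambda : nat -> R) (u : nat -> R -> R),
      eigenbasis L (potential L phi y eps) lambda u ->
      forall N : nat, (3 <= N)%N -> N%:R <= Neps eps ->
      exists2 x0 : R, y <= x0 <= y + eps &
        strict_local_min (landscape L lambda u N) x0) /\
    Neps eps @[eps --> 0^'+] --> +oo.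
Proof.
move=> L0 phi0 phii; exists (fun eps => (safe_length L y phi eps)%:R); split.
  move=> eps _ lambda u eb N N3; rewrite ler_nat => NM.
  by apply: (safe_lengthP (N := N)) eb; rewrite N3.
exact: safe_length_cvg.
Qed.
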